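(* Let $(\mathbb X,\mathcal X)$ be a Borel space, $\alpha$ a $\sigma$-finite measure on $\mathbb X$, $p\in(0,1)$, and $\rho_{p,\alpha}$ the law of the Pascal point process with parameters $p,\alpha$. The operators $K^+(\varphi),K^0(\varphi),K^-(\varphi)$, $\varphi\in\mathcal C$, defined on $\mathbb D$, are a Fock representation in $L^2(\mathbf N,\mathcal N,\rho_{p,\alpha})$ of the current algebra of $su(1,1)$ with vacuum $\mathbf 1$, the constant function $1$. Moreover, with $c=\sqrt p^{\,-1}-\sqrt p$, $$K^+(\mathbf 1_{B_1})^{n_1}\cdots K^+(\mathbf 1_{B_\ell})^{n_\ell}\mathbf 1(\eta)=\prod_{j=1}^\ell c^{n_j}\mathcal M_{n_j}\big(\eta(B_j);\alpha(B_j),p\big)$$ for all $\ell\in\mathbb N$, disjoint $B_1,\ldots,B_\ell\in\mathcal X$ with $0<\alpha(B_i)<\infty$, $n_1,\ldots,n_\ell\in\mathbb N$ and $\rho_{p,\alpha}$-almost all $\eta\in\mathbf N$.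
   Context: Test functions: $\mathcal C$ is the algebra of bounded measurable $\varphi:\mathbb X\to\mathbb C$ with $\alpha(\{x:\varphi(x)\neq 0\})<\infty$. Scalar products are antilinear in the first argument. Fock representation. A family $k^\pm(\varphi),k^0(\varphi)$, $\varphi\in\mathcal C$, of operators in a Hilbert space $\mathcal H$ is a Fock representation of the $su(1,1)$ current algebra with vacuum $\Psi$ if: (i) the operators are defined on a common domain $\mathcal D$ dense in $\mathcal H$ and map $\mathcal D$ to itself; (ii) $k^+(\varphi)$ and $k^0(\varphi)$ are linear in $\varphi$, and $k^-(\varphi)$ is antilinear in $\varphi$; (iii) for all $\varphi,\theta\in\mathcal C$, on $\mathcal D$: $[k^-(\varphi),k^+(\theta)]=2k^0(\overline\varphi\theta)$, $[k^0(\varphi),k^+(\theta)]=k^+(\varphi\theta)$, $[k^0(\varphi),k^-(\theta)]=-k^-(\overline\varphi\theta)$, and $[k^\#(\varphi),k^\#(\theta)]=0$ for each $\#\in\{0,+,-\}$; (iv) for all $f,g\in\mathcal D$, $\varphi\in\mathcal C$: $\langle f,k^0(\varphi)g\rangle=\langle k^0(\overline\varphi)f,g\rangle$ and $\langle f,k^+(\varphi)g\rangle=\langle k^-(\varphi)f,g\rangle$; (v) $\Psi\in\mathcal D$, $\|\Psi\|=1$ and $k^-(\varphi)\Psi=0$ for all $\varphi\in\mathcal C$; (vi) $\Psi$ is cyclic: the linear combinations of $\Psi$ and $k^+(\varphi_1)\cdots k^+(\varphi_n)\Psi$, $n\in\mathbb N$, $\varphi_1,\ldots,\varphi_n\in\mathcal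 C$, are dense in $\mathcal H$. Pascal point process. $\mathbf N$ is the space of finite or countable sums of Dirac measures on $\mathbb X$ (including the zero measure), with the $\sigma$-algebra $\mathcal N$ generated by $\eta\mapsto\eta(B)$, $B\in\mathcal X$. With $(a)_0=1$, $(a)_n=a(a+1)\cdots(a+n-1)$, $\rho_{p,\alpha}$ is the unique probability measure on $\mathbf N$ such that: for pairwise disjoint $B_1,\ldots,B_k\in\mathcal X$, $k\ge2$, the variables $\eta(B_1),\ldots,\eta(B_k)$ are independent; if $0<\alpha(B)<\infty$ then $\rho_{p,\alpha}(\{\eta:\eta(B)=n\})=(1-p)^{\alpha(B)}\frac{p^n}{n!}(\alpha(B))_n$ for $n\in\mathbb N_0$; if $\alpha(B)=0$ or $\infty$ then $\eta(B)=0$ or $\infty$ respectively, $\rho_{p,\alpha}$-a.s. Polynomials. Write $\eta(f)=\int f\,d\eta$, $\alpha(f)=\int f\,d\alpha$. The common domain $\mathbb D$ is the set of functions $F(\eta)=P_n(\eta(\varphi_1),\ldots,\eta(\varphi_n))$, $n\in\mathbb N$, $\varphi_i\in\mathcal C$, $P_n:\mathbb C^n\to\mathbb C$ a multivariate polynomial. Operators on $\mathbb D$ ($\varphi\in\mathcal C$). With $D_x^+F(\eta)=F(\eta+\delta_x)-F(\eta)$, $D_x^-F(\eta)=F(\eta-\delta_x)-F(\eta)$ (the latter for $\eta(\{x\})\ge1$): $K^-(\varphi)F(\eta)=\frac1c\Big(\int\overline{\varphi(x)}D_x^+F(\eta)\,(\alpha+\eta)(dx)+\int\overline{\varphi(x)}D_x^-F(\eta)\,\eta(dx)\Big)$,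 $K^+(\varphi)F(\eta)=\frac1c\Big(p\int\varphi(x)F(\eta+\delta_x)\,(\eta+\alpha)(dx)+\frac1p\int\varphi(x)F(\eta-\delta_x)\,\eta(dx)\Big)-\frac1c\big(2\eta(\varphi)+\alpha(\varphi)\big)F(\eta)$, $K^0(\varphi)F(\eta)=-\frac1c\Big(\sqrt p\int\varphi(x)D_x^+F(\eta)\,(\alpha+\eta)(dx)+\frac1{\sqrt p}\int\varphi(x)D_x^-F(\eta)\,\eta(dx)\Big)+\frac12\alpha(\varphi)F(\eta)$. Meixner polynomials. For $a>0$, $p\in(0,1)$, $\mathcal M_n(x;a,p)$ are the polynomials in $x$ of degree $n$ with leading coefficient $1$ that are orthogonal with respect to the law $\nu(\{x\})=(1-p)^a(a)_xp^x/x!$ on $\mathbb N_0$. *)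

(* Defs.v *)
From HB Require Import structures.
From mathcomp Require Import all_boot all_order all_algebra.
From mathcomp Require Import all_classical all_reals all_analysis.
From mathcomp Require Import measurable_realfun.
From mathcomp Require Import ring complex.
From mathcomp.multinomials Require mpoly.

Set Implicit Arguments.
Unset Strict Implicit.
Unset Printing Implicit Defensive.

Import Order.TTheory GRing.Theory Num.Theory.
Import numFieldNormedType.Exports.

Local Open Scope classical_set_scope.
Local Open Scope ring_scope.
Local Open Scope complex_scope.
Local Open Scope quotient_scope.

Local Notation normc := ComplexField.Normc.normc.

Section complex_functions.
Context d (T : measurableType d) (R : realType).

Definition cmeasurable (f : T -> R[i]) : Prop :=
  measurable_fun [set: T] (fun x => complex.Re (f x)) /\
  measurable_fun [set: T] (fun x => complex.Im (f x)).

Definition cintegral (mu : {measure set T -> \bar R}) (f : T -> R[i]) : R[i] :=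
  (\int[mu]_x complex.Re (f x)) +i* (\int[mu]_x complex.Im (f x)).

End complex_functions.

Section test_functions.
Context d (X : measurableType d) (R : realType).
Variable alpha : {measure set X -> \bar R}.

Definition test_function (phi : X -> R[i]) : Prop :=
  [/\ cmeasurable phi,
      exists M : R, forall x, normc (phi x) <= M &
      (alpha [set x | phi x != 0%R] < +oo)%E].

End test_functions.

Section square_integrable.
Context d (T : measurableType d) (R : realType).
Variable mu : {measure set T -> \bar R}.

Definition square_integrable : {pred (T -> R[i])} := fun f =>
  `[< cmeasurable f /\ (\int[mu]_x (normc (f x) ^+ 2)%:E < +oo)%E >].

Let normc2E (z : R[i]) : normc z ^+ 2 = complex.Re z ^+ 2 + complex.Im z ^+ 2.
Proof. by case: z => a b /=; rewrite sqr_sqrtr// addr_ge0// sqr_ge0. Qed.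

Let measurable_normc2 (f : T -> R[i]) : cmeasurable f ->
  measurable_fun [set: T] (fun x => (normc (f x) ^+ 2)%:E).
Proof.
move=> [mr mi]; apply/measurable_EFinP; under eq_fun do rewrite normc2E.
by apply: measurable_funD; apply: measurable_funX.
Qed.

Lemma square_integrable_submod_closed : submod_closed square_integrable.
Proof.
split.
  apply/asboolP; split.
    by split; exact: measurable_cst.
  rewrite integral0_eq ?ltry// => x _.
  by rewrite normc2E /= expr0n /= addr0.
move=> a f g /asboolP[mf ff] /asboolP[mg fg].
have mafg : cmeasurable (a *: f + g).
  case: mf mg => mfr mfi [mgr mgi]; split.
  - rewrite (_ : (fun _ => _) = fun x => complex.Re a * complex.Re (f x)
        - complex.Im a * complex.Im (f x) + complex.Re (g x)); last first.
      by apply/funext => x; rewrite /GRing.add /GRing.scale /= raddfD/=;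
         case: a (f x) => [? ?] [].
    apply: measurable_funD => //.
    by apply: measurable_funB; apply: measurable_funM.
  - rewrite (_ : (fun _ => _) = fun x => complex.Re a * complex.Im (f x)
        + complex.Im a * complex.Re (f x) + complex.Im (g x)); last first.
      by apply/funext => x; rewrite /GRing.add /GRing.scale /= raddfD/=;
         case: a (f x) => [? ?] [].
    apply: measurable_funD => //.
    by apply: measurable_funD; apply: measurable_funM.
apply/asboolP; split => //.
pose A : R := 2 * normc a ^+ 2.
have A0 : 0 <= A by rewrite mulr_ge0// sqr_ge0.
have h0 (h : T -> R[i]) x : (0 <= (normc (h x) ^+ 2)%:E)%E.
  by rewrite lee_fin sqr_ge0.
apply: (@le_lt_trans _ _ (\int[mu]_x
   (A%:E * (normc (f x) ^+ 2)%:E + 2%:E * (normc (g x) ^+ 2)%:E))%E).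
  apply: ge0_le_integral => //.
  - exact: measurable_normc2.
  - apply: emeasurable_funD; apply: measurable_funeM; exact: measurable_normc2.
  move=> x _; rewrite -!EFinM -EFinD lee_fin /A.
  have -> : (a *: f + g) x = a * f x + g x by [].
  rewrite -mulrA -exprMn -ComplexField.Normc.normcM -mulrDr.
  set u := a * f x; set v := g x.
  rewrite !normc2E; case: u v => [a1 b1] [a2 b2] /=.
  rewrite -subr_ge0.
  have -> : 2 * (a1 ^+ 2 + b1 ^+ 2 + (a2 ^+ 2 + b2 ^+ 2))
     - ((a1 + a2) ^+ 2 + (b1 + b2) ^+ 2) = (a1 - a2) ^+ 2 + (b1 - b2) ^+ 2.
    ring.
  by rewrite addr_ge0// sqr_ge0.
rewrite ge0_integralD//.
- rewrite !ge0_integralZl_EFin//; [|exact: measurable_normc2..].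
  by apply: lte_add_pinfty; apply: lte_mul_pinfty; rewrite ?lee_fin ?fin_numE.
all: try by apply: measurable_funeM; exact: measurable_normc2.
all: by move=> x _; apply: mule_ge0; [rewrite lee_fin|exact: h0].
Qed.

HB.instance Definition _ :=
  GRing.isSubmodClosed.Build R[i] (T -> R[i]) square_integrable
    square_integrable_submod_closed.

Record square_integrable_fun := SquareIntegrableFun {
  sqint_fun :> T -> R[i] ;
  _ : sqint_fun \in square_integrable }.

HB.instance Definition _ := [isSub for sqint_fun].
HB.instance Definition _ := [Choice of square_integrable_fun by <:].
HB.instance Definition _ :=
  [SubChoice_isSubLmodule of square_integrable_fun by <:].

Definition L2eq (f g : square_integrable_fun) :=
  `[< {ae mu, forall x, f x = g x} >].

Lemma L2eq_refl : reflexive L2eq.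
Proof. by move=> f; apply/asboolP; apply: aeW. Qed.

Lemma L2eq_sym : symmetric L2eq.
Proof.
by move=> f g; apply: asbool_equiv_eq; split;
  apply: filterS => x ->.
Qed.

Lemma L2eq_trans : transitive L2eq.
Proof.
move=> g f h /asboolP fg /asboolP gh; apply/asboolP.
by apply: filterS2 fg gh => x -> ->.
Qed.

Canonical L2eq_equiv := EquivRel L2eq L2eq_refl L2eq_sym L2eq_trans.

Definition L2 : Type := {eq_quot L2eq}.

HB.instance Definition _ : EqQuotient _ L2eq L2 := EqQuotient.on L2.
HB.instance Definition _ := Choice.on L2.

Definition L2_addr (f g : L2) : L2 := \pi_L2 (repr f + repr g).
Definition L2_oppr (f : L2) : L2 := \pi_L2 (- repr f).
Definition L2_scale (a : R[i]) (f : L2) : L2 := \pi_L2 (a *: repr f).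

Lemma piL2 (f g : square_integrable_fun) :
  \pi_L2 f = \pi_L2 g <-> {ae mu, forall x, f x = g x}.
Proof.
split; first by move=> /eqP; rewrite eqmodE => /asboolP.
by move=> fg; apply/eqP; rewrite eqmodE; apply/asboolP.
Qed.

Lemma repr_L2 (f : square_integrable_fun) :
  {ae mu, forall x, repr (\pi_L2 f) x = f x}.
Proof. by apply/piL2; rewrite reprK. Qed.

Lemma L2_ind (P : L2 -> Prop) : (forall f, P (\pi_L2 f)) -> forall f, P f.
Proof. by move=> h f; rewrite -[f]reprK; apply: h. Qed.

Lemma sqintD (f g : square_integrable_fun) x : (f + g) x = f x + g x.
Proof. by have := raddfD (val : square_integrable_fun -> _) f g; move=> /= ->. Qed.

Lemma sqintN (f : square_integrable_fun) x : (- f) x = - f x.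
Proof. by have := raddfN (val : square_integrable_fun -> _) f; move=> /= ->. Qed.

Lemma sqintZ a (f : square_integrable_fun) x : (a *: f) x = a * f x.
Proof. by have := linearZ_LR (val : square_integrable_fun -> _) a f; move=> /= ->. Qed.

Lemma pi_addL2 f g : L2_addr (\pi f) (\pi g) = \pi_L2 (f + g).
Proof.
apply/piL2; apply: filterS2 (repr_L2 f) (repr_L2 g) => x fx gx.
by rewrite !sqintD fx gx.
Qed.

Lemma pi_oppL2 f : L2_oppr (\pi f) = \pi_L2 (- f).
Proof. by apply/piL2; apply: filterS (repr_L2 f) => x fx; rewrite !sqintN fx. Qed.

Lemma pi_scaleL2 a f : L2_scale a (\pi f) = \pi_L2 (a *: f).
Proof. by apply/piL2; apply: filterS (repr_L2 f) => x fx; rewrite !sqintZ fx. Qed.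

Lemma L2_addrA : associative L2_addr.
Proof.
elim/L2_ind=> f; elim/L2_ind=> g; elim/L2_ind=> h.
by rewrite (pi_addL2 g h) (pi_addL2 f g) (pi_addL2 f) (pi_addL2 _ h) addrA.
Qed.

Lemma L2_addrC : commutative L2_addr.
Proof. by elim/L2_ind=> f; elim/L2_ind=> g; rewrite (pi_addL2 f g) (pi_addL2 g f) addrC. Qed.

Lemma L2_add0r : left_id (\pi_L2 0) L2_addr.
Proof. by elim/L2_ind=> f; rewrite (pi_addL2 0 f) add0r. Qed.

Lemma L2_addNr : left_inverse (\pi_L2 0) L2_oppr L2_addr.
Proof. by elim/L2_ind=> f; rewrite (pi_oppL2 f) (pi_addL2 _ f) addNr. Qed.

HB.instance Definition _ :=
  GRing.isZmodule.Build L2 L2_addrA L2_addrC L2_add0r L2_addNr.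

Lemma L2_scalerA a b f : L2_scale a (L2_scale b f) = L2_scale (a * b) f.
Proof. by elim/L2_ind: f => f; rewrite (pi_scaleL2 b) !(pi_scaleL2 _) scalerA. Qed.

Lemma L2_scale1r : left_id 1 L2_scale.
Proof. by elim/L2_ind=> f; rewrite pi_scaleL2 scale1r. Qed.

Lemma L2_scalerDr : right_distributive L2_scale +%R.
Proof.
move=> a; elim/L2_ind=> f; elim/L2_ind=> g.
have -> : \pi_L2 f + \pi_L2 g = \pi_L2 (f + g) by exact: pi_addL2.
by rewrite !(pi_scaleL2 a) scalerDr; apply: esym; exact: pi_addL2.
Qed.

Lemma L2_scalerDl f : {morph L2_scale^~ f : a b / a + b}.
Proof.
move=> a b; elim/L2_ind: f => f.
rewrite (pi_scaleL2 (a + b)) (pi_scaleL2 a) (pi_scaleL2 b) scalerDl.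
by apply: esym; exact: pi_addL2.
Qed.

HB.instance Definition _ :=
  GRing.Zmodule_isLmodule.Build R[i] L2
    L2_scalerA L2_scale1r L2_scalerDr L2_scalerDl.

Definition L2dot (f g : L2) : R[i] :=
  cintegral mu (fun x => conjc (repr f x) * repr g x).

(* [F] is one of the functions forming the class [h]; [F] need not be
   measurable itself, but only a.e. equal to a measurable function. *)
Definition L2_class_of (F : T -> R[i]) (h : L2) : Prop :=
  {ae mu, forall x, repr h x = F x}.

End square_integrable.

Arguments L2dot {d T R} mu f g.

Section hilbert.
Context (R : realType) (H : lmodType R[i]).
Variable dot : H -> H -> R[i].

Definition hnorm (f : H) : R := Num.sqrt (complex.Re (dot f f)).

Record hilbert_space : Prop := HilbertSpace {
  hilbert_linearr : forall f a g h, dot f (a *: g + h) = a * dot f g + dot f h ;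
  hilbert_conj : forall f g, dot g f = conjc (dot f g) ;
  hilbert_definite : forall f, f != 0 -> 0 < dot f f ;
  hilbert_complete : forall u : nat -> H,
    (forall e : R, 0 < e -> exists N : nat, forall m n : nat,
       (N <= m)%N -> (N <= n)%N -> hnorm (u m - u n) < e) ->
    exists l : H, forall e : R, 0 < e -> exists N : nat, forall n : nat,
       (N <= n)%N -> hnorm (u n - l) < e }.

Definition hdense (S : set H) : Prop :=
  forall (h : H) (e : R), 0 < e -> exists2 g, S g & hnorm (h - g) < e.

Definition linear_span (S : set H) : set H :=
  [set h | exists (m : nat) (a : 'I_m -> R[i]) (v : 'I_m -> H),
     (forall i, S (v i)) /\ h = \sum_(i < m) a i *: v i].

Definition linear_subspace (D : set H) : Prop :=
  D 0 /\ forall a f g, D f -> D g -> D (a *: f + g).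

(* An operator with domain [D] is a total function, only its values on [D]
   being relevant. *)
Definition operator_on (D : set H) (A : H -> H) : Prop :=
  (forall f, D f -> D (A f)) /\
  (forall a f g, D f -> D g -> A (a *: f + g) = a *: A f + A g).

End hilbert.

Section fock.
Context d (X : measurableType d) (R : realType).
Variable alpha : {measure set X -> \bar R}.
Context (H : lmodType R[i]).
Variables (dot : H -> H -> R[i]) (D : set H).
Variables (kp k0 km : (X -> R[i]) -> H -> H) (Psi : H).

Let C := test_function alpha.

Inductive creation_vector : set H :=
| creation_vacuum : creation_vector Psi
| creation_step phi h : C phi -> creation_vector h -> creation_vector (kp phi h).

Definition commute_on (k : (X -> R[i]) -> H -> H) : Prop :=
  forall phi theta f, C phi -> C theta -> D f ->
    k phi (k theta f) - k theta (k phi f) = 0.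

Record fock_representation : Prop := FockRepresentation {
  fock_hilbert : hilbert_space dot ;
  fock_subspace : linear_subspace D ;
  fock_dense : hdense dot D ;
  fock_operators : forall phi, C phi ->
    [/\ operator_on D (kp phi), operator_on D (k0 phi) & operator_on D (km phi)] ;
  fock_linear_p : forall a phi theta f, C phi -> C theta -> D f ->
    kp (a *: phi + theta) f = a *: kp phi f + kp theta f ;
  fock_linear_0 : forall a phi theta f, C phi -> C theta -> D f ->
    k0 (a *: phi + theta) f = a *: k0 phi f + k0 theta f ;
  fock_antilinear_m : forall a phi theta f, C phi -> C theta -> D f ->
    km (a *: phi + theta) f = conjc a *: km phi f + km theta f ;
  fock_comm_mp : forall phi theta f, C phi -> C theta -> D f ->
    km phi (kp theta f) - kp theta (km phi f)
    = 2 *: k0 (fun x => conjc (phi x) * theta x) f ;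
  fock_comm_0p : forall phi theta f, C phi -> C theta -> D f ->
    k0 phi (kp theta f) - kp theta (k0 phi f)
    = kp (fun x => phi x * theta x) f ;
  fock_comm_0m : forall phi theta f, C phi -> C theta -> D f ->
    k0 phi (km theta f) - km theta (k0 phi f)
    = - km (fun x => conjc (phi x) * theta x) f ;
  fock_comm_pp : commute_on kp ;
  fock_comm_00 : commute_on k0 ;
  fock_comm_mm : commute_on km ;
  fock_adjoint_0 : forall phi f g, C phi -> D f -> D g ->
    dot f (k0 phi g) = dot (k0 (fun x => conjc (phi x)) f) g ;
  fock_adjoint_p : forall phi f g, C phi -> D f -> D g ->
    dot f (kp phi g) = dot (km phi f) g ;
  fock_vacuum_dom : D Psi ;
  fock_vacuum_norm : hnorm dot Psi = 1 ;
  fock_vacuum_annihilated : forall phi, C phi -> km phi Psi = 0 ;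
  fock_cyclic : hdense dot (linear_span creation_vector) }.

End fock.

Definition borel_space (R : realType) d (X : measurableType d) : Prop :=
  exists f : X -> R,
    [/\ measurable_fun [set: X] f, injective f,
        (range f `<=` `[0, 1]) &
        forall A : set X, measurable A -> measurable (f @` A)].

Section configurations.
Context d (X : measurableType d) (R : realType).

(* Finite sums are obtained by letting [x i = None] from some index on. The
   equality is required on all sets [B], measurable or not: [eta] is then
   determined by its point masses as soon as singletons are measurable. *)
Definition is_dirac_sum (eta : {measure set X -> \bar R}) : Prop :=
  exists x : nat -> option X, forall B : set X,
    eta B = (\sum_(0 <= i <oo) (if x i is Some y then \d_y B else 0))%E.

Record config := Config {
  config_measure :> {measure set X -> \bar R} ;
  configP : is_dirac_sum config_measure }.

Lemma is_dirac_sum0 : is_dirac_sum (@mzero _ X R).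
Proof. by exists (fun=> None) => B; rewrite eseries0. Qed.

HB.instance Definition _ := gen_eqMixin config.
HB.instance Definition _ := gen_choiceMixin config.
HB.instance Definition _ := isPointed.Build config (Config is_dirac_sum0).

Definition config_measurable : set (set config) :=
  <<s \bigcup_(B in @measurable _ X)
        preimage_set_system [set: config] (fun eta : config => eta B)
          (@measurable _ (\bar R)) >>.

Definition config_display : measure_display.
Proof. by constructor. Qed.

Let config_measurable0 : config_measurable set0.
Proof. exact: sigma_algebra0. Qed.

Let config_measurableC A : config_measurable A -> config_measurable (~` A).
Proof. exact: sigma_algebraC. Qed.

Let config_measurableU (F : (set config)^nat) :
  (forall i, config_measurable (F i)) -> config_measurable (\bigcup_i F i).
Proof. exact: sigma_algebra_bigcup. Qed.

HB.instance Definition _ :=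
  @isMeasurable.Build config_display config config_measurable
    config_measurable0 config_measurableC config_measurableU.

Lemma config_add_subproof (eta : config) (x : X) :
  is_dirac_sum (measure_add eta (\d_x : {measure set X -> \bar R})).
Proof.
case: eta => eta [y ye]; exists (fun n => if n is m.+1 then y m else Some x) => B.
transitivity (eta B + \d_x B)%E; first exact: measure_addE.
pose f n : \bar R :=
  if (if n is m.+1 then y m else Some x) is Some z then \d_z B else 0%E.
have f0 n : (0 <= f n)%E by rewrite /f; case: n => [|n] //; case: (y n).
rewrite -[RHS]/(\sum_(0 <= i <oo) f i)%E nneseries_recl// ye addeC.
by rewrite -(nneseries_addn 1 f0); under [in RHS]eq_eseriesr do rewrite addn1.
Qed.

Definition config_add (eta : config) (x : X) : config :=
  Config (config_add_subproof eta x).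

(* The configuration [zeta] with [zeta + \d_x = eta]: it is unique, and exists
   iff [eta] has a point at [x] (otherwise the value is irrelevant). *)
Definition config_sub (eta : config) (x : X) : config :=
  get [set zeta | config_add zeta x = eta].

End configurations.

Arguments config {d} X R.

Section pascal.
Context (R : realType).

Definition rising (a : R) (n : nat) : R := \prod_(i < n) (a + i%:R).

Definition pascal_pmf (p a : R) (n : nat) : R :=
  (1 - p) `^ a * (p ^+ n / n`!%:R) * rising a n.

Definition meixner_polynomials (p a : R) (M : nat -> {poly R}) : Prop :=
  [/\ forall n, size (M n) = n.+1,
      forall n, M n \is monic &
      forall m n, m != n ->
        series (fun x => pascal_pmf p a x * ((M m).[x%:R] * (M n).[x%:R]))
          @ \oo --> (0 : R)].

Context d (X : measurableType d).

Record pascal_process (p : R) (alpha : {measure set X -> \bar R})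
    (rho : probability (config X R) R) : Prop := PascalProcess {
  pascal_independent : forall (k : nat) (B : 'I_k -> set X), (2 <= k)%N ->
    (forall i, measurable (B i)) -> trivIset [set: 'I_k] B ->
    forall A : 'I_k -> set (\bar R), (forall i, measurable (A i)) ->
      (rho [set eta : config X R | forall i, A i (eta (B i))]
       = \prod_(i < k) rho [set eta : config X R | A i (eta (B i))])%E ;
  pascal_count : forall B : set X, measurable B -> (0 < alpha B < +oo)%E ->
    forall n : nat,
      rho [set eta : config X R | eta B = n%:R%:E] = (pascal_pmf p (fine (alpha B)) n)%:E ;
  pascal_null : forall B : set X, measurable B -> alpha B = 0%E ->
    {ae rho, forall eta : config X R, eta B = 0%E} ;
  pascal_infinite : forall B : set X, measurable B -> alpha B = +oo%E ->
    {ae rho, forall eta : config X R, eta B = +oo%E} }.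

End pascal.

Section operators.
Context d (X : measurableType d) (R : realType).
Variable alpha : {measure set X -> \bar R}.

Definition polynomial_fun (F : config X R -> R[i]) : Prop :=
  exists (n : nat) (P : mpoly.mpoly n R[i]) (phi : 'I_n -> X -> R[i]),
    [/\ (0 < n)%N, forall i, test_function alpha (phi i) &
        F = fun eta => mpoly.meval (fun i => cintegral eta (phi i)) P].

Definition difference_add (x : X) (F : config X R -> R[i]) eta : R[i] :=
  F (config_add eta x) - F eta.

Definition difference_sub (x : X) (F : config X R -> R[i]) eta : R[i] :=
  F (config_sub eta x) - F eta.

Variable p : R.

Definition su11_c : R := (Num.sqrt p)^-1 - Num.sqrt p.

Implicit Types (phi : X -> R[i]) (F : config X R -> R[i]) (eta : config X R).

Definition Kminus phi F eta : R[i] :=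
  su11_c^-1%:C *
    (cintegral (measure_add alpha eta)
       (fun x => conjc (phi x) * difference_add x F eta)
     + cintegral eta (fun x => conjc (phi x) * difference_sub x F eta)).

Definition Kplus phi F eta : R[i] :=
  su11_c^-1%:C *
    (p%:C * cintegral (measure_add eta alpha)
              (fun x => phi x * F (config_add eta x))
     + p^-1%:C * cintegral eta (fun x => phi x * F (config_sub eta x)))
  - su11_c^-1%:C * (2 * cintegral eta phi + cintegral alpha phi) * F eta.

Definition Kzero phi F eta : R[i] :=
  - su11_c^-1%:C *
    ((Num.sqrt p)%:C * cintegral (measure_add alpha eta)
                         (fun x => phi x * difference_add x F eta)
     + (Num.sqrt p)^-1%:C * cintegral eta
                              (fun x => phi x * difference_sub x F eta))
  + 2^-1 * cintegral alpha phi * F eta.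

Variable rho : {measure set (config X R) -> \bar R}.

Definition polynomial_domain : set (L2 rho) :=
  [set h | exists2 F, polynomial_fun F & L2_class_of F h].

(* [k] is the operator induced on classes by the pointwise formula [K]; no
   such [k] exists unless [K] is compatible with a.e. equality. *)
Definition induced_operators (K : (X -> R[i]) -> (config X R -> R[i]) ->
      config X R -> R[i]) (k : (X -> R[i]) -> L2 rho -> L2 rho) : Prop :=
  forall phi F h, test_function alpha phi -> polynomial_fun F ->
    L2_class_of F h -> L2_class_of (K phi F) (k phi h).

End operators.

Arguments polynomial_domain {d X R} alpha rho _.

(* Main.v *)
Require Import Defs.
From mathcomp Require Import all_boot all_order all_algebra.
From mathcomp Require Import all_classical all_reals all_analysis.
From mathcomp Require Import measurable_realfun.
From mathcomp Require Import zify ring lra complex.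
From mathcomp.multinomials Require mpoly.

Set Implicit Arguments.
Unset Strict Implicit.
Unset Printing Implicit Defensive.

Import Order.TTheory GRing.Theory Num.Theory.
Import numFieldNormedType.Exports.

Local Open Scope classical_set_scope.
Local Open Scope ring_scope.
Local Open Scope complex_scope.

Local Notation normc := ComplexField.Normc.normc.
Local Notation Re := complex.Re.
Local Notation Im := complex.Im.


(** Why the theorem holds.

    Algebra. For a test function [phi], let [raise phi] average [F] over the
    configurations with one more point, [lower phi] over those with one point
    less, and [number phi] multiply by [eta(phi)]. Shifted by half of
    [alpha(phi)], the multiplications together with [raise] and [lower] form a
    current algebra of sl2, and the operators of the theorem are the three
    combinations [kplus], [kzero] and [kminus] of them. The relations need no
    rearrangement of multiple integrals: moving [number psi] across [raise phi] or
    [lower phi] costs one correction term, because a new point adds [psi x] to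
    [eta(psi)] ([raise_number], [lower_number]); products of numbers applied to the
    constant function span the polynomials, so these two rules and the values on
    the constant determine everything ([current_bracket]). All this takes place
    in a region [S] of finite mass containing the supports involved. Almost every
    configuration is finite there, and extending functions by zero to the others
    turns the relations into equalities of functions.

    Adjoints. The recursion [(n + 1) nu(n + 1) = p (n + a) nu(n)] of the
    negative binomial weights is Mecke's equation for functions of finitely many
    counts ([mecke_counts]), and passes to polynomials by approximating test
    functions by functions with finitely many values ([mecke_pol]). It says that
    [lower phi] is [p] times the transpose of [raise phi] ([pairing_lower]), hence the adjoint
    relations. It also shows that the pointwise operators respect almost
    everywhere equality: the image of a null polynomial is orthogonal to all
    polynomials and is one itself ([current_null]).

    Density. A square integrable function orthogonal to the polynomials has
    vanishing moments with respect to every count. Counts have exponential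
    moments, so that the moment problem is determinate ([weighted_count_eq]), and
    the function has integral zero over all events prescribing finitely many
    counts; these form a pi-system generating the sigma-algebra
    ([orthogonal_polynomials0]). Completeness of the space of classes
    ([L2_complete]) turns this into density ([hdense_orthogonal]).

    Cyclicity. Multiplication by [eta(phi)] is a linear combination of the three
    currents and the identity, and the span of the creation vectors is invariant under all
    three by the commutation relations; it therefore contains every polynomial
    ([pol_span]).

    Meixner polynomials. On products of functions of the counts in disjoint cells
    the creation operator of one cell acts on one variable, by a difference
    operator multiplying the leading coefficient by [c] and raising the degree by
    one, whose transpose lowers the degree. Its iterates on [1] are therefore
    orthogonal ([creation_poly_orthogonal]), and orthogonal polynomials are
    determined by their leading coefficients ([meixner_creation_poly]). *)

(** * Complex integrals of bounded functions with support of finite measure *)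

Section complex_basics.
Context (R : realType).
Implicit Types z w : R[i].

Lemma complex_eqP z w : Re z = Re w -> Im z = Im w -> z = w.
Proof. by case: z w => [a b] [c d] /= -> ->. Qed.

Lemma ReD z w : Re (z + w) = Re z + Re w. Proof. by case: z w => [? ?] []. Qed.
Lemma ImD z w : Im (z + w) = Im z + Im w. Proof. by case: z w => [? ?] []. Qed.
Lemma ReN z : Re (- z) = - Re z. Proof. by case: z. Qed.
Lemma ImN z : Im (- z) = - Im z. Proof. by case: z. Qed.
Lemma ReM z w : Re (z * w) = Re z * Re w - Im z * Im w.
Proof. by case: z w => [? ?] []. Qed.
Lemma ImM z w : Im (z * w) = Re z * Im w + Im z * Re w.
Proof. by case: z w => [? ?] []. Qed.
Lemma Re_conj z : Re (conjc z) = Re z. Proof. by case: z. Qed.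
Lemma Im_conj z : Im (conjc z) = - Im z. Proof. by case: z. Qed.

Lemma conjcD z w : conjc (z + w) = conjc z + conjc w. Proof. exact: rmorphD. Qed.
Lemma conjcN z : conjc (- z) = - conjc z. Proof. exact: rmorphN. Qed.
Lemma conjcM z w : conjc (z * w) = conjc z * conjc w. Proof. exact: rmorphM. Qed.
Lemma conjcV z : conjc z^-1 = (conjc z)^-1. Proof. exact: fmorphV. Qed.
Lemma conjc0 : conjc 0 = 0 :> R[i]. Proof. exact: rmorph0. Qed.
Lemma conjc1 : conjc 1 = 1 :> R[i]. Proof. exact: rmorph1. Qed.
Lemma conjc_nat n : conjc n%:R = n%:R :> R[i]. Proof. exact: rmorph_nat. Qed.
Lemma conjc_sum (I : Type) (s : seq I) (f : I -> R[i]) :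
  conjc (\sum_(i <- s) f i) = \sum_(i <- s) conjc (f i).
Proof. exact: rmorph_sum. Qed.

Definition ReImE := (ReD, ImD, ReN, ImN, ReM, ImM, Re_conj, Im_conj).

Lemma normc_ge0 z : 0 <= normc z.
Proof. by case: z => a b /=; rewrite sqrtr_ge0. Qed.

Lemma normr_Re_le z : `|Re z| <= normc z.
Proof.
by case: z => a b /=; rewrite -sqrtr_sqr ler_sqrt ?lerDl ?sqr_ge0// addr_ge0 ?sqr_ge0.
Qed.

Lemma normr_Im_le z : `|Im z| <= normc z.
Proof.
by case: z => a b /=; rewrite -sqrtr_sqr ler_sqrt ?lerDr ?sqr_ge0// addr_ge0 ?sqr_ge0.
Qed.

Lemma normc_sqr z : normc z ^+ 2 = Re z ^+ 2 + Im z ^+ 2.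
Proof. by case: z => a b /=; rewrite sqr_sqrtr// addr_ge0// sqr_ge0. Qed.

Lemma normc_le z : normc z <= `|Re z| + `|Im z|.
Proof.
rewrite -(ler_pXn2r (_ : 0 < 2)%N) ?nnegrE ?normc_ge0 ?addr_ge0//.
rewrite normc_sqr sqrrD !real_normK ?num_real// addrAC lerDl.
by rewrite mulrn_wge0// mulr_ge0.
Qed.

Lemma normc_conj z : normc (conjc z) = normc z.
Proof. by case: z => a b /=; rewrite sqrrN. Qed.

Lemma normc_real (x : R) : normc x%:C = `|x|.
Proof. by rewrite /= expr0n addr0 sqrtr_sqr. Qed.

End complex_basics.

Section complex_integral.
Context d (T : measurableType d) (R : realType).
Implicit Types (mu : {measure set T -> \bar R}) (f g : T -> R[i]).

Definition cintegrable mu f :=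
  mu.-integrable setT (EFin \o (fun x => Re (f x))) /\
  mu.-integrable setT (EFin \o (fun x => Im (f x))).

Lemma eq_cintegral mu f g : f =1 g -> cintegral mu f = cintegral mu g.
Proof. by move=> /funext ->. Qed.

Lemma cmeasurable_cst (a : R[i]) : cmeasurable (fun _ : T => a).
Proof. by split; exact: measurable_cst. Qed.

Lemma cmeasurableD f g : cmeasurable f -> cmeasurable g ->
  cmeasurable (fun x => f x + g x).
Proof.
move=> [f1 f2] [g1 g2]; split.
  by under eq_fun do rewrite ReD; exact: measurable_funD.
by under eq_fun do rewrite ImD; exact: measurable_funD.
Qed.

Lemma cmeasurableM f g : cmeasurable f -> cmeasurable g ->
  cmeasurable (fun x => f x * g x).
Proof.
move=> [f1 f2] [g1 g2]; split.
  by under eq_fun do rewrite ReM; apply: measurable_funB; exact: measurable_funM.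
by under eq_fun do rewrite ImM; apply: measurable_funD; exact: measurable_funM.
Qed.

Lemma cmeasurable_conj f : cmeasurable f -> cmeasurable (fun x => conjc (f x)).
Proof.
move=> [f1 f2]; split; first by under eq_fun do rewrite Re_conj.
by under eq_fun do rewrite Im_conj; exact: measurableT_comp.
Qed.

Lemma cmeasurable_normc f : cmeasurable f -> measurable_fun setT (fun x => normc (f x)).
Proof.
move=> [f1 f2]; rewrite (_ : (fun _ => _) =
  Num.sqrt \o (fun x => Re (f x) ^+ 2 + Im (f x) ^+ 2)); last first.
  by apply/funext => x /=; case: (f x).
apply: measurableT_comp; first exact: (continuous_measurable_fun (@sqrt_continuous R)).
by apply: measurable_funD; exact: measurable_funX.
Qed.

Lemma cintegrableD mu f g : cintegrable mu f -> cintegrable mu g ->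
  cintegrable mu (fun x => f x + g x).
Proof.
move=> [f1 f2] [g1 g2]; split.
  rewrite (_ : _ \o _ = (EFin \o (fun x => Re (f x))) \+ (EFin \o (fun x => Re (g x)))).
    exact: integrableD.
  by apply/funext => x /=; rewrite ReD.
rewrite (_ : _ \o _ = (EFin \o (fun x => Im (f x))) \+ (EFin \o (fun x => Im (g x)))).
  exact: integrableD.
by apply/funext => x /=; rewrite ImD.
Qed.

Lemma cintegralD mu f g : cintegrable mu f -> cintegrable mu g ->
  cintegral mu (fun x => f x + g x) = cintegral mu f + cintegral mu g.
Proof.
move=> [f1 f2] [g1 g2]; apply: complex_eqP; rewrite !ReImE /=.
  by under eq_Rintegral do rewrite ReD; rewrite RintegralD.
by under eq_Rintegral do rewrite ImD; rewrite RintegralD.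
Qed.

Lemma integrable_scale mu (h : T -> R) (a : R) :
  mu.-integrable setT (EFin \o h) ->
  mu.-integrable setT (EFin \o (fun x => a * h x)).
Proof.
move=> ih; rewrite (_ : _ \o _ = fun x => (a%:E * (EFin \o h) x)%E).
  exact: integrableZl.
by apply/funext => x /=; rewrite EFinM.
Qed.

Lemma integrable_addr mu (h k : T -> R) :
  mu.-integrable setT (EFin \o h) -> mu.-integrable setT (EFin \o k) ->
  mu.-integrable setT (EFin \o (fun x => h x + k x)).
Proof.
move=> ih ik; rewrite (_ : _ \o _ = (EFin \o h) \+ (EFin \o k)) //.
exact: integrableD.
Qed.

Lemma cintegrableZ mu (a : R[i]) f : cintegrable mu f ->
  cintegrable mu (fun x => a * f x).
Proof.
move=> [f1 f2]; split.
  rewrite (_ : _ \o _ = EFin \o (fun x => Re a * Re (f x) + - Im a * Im (f x))).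
    by apply: integrable_addr; exact: integrable_scale.
  by apply/funext => x /=; rewrite ReM mulNr.
rewrite (_ : _ \o _ = EFin \o (fun x => Re a * Im (f x) + Im a * Re (f x))).
  by apply: integrable_addr; exact: integrable_scale.
by apply/funext => x /=; rewrite ImM.
Qed.

Lemma cintegralZ mu (a : R[i]) f : cintegrable mu f ->
  cintegral mu (fun x => a * f x) = a * cintegral mu f.
Proof.
move=> [f1 f2]; apply: complex_eqP; rewrite !ReImE /=.
  under eq_Rintegral do rewrite ReM -mulNr.
  rewrite RintegralD//; [|exact: integrable_scale..].
  by rewrite !RintegralZl// mulNr.
under eq_Rintegral do rewrite ImM.
rewrite RintegralD//; [|exact: integrable_scale..].
by rewrite !RintegralZl.
Qed.

Lemma cintegral_lin mu a f g :
  cintegrable mu f -> cintegrable mu g ->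
  cintegral mu (fun x => a * f x + g x) = a * cintegral mu f + cintegral mu g.
Proof.
move=> if_ ig; rewrite cintegralD//; last exact: cintegrableZ.
by rewrite cintegralZ.
Qed.

Lemma cintegral_conj mu f : cintegrable mu f ->
  cintegral mu (fun x => conjc (f x)) = conjc (cintegral mu f).
Proof.
move=> [f1 f2]; apply: complex_eqP; rewrite !ReImE /=.
  by under eq_Rintegral do rewrite Re_conj.
by under eq_Rintegral do rewrite Im_conj -mulN1r; rewrite RintegralZl// mulN1r.
Qed.

Lemma cintegral0 mu : cintegral mu (fun=> 0) = 0.
Proof. by rewrite /cintegral /= !Rintegral_cst// !mul0r. Qed.

Lemma cintegral_measure_add (mu nu : {measure set T -> \bar R}) f :
  cintegrable mu f -> cintegrable nu f ->
  cintegral (measure_add mu nu) f = cintegral mu f + cintegral nu f.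
Proof.
move=> [f1 f2] [g1 g2]; apply: complex_eqP; rewrite !ReImE /= /Rintegral.
  by rewrite integral_measure_add// fineD//; exact: integrable_fin_num.
by rewrite integral_measure_add// fineD//; exact: integrable_fin_num.
Qed.

Lemma cintegrable_dominated mu f (g : T -> R) : cmeasurable f ->
  mu.-integrable setT (EFin \o g) -> (forall x, normc (f x) <= g x) ->
  cintegrable mu f.
Proof.
move=> [m1 m2] ig fg; split.
  apply: le_integrable ig => //; first exact/measurable_EFinP.
  move=> x _ /=; rewrite lee_fin (le_trans (normr_Re_le _))//.
  by rewrite (le_trans (fg x))// ler_norm.
apply: le_integrable ig => //; first exact/measurable_EFinP.
move=> x _ /=; rewrite lee_fin (le_trans (normr_Im_le _))//.
by rewrite (le_trans (fg x))// ler_norm.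
Qed.

(** Bounded measurable functions vanishing off [S] form an algebra; when [S]
    has finite measure they are the test functions supported by [S]. *)
Definition test_on (S : set T) f : Prop :=
  [/\ cmeasurable f, exists M : R, forall x, normc (f x) <= M &
      forall x, ~ S x -> f x = 0].

(** The integrands met below are a test function times a function of this kind. *)
Definition cbounded f : Prop :=
  cmeasurable f /\ exists M : R, forall x, normc (f x) <= M.

Lemma integrable_finite_indic mu (S : set T) : measurable S -> (mu S < +oo)%E ->
  mu.-integrable setT (EFin \o (\1_S : T -> R)).
Proof.
move=> mS fS; apply/integrableP; split; first exact/measurable_EFinP.
rewrite (eq_integral (fun x => (\1_S x)%:E)); last first.
  by move=> t _; rewrite gee0_abs// lee_fin.
by rewrite integral_indic// setIT.
Qed.

Lemma cintegrable_test_on mu S f : measurable S -> (mu S < +oo)%E ->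
  test_on S f -> cintegrable mu f.
Proof.
move=> mS fS [mf [M fM] f0]; apply: (@cintegrable_dominated _ _ (fun x => M * \1_S x)) => //.
  by apply: integrable_scale; exact: integrable_finite_indic.
move=> x; rewrite indicE; case: (pselect (S x)) => Sx.
  by rewrite mem_set// mulr1.
by rewrite f0// memNset// mulr0 ComplexField.Normc.normc0.
Qed.

Lemma cbounded_cst (a : R[i]) : cbounded (fun=> a).
Proof. by split; [exact: cmeasurable_cst|exists (normc a)]. Qed.

Lemma cboundedD f g : cbounded f -> cbounded g -> cbounded (fun x => f x + g x).
Proof.
move=> [mf [M fM]] [mg [N gN]]; split; first exact: cmeasurableD.
exists (M + N) => x; apply: le_trans (le_normcD _ _) _.
by rewrite lerD.
Qed.

Lemma cboundedM f g : cbounded f -> cbounded g -> cbounded (fun x => f x * g x).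
Proof.
move=> [mf [M fM]] [mg [N gN]]; split; first exact: cmeasurableM.
exists (M * N) => x; rewrite ComplexField.Normc.normcM.
by rewrite ler_pM ?normc_ge0.
Qed.

Lemma test_on_cbounded S f : test_on S f -> cbounded f.
Proof. by case. Qed.

Lemma test_onM S f g : test_on S f -> cbounded g -> test_on S (fun x => f x * g x).
Proof.
move=> tf bg; have [mfg bfg] := cboundedM (test_on_cbounded tf) bg.
by split=> // x Sx; case: tf => _ _ ->//; rewrite mul0r.
Qed.

Lemma test_onD S f g : test_on S f -> test_on S g -> test_on S (fun x => f x + g x).
Proof.
move=> tf tg.
have [mfg bfg] := cboundedD (test_on_cbounded tf) (test_on_cbounded tg).
split=> // x Sx; case: tf tg => _ _ f0 [_ _ g0].
by rewrite f0// g0// addr0.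
Qed.

Lemma test_onZ S a f : test_on S f -> test_on S (fun x => a * f x).
Proof.
move=> tf; under [X in test_on _ X]eq_fun do rewrite mulrC.
by apply: test_onM => //; exact: cbounded_cst.
Qed.

Lemma test_onMt S f g : test_on S f -> test_on S g -> test_on S (fun x => f x * g x).
Proof. by move=> tf /test_on_cbounded; exact: test_onM. Qed.

Lemma test_on_conj S f : test_on S f -> test_on S (fun x => conjc (f x)).
Proof.
move=> [mf [M fM] f0]; split; first exact: cmeasurable_conj.
  by exists M => x; rewrite normc_conj.
by move=> x Sx; rewrite f0// /= oppr0.
Qed.

Lemma test_on0 S : test_on S (fun=> 0).
Proof. by have [? ?] := cbounded_cst 0; split. Qed.

End complex_integral.

(** * Point configurations: integrals as finite sums, adding and removing a point *)

Section borel.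
Context (R : realType) d (X : measurableType d).

Lemma borel_space_measurable_set1 : borel_space R X -> forall x : X, measurable [set x].
Proof.
move=> [f [mf fI _ _]] x.
rewrite (_ : [set x] = f @^-1` [set f x]); last first.
  by apply/seteqP; split=> y /=; [move=> ->|move/fI].
by rewrite -[X in measurable X]setTI; apply: mf => //; exact: measurable_set1.
Qed.

End borel.

Section dirac_sums.
Context d (X : measurableType d) (R : realType).

Fixpoint dirac_seq (s : seq X) : {measure set X -> \bar R} :=
  if s is x :: s' then measure_add (\d_x : {measure set X -> \bar R}) (dirac_seq s')
  else mzero.

Lemma dirac_seqE (s : seq X) A : dirac_seq s A = (\sum_(x <- s) \d_x A)%E.
Proof.
elim: s => [|x s ih]; first by rewrite big_nil.
by rewrite big_cons -ih /=; exact: measure_addE.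
Qed.

Lemma cintegrable_dirac (f : X -> R[i]) x : cmeasurable f ->
  cintegrable (\d_x : {measure set X -> \bar R}) f.
Proof.
have H (g : X -> R) : measurable_fun setT g ->
    (\d_x : {measure set X -> \bar R}).-integrable setT (EFin \o g).
  move=> mg; apply/integrableP; split; first exact/measurable_EFinP.
  rewrite integral_dirac//; last by do 2!apply: measurableT_comp => //.
  by rewrite /= diracT mul1e ltry.
by case=> m1 m2; split; exact: H.
Qed.

Lemma cintegral_dirac (f : X -> R[i]) x : cmeasurable f ->
  cintegral (\d_x : {measure set X -> \bar R}) f = f x.
Proof.
case=> m1 m2; apply: complex_eqP; rewrite /= /Rintegral integral_dirac//=;
  by [rewrite indicE in_setT mul1r|exact/measurable_EFinP].
Qed.

Lemma cintegral_dirac_seq (f : X -> R[i]) s : cmeasurable f ->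
  cintegrable (dirac_seq s) f /\ cintegral (dirac_seq s) f = \sum_(x <- s) f x.
Proof.
move=> mf; elim: s => [|x s [ih1 ih2]].
  rewrite big_nil; split; last first.
    by apply: complex_eqP => /=; rewrite /Rintegral integral_measure_zero.
  case: mf => m1 m2; split; apply/integrableP; split;
    by [exact/measurable_EFinP|rewrite integral_measure_zero ?ltry].
have idf : cintegrable (\d_x : {measure set X -> \bar R}) f by exact: cintegrable_dirac.
rewrite big_cons; split; last first.
  by rewrite [LHS]cintegral_measure_add// ih2 cintegral_dirac.
case: idf ih1 => [/integrableP[m1 l1] /integrableP[m2 l2]].
move=> [/integrableP[n1 k1] /integrableP[n2 k2]].
split; apply/integrableP; (split; first by []);
  rewrite [X in (X < _)%E]ge0_integral_measure_add//; first 1 last.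
- exact: measurableT_comp.
- exact: lte_add_pinfty.
- exact: measurableT_comp.
- exact: lte_add_pinfty.
Qed.

(** The integral of a function vanishing off [S] only depends on the restriction of
    the measure to [S], and there the measure is a finite sum of point masses. *)
Lemma dirac_seq_restrict_integral (mu : {measure set X -> \bar R}) (S : set X)
    (s : seq X) (f : X -> R[i]) :
  measurable S -> (forall A, measurable A -> mu (A `&` S) = dirac_seq s A) ->
  (forall x, x \in s -> S x) -> cmeasurable f -> (forall x, ~ S x -> f x = 0) ->
  cintegral mu f = \sum_(x <- s) f x.
Proof.
move=> mS mus sS mf f0; have [_ <-] := cintegral_dirac_seq s mf.
have H (g : X -> R) : (forall x, ~ S x -> g x = 0) ->
    \int[mu]_x g x = \int[dirac_seq s]_x g x.
  move=> g0; rewrite /Rintegral; congr fine.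
  rewrite (_ : (fun x => (g x)%:E) = (EFin \o g) \_ S); last first.
    apply/funext => x; rewrite patchE; case: ifPn => // /negP; rewrite inE => /g0 /=.
    by move=> ->.
  rewrite -!integral_mkcond; apply: eq_measure_integral => A mA AS.
  by rewrite -mus// setIidl.
by apply: complex_eqP => /=; apply: H => x /f0 ->.
Qed.

End dirac_sums.

Section configurations.
Context d (X : measurableType d) (R : realType).
Hypothesis msing : forall x : X, measurable [set x].
Implicit Types (eta zeta : config X R) (S : set X) (f phi : X -> R[i]).

(** Being a sum of point masses is a proposition, so that the measure determines the
    configuration. *)
Lemma config_eq eta zeta : (forall B : set X, eta B = zeta B) -> eta = zeta.
Proof.
case: eta zeta => [m pm] [n pn] /= mn.
have {}mn : m = n by apply: eq_measure; apply/funext.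
by subst n; congr Config; exact: Prop_irrelevance.
Qed.

Lemma config_addE eta x B : config_add eta x B = (eta B + \d_x B)%E.
Proof. exact: measure_addE. Qed.

Definition is_points S eta (s : seq X) :=
  (forall x, x \in s -> S x) /\
  forall A, eta (A `&` S) = (\sum_(x <- s) \d_x A)%E.

(** The masses given to [S] by the successive points are 0 or 1 and have a finite
    sum, so that they vanish from some index on. *)
Lemma exists_points S eta : (eta S < +oo)%E -> exists s, is_points S eta s.
Proof.
case: eta => eta [y yE] /= fS.
pose u (B : set X) i : \bar R := if y i is Some z then \d_z B else 0%E.
have u0 B i : (0 <= u B i)%E by rewrite /u; case: (y i).
have [N HN] : exists N, forall i, (N <= i)%N -> u S i = 0%E.
  have := @nneseries_tail_cvg R (u S) xpredT.
  rewrite -[X in (X < _)%E]yE => /(_ fS (fun i _ => u0 S i)).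
  move=> /fine_cvgP [fin_num /cvgrPdist_lt /(_ 1 ltr01)].
  move=> near1; have [N _ HN] := filterI fin_num near1.
  exists N => i Ni; have [/= ffin] := HN _ Ni.
  rewrite sub0r normrN ger0_norm ?fine_ge0 ?nneseries_ge0//.
  rewrite -lte_fin fineK// => lt1.
  have : (u S i < 1)%E.
    apply: le_lt_trans lt1.
    by rewrite (@nneseries_split _ _ i 1)// addn1 big_nat1 leeDl// nneseries_ge0.
  rewrite /u; case: (y i) => // z; rewrite diracE; case: (z \in S) => //=.
  by rewrite lte_fin ltxx.
(* Only the first [N] points can lie in [S]. *)
pose s := [seq x <- pmap y (iota 0 N) | x \in S].
exists s; split; first by move=> x; rewrite mem_filter => /andP[/set_mem].
move=> A; rewrite yE (nneseries_split_cond 0 N)//; last by move=> k _; exact: (u0 (A `&` S)).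
rewrite [X in (_ + X)%E]eseries0 ?adde0 ?add0n; last first.
  move=> i Ni _; have := HN _ Ni; rewrite /u; case: (y i) => // z.
  rewrite !diracE in_setI; case: (z \in S) => //=; last by rewrite andbF.
  by move=> /eqP; rewrite eqe oner_eq0.
rewrite /index_iota subn0 /s big_filter; elim: (iota 0 N) => [|i t ih].
  by rewrite !big_nil.
rewrite big_cons ih /=; case: (y i) => [z|]/=; last by rewrite add0e.
rewrite big_cons !diracE in_setI; case: (z \in S) => /=; first by rewrite andbT.
by rewrite andbF add0e.
Qed.

Definition points S eta : seq X := xget [::] [set s | is_points S eta s].

Lemma pointsP S eta : (eta S < +oo)%E -> is_points S eta (points S eta).
Proof. by move=> /exists_points h; exact: (xgetPex [::] h). Qed.

Lemma cintegral_points S eta f : measurable S -> (eta S < +oo)%E ->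
  cmeasurable f -> (forall x, ~ S x -> f x = 0) ->
  cintegral eta f = \sum_(x <- points S eta) f x.
Proof.
move=> mS /pointsP[h1 h2] mf f0.
by apply: dirac_seq_restrict_integral mf f0 => // A _; rewrite dirac_seqE h2.
Qed.

Lemma config_add_fin S eta x : (eta S < +oo)%E -> (config_add eta x S < +oo)%E.
Proof.
by move=> fS; rewrite config_addE lte_add_pinfty// diracE; case: (_ \in _); rewrite ltry.
Qed.

Lemma cintegral_config_add S eta x f : measurable S -> (eta S < +oo)%E ->
  test_on S f -> cintegral (config_add eta x) f = cintegral eta f + f x.
Proof.
move=> mS fS tf; rewrite [LHS]cintegral_measure_add.
- by rewrite cintegral_dirac//; case: tf.
- exact: cintegrable_test_on tf.
- by apply: cintegrable_dirac; case: tf.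
Qed.

(** Erasing one occurrence of [x] from an enumeration of the points gives the
    configuration whose existence is needed. *)
Lemma config_subK S eta x : (eta S < +oo)%E -> x \in points S eta ->
  config_add (config_sub eta x) x = eta.
Proof.
move=> /pointsP[sS etaS] xs.
suff [zeta zE] : exists zeta, config_add zeta x = eta.
  by rewrite /config_sub; apply: (getI (P := [set z | config_add z x = eta])) zE.
have := etaS [set x].
case: (configP eta) => y yE; pose u (B : set X) i : \bar R :=
  if y i is Some z then \d_z B else 0%E.
have u0 B i : (0 <= u B i)%E by rewrite /u; case: (y i).
move=> eta1; have [i0 yi0] : exists i0, y i0 = Some x.
  apply: contrapT => nex; move: eta1; rewrite yE eseries0; last first.
    move=> i _ _; case yi : (y i) => [z|//]; rewrite diracE memNset// => -[/= zx _].
    by apply: nex; exists i; rewrite yi zx.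
  move=> /esym/eqP; rewrite (big_rem x xs)/= padde_eq0 ?sume_ge0//.
  by rewrite diracE mem_set//= eqe oner_eq0.
(* [zm] enumerates the points of [eta] except the one of index [i0]. *)
pose y' i := if i == i0 then None else y i.
pose m i : {measure set X -> \bar R} := if y' i is Some z then \d_z else mzero.
pose zm : {measure set X -> \bar R} := mseries m 0.
have zmE (B : set X) : zm B = (\sum_(0 <= i <oo) (if y' i is Some z then \d_z B else 0))%E.
  by apply: eq_eseriesr => i _; rewrite /m; case: (y' i).
have zmd : is_dirac_sum zm by exists y'.
exists (Config zmd); apply: config_eq => B; rewrite config_addE /= yE zmE.
have -> : (\d_x B = \sum_(0 <= i <oo) (if i == i0 then \d_x B else 0) :> \bar R)%E.
  rewrite (nneseries_split 0 i0.+1); last by move=> k _; case: ifP.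
  rewrite add0n big_nat_recr//= eqxx big_nat_cond big1 ?add0e.
    rewrite eseries0 ?adde0// => i + _; case: eqP => // ->; by rewrite ltnn.
  by move=> i /andP[/andP[_ ii]] _; rewrite ltn_eqF.
rewrite -nneseriesD//.
- apply: eq_eseriesr => i _; rewrite /y'; case: eqP => [->|_]; last by rewrite adde0.
  by rewrite yi0 add0e.
- by move=> i _ _; case: (y' i).
- by move=> i _ _; case: eqP.
Qed.

Lemma config_sub_fin S S' eta x : (eta S < +oo)%E -> x \in points S eta ->
  (eta S' < +oo)%E -> (config_sub eta x S' < +oo)%E.
Proof.
move=> fS xs; rewrite -[in X in X -> _](config_subK fS xs) config_addE.
by apply: le_lt_trans; rewrite leeDl.
Qed.

Lemma cintegral_config_sub S eta x f : measurable S -> (eta S < +oo)%E ->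
  x \in points S eta ->
  test_on S f -> cintegral (config_sub eta x) f = cintegral eta f - f x.
Proof.
move=> mS fS xs tf; rewrite -[in RHS](config_subK fS xs) (cintegral_config_add (S := S))//.
  by rewrite addrK.
exact: (config_sub_fin fS xs fS).
Qed.

(** Removing a point is meaningful only at the finitely many points of [eta] in
    [S]; elsewhere [config_sub] takes a junk value not depending on the point,
    so that the integrand is still measurable. *)
Lemma cintegral_sub_points S eta (F : config X R -> R[i]) phi :
  measurable S -> (eta S < +oo)%E -> test_on S phi ->
  cintegral eta (fun x => phi x * F (config_sub eta x)) =
  \sum_(x <- points S eta) phi x * F (config_sub eta x).
Proof.
move=> mS fS tphi; case: (tphi) => mphi _ phi0.
apply: (cintegral_points mS fS); last by move=> x /phi0 ->; rewrite mul0r.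
pose a := F point; pose s := undup (points S eta).
(* The integrand is [phi x * F point], corrected at the points of [eta]. *)
rewrite (_ : (fun x => _) = (fun x => phi x * a + \sum_(z <- s)
    (\1_[set z] x)%:C * (phi z * F (config_sub eta z) - phi z * a))).
  apply: cmeasurableD; first by apply: cmeasurableM => //; exact: cmeasurable_cst.
  elim: s => [|z s ih].
    by under eq_fun do rewrite big_nil; exact: cmeasurable_cst.
  under eq_fun do rewrite big_cons; apply: cmeasurableD => //.
  apply: cmeasurableM; last exact: cmeasurable_cst.
  by split; [exact: measurable_indic|exact: measurable_cst].
apply/funext => x; have [xs|xs] := boolP (x \in s).
  rewrite (big_rem x xs)/= indicE mem_set// mul1r big1_seq; last first.
    move=> z /andP[_]; rewrite mem_rem_uniq ?undup_uniq// inE => /andP[zx _].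
    by rewrite indicE memNset ?mul0r// => /= /esym/eqP; rewrite (negbTE zx).
  by rewrite addr0 addrC subrK.
rewrite big1_seq ?addr0; last first.
  move=> z /andP[_ zs]; rewrite indicE memNset ?mul0r// => /= xz.
  by move: xs; rewrite xz zs.
have [Sx|Sx] := pselect (S x); last by rewrite phi0// !mul0r.
congr (_ * F _); rewrite /config_sub getPN// => zeta /= zx.
have [_ /(_ [set x])] := pointsP fS; rewrite -zx config_addE.
rewrite big1_seq; last first.
  move=> z /andP[_ zs]; rewrite diracE memNset// => /= xz.
  by move: xs; rewrite -xz mem_undup -zx zs.
move=> /eqP; rewrite padde_eq0//.
rewrite diracE mem_set//= andbC eqe oner_eq0//.
Qed.

End configurations.

(** * Commutation relations from the action on a vacuum *)

Section abstract_current_algebra.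
Context (K : numFieldType) (T Y : Type).
Variables (mul : T -> T -> T) (ok : T -> Prop) (D : (Y -> K) -> Prop).
Variables (num up dn : T -> (Y -> K) -> Y -> K) (b : T -> K) (vac : Y -> K).

Implicit Types (a : K) (f g : Y -> K) (s t : T).

Definition linear_on (A : (Y -> K) -> Y -> K) :=
  forall a f g, D f -> D g -> A (a *: f + g) = a *: A f + A g.

(** Raising and lowering operators are determined by their commutators with the
    commuting operators [num] and by their action on the vacuum, because the
    vectors [num t1 (... (num tn vac))] span the domain. *)
Record current_action : Prop := CurrentAction {
  ca_ok : forall s t, ok s -> ok t -> ok (mul s t) ;
  ca_mulC : commutative mul ;
  ca_mulA : associative mul ;
  ca_vac : D vac ;
  ca_lin : forall a f g, D f -> D g -> D (a *: f + g) ;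
  ca_ind : forall P : (Y -> K) -> Prop, P vac ->
    (forall t f, ok t -> D f -> P f -> P (num t f)) ->
    (forall a f g, D f -> P f -> D g -> P g -> P (a *: f + g)) ->
    forall f, D f -> P f ;
  ca_num : forall t f, ok t -> D f -> D (num t f) ;
  ca_up : forall t f, ok t -> D f -> D (up t f) ;
  ca_dn : forall t f, ok t -> D f -> D (dn t f) ;
  ca_num_lin : forall t, ok t -> linear_on (num t) ;
  ca_up_lin : forall t, ok t -> linear_on (up t) ;
  ca_dn_lin : forall t, ok t -> linear_on (dn t) ;
  ca_num_num : forall s t f, num s (num t f) = num t (num s f) ;
  ca_up_num : forall s t f, ok s -> ok t -> D f ->
    up s (num t f) = num t (up s f) + up (mul s t) f ;
  ca_dn_num : forall s t f, ok s -> ok t -> D f ->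
    dn s (num t f) = num t (dn s f) - dn (mul s t) f ;
  ca_up_vac : forall t, ok t -> up t vac = num t vac + (2 * b t) *: vac ;
  ca_dn_vac : forall t, ok t -> dn t vac = num t vac }.

Hypothesis ca : current_action.

Let fD f g (y : Y) : (f + g : Y -> K) y = f y + g y. Proof. by []. Qed.
Let fN f (y : Y) : (- f : Y -> K) y = - f y. Proof. by []. Qed.
Let fZ a f (y : Y) : (a *: f : Y -> K) y = a * f y. Proof. by []. Qed.
Let fE := (fD, fN, fZ).

Lemma ca_D0 : D 0.
Proof.
rewrite -[0](subrr vac) addrC -scaleN1r.
by apply: (ca_lin ca); exact: (ca_vac ca).
Qed.

Lemma ca_DZ a f : D f -> D (a *: f).
Proof. by move=> Df; rewrite -[_ *: _]addr0; apply: (ca_lin ca) => //; exact: ca_D0. Qed.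

Lemma ca_DD f g : D f -> D g -> D (f + g).
Proof. by move=> Df Dg; rewrite -[f]scale1r; exact: (ca_lin ca). Qed.

Lemma linear_on0 A : linear_on A -> A 0 = 0.
Proof.
move=> linA; have := linA (-1) 0 0 ca_D0 ca_D0.
by rewrite scaler0 addr0 scaleN1r addNr.
Qed.

Lemma linear_onD A f g : linear_on A -> D f -> D g -> A (f + g) = A f + A g.
Proof. by move=> linA Df Dg; rewrite -[f in LHS]scale1r linA// scale1r. Qed.

Lemma linear_onB A f g : linear_on A -> D f -> D g -> A (f - g) = A f - A g.
Proof. by move=> linA Df Dg; rewrite addrC -scaleN1r linA// scaleN1r addrC. Qed.

Lemma linear_onZ A a f : linear_on A -> D f -> A (a *: f) = a *: A f.
Proof.
move=> linA Df; rewrite -[a *: f]addr0 linA ?(linear_on0 linA) ?addr0//.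
exact: ca_D0.
Qed.

Lemma linear_on3 A a1 a2 a3 f g h : linear_on A -> D f -> D g -> D h ->
  A (a1 *: f + a2 *: g + a3 *: h) = a1 *: A f + a2 *: A g + a3 *: A h.
Proof.
move=> linA Df Dg Dh.
rewrite (linear_onD linA); [|apply: ca_DD; exact: ca_DZ|exact: ca_DZ].
by rewrite (linear_onD linA) ?(linear_onZ _ linA)//; exact: ca_DZ.
Qed.

Let okm := ca_ok ca.
Let Dn := ca_num ca.
Let Du := ca_up ca.
Let Dd := ca_dn ca.
Let nl := ca_num_lin ca.
Let ul := ca_up_lin ca.
Let dl := ca_dn_lin ca.
Let mC := ca_mulC ca.
Let mA := ca_mulA ca.

(** Each of the commutators below is computed on the vacuum and propagated by the
    rules for [num], which produce the same correction on both sides. *)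
Lemma up_up s t f : ok s -> ok t -> D f -> up s (up t f) = up t (up s f).
Proof.
move=> + + Df; elim/(ca_ind ca): f / Df s t => [|r f okr Df ih|a f g Df ihf Dg ihg] s t oks okt.
- have Dv := ca_vac ca; rewrite !(ca_up_vac ca)//.
  rewrite (linear_onD (ul oks)); [|exact: Dn|exact: ca_DZ].
  rewrite (linear_onD (ul okt)); [|exact: Dn|exact: ca_DZ].
  rewrite !(linear_onZ _ (ul _))// !(ca_up_num ca)// !(ca_up_vac ca)//; [|exact: okm..].
  rewrite (linear_onD (nl oks)); [|exact: Dn|exact: ca_DZ].
  rewrite (linear_onD (nl okt)); [|exact: Dn|exact: ca_DZ].
  rewrite !(linear_onZ _ (nl _))// (mC t s) (ca_num_num ca t s).
  by apply/funext => y; rewrite !fE; ring.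
- rewrite !(ca_up_num ca)//.
  rewrite (linear_onD (ul oks)); [|apply: Dn => //; exact: Du|apply: Du => //; exact: okm].
  rewrite (linear_onD (ul okt)); [|apply: Dn => //; exact: Du|apply: Du => //; exact: okm].
  rewrite !(ca_up_num ca)//; [|exact: Du..].
  rewrite (ih s t)// (ih (mul s r) t)//; last exact: okm.
  rewrite (ih (mul t r) s)//; last exact: okm.
  by apply/funext => y; rewrite !fE; ring.
- rewrite (ul oks)// (ul okt)//; rewrite (ul oks) ?(ul okt)//; [|exact: Du..].
  by rewrite ihf// ihg.
Qed.

Lemma dn_dn s t f : ok s -> ok t -> D f -> dn s (dn t f) = dn t (dn s f).
Proof.
move=> + + Df; elim/(ca_ind ca): f / Df s t => [|r f okr Df ih|a f g Df ihf Dg ihg] s t oks okt.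
- have Dv := ca_vac ca; rewrite !(ca_dn_vac ca)//.
  rewrite !(ca_dn_num ca)// !(ca_dn_vac ca)//; [|exact: okm..].
  by rewrite (mC t s) (ca_num_num ca t s).
- rewrite !(ca_dn_num ca)//.
  rewrite (linear_onB (dl oks)); [|apply: Dn => //; exact: Dd|apply: Dd => //; exact: okm].
  rewrite (linear_onB (dl okt)); [|apply: Dn => //; exact: Dd|apply: Dd => //; exact: okm].
  rewrite !(ca_dn_num ca)//; [|exact: Dd..].
  rewrite (ih s t)// (ih (mul s r) t)//; last exact: okm.
  rewrite (ih (mul t r) s)//; last exact: okm.
  by apply/funext => y; rewrite !fE; ring.
- rewrite (dl oks)// (dl okt)//; rewrite (dl oks) ?(dl okt)//; [|exact: Dd..].
  by rewrite ihf// ihg.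
Qed.

Definition cartan t (f : Y -> K) := num t f + b t *: f.

Lemma ca_cartan t f : ok t -> D f -> D (cartan t f).
Proof. by move=> okt Df; apply: ca_DD; [exact: Dn|exact: ca_DZ]. Qed.

Lemma cartan_lin t : ok t -> linear_on (cartan t).
Proof.
move=> okt a f g Df Dg; rewrite /cartan nl//.
by apply/funext => y; rewrite !fE; ring.
Qed.

Lemma dn_up s t f : ok s -> ok t -> D f ->
  dn s (up t f) = up t (dn s f) - 2 *: cartan (mul s t) f.
Proof.
move=> + + Df; elim/(ca_ind ca): f / Df s t => [|r f okr Df ih|a f g Df ihf Dg ihg] s t oks okt.
- have Dv := ca_vac ca; rewrite (ca_up_vac ca)// (ca_dn_vac ca)//.
  rewrite (linear_onD (dl oks)); [|exact: Dn|exact: ca_DZ].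
  rewrite (linear_onZ _ (dl _))// (ca_up_num ca)// (ca_up_vac ca)// (ca_up_vac ca); last exact: okm.
  rewrite (ca_dn_num ca)// (ca_dn_vac ca)// (ca_dn_vac ca); last exact: okm.
  rewrite (linear_onD (nl oks)); [|exact: Dn|exact: ca_DZ].
  rewrite !(linear_onZ _ (nl _))// (mC t s) (ca_num_num ca t s) /cartan.
  by apply/funext => y; rewrite !fE; ring.
- rewrite (ca_up_num ca)// (ca_dn_num ca)//.
  rewrite (linear_onD (dl oks)); [|apply: Dn => //; exact: Du|apply: Du => //; exact: okm].
  rewrite (linear_onB (ul okt)); [|apply: Dn => //; exact: Dd|apply: Dd => //; exact: okm].
  rewrite (ca_up_num ca)//; last exact: Dd.
  rewrite (ca_dn_num ca)//; last exact: Du.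
  rewrite (ih s t)// (ih (mul s r) t)//; last exact: okm.
  rewrite (ih s (mul t r))//; last exact: okm.
  rewrite (linear_onB (nl okr)); [|apply: Du => //; exact: Dd
    |by apply: ca_DZ; apply: ca_cartan => //; exact: okm].
  rewrite (linear_onZ _ (nl okr)); last by apply: ca_cartan => //; exact: okm.
  rewrite /cartan (linear_onD (nl okr)); [|by apply: Dn => //; exact: okm|exact: ca_DZ].
  rewrite (linear_onZ _ (nl okr))// (ca_num_num ca (mul s t) r).
  have -> : mul (mul s r) t = mul s (mul t r) by rewrite -mA (mC r).
  by apply/funext => y; rewrite !fE; ring.
- rewrite (dl oks)// (ul okt)//; rewrite (dl oks) ?(ul okt)//; [|by [exact: Du|exact: Dd]..].
  rewrite ihf// ihg// cartan_lin//; last exact: okm.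
  by apply/funext => y; rewrite !fE; ring.
Qed.

Lemma up_cartan s t f : ok s -> ok t -> D f ->
  up s (cartan t f) = cartan t (up s f) + up (mul s t) f.
Proof.
move=> oks okt Df; rewrite /cartan (linear_onD (ul oks)); [|exact: Dn|exact: ca_DZ].
rewrite (ca_up_num ca)// (linear_onZ _ (ul oks))//.
by apply/funext => y; rewrite !fE; ring.
Qed.

Lemma dn_cartan s t f : ok s -> ok t -> D f ->
  dn s (cartan t f) = cartan t (dn s f) - dn (mul s t) f.
Proof.
move=> oks okt Df; rewrite /cartan (linear_onD (dl oks)); [|exact: Dn|exact: ca_DZ].
rewrite (ca_dn_num ca)// (linear_onZ _ (dl oks))//.
by apply/funext => y; rewrite !fE; ring.
Qed.

Lemma cartan_cartan s t f : ok s -> ok t -> D f ->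
  cartan s (cartan t f) = cartan t (cartan s f).
Proof.
move=> oks okt Df; rewrite /cartan.
rewrite (linear_onD (nl oks)); [|exact: Dn|exact: ca_DZ].
rewrite (linear_onD (nl okt)); [|exact: Dn|exact: ca_DZ].
rewrite !(linear_onZ _ (nl _))// (ca_num_num ca s t).
by apply/funext => y; rewrite !fE; ring.
Qed.

(** An element of sl2 is given by its coordinates on raising, lowering and
    Cartan generators, and a current is such an element times a test function. *)
Definition current (v : K * K * K) t f : Y -> K :=
  v.1.1 *: up t f + v.1.2 *: dn t f + v.2 *: cartan t f.

Definition sl2_bracket (v w : K * K * K) : K * K * K :=
  (v.1.1 * w.2 - v.2 * w.1.1, v.2 * w.1.2 - v.1.2 * w.2,
   2 * (v.1.1 * w.1.2 - v.1.2 * w.1.1)).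

Lemma ca_current v t f : ok t -> D f -> D (current v t f).
Proof.
move=> okt Df; rewrite /current; apply: ca_DD; [apply: ca_DD|]; apply: ca_DZ.
- exact: Du.
- exact: Dd.
- exact: ca_cartan.
Qed.

Lemma current_lin v t : ok t -> linear_on (current v t).
Proof.
move=> okt a f g Df Dg; rewrite /current ul// dl// cartan_lin//.
by apply/funext => y; rewrite !fE; ring.
Qed.

Lemma current_arg_lin v a r s t f : up r f = a *: up s f + up t f ->
  dn r f = a *: dn s f + dn t f -> num r f = a *: num s f + num t f ->
  b r = a * b s + b t -> current v r f = a *: current v s f + current v t f.
Proof.
rewrite /current /cartan => -> -> -> ->.
by apply/funext => y; rewrite !fE; ring.
Qed.

(** Bilinearity reduces the bracket of two currents to the commutators of the
    generators. *)
Lemma current_bracket v w s t f : ok s -> ok t -> D f ->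
  current v s (current w t f) - current w t (current v s f) =
  current (sl2_bracket v w) (mul s t) f.
Proof.
move=> oks okt Df; have Dus := Du oks Df; have Dut := Du okt Df.
have Dds := Dd oks Df; have Ddt := Dd okt Df.
have Dcs := ca_cartan oks Df; have Dct := ca_cartan okt Df.
rewrite [current w t f]/current [current v s f]/current.
rewrite [current v s _]/current [current w t _]/current.
rewrite !(linear_on3 _ _ _ (ul _))// !(linear_on3 _ _ _ (dl _))//.
rewrite !(linear_on3 _ _ _ (cartan_lin _))//.
rewrite (up_up oks okt)// (dn_dn oks okt)// (cartan_cartan oks okt)//.
rewrite (dn_up oks okt)// (dn_up okt oks)//.
rewrite (up_cartan oks okt)// (up_cartan okt oks)//.
rewrite (dn_cartan oks okt)// (dn_cartan okt oks)// (mC t s).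
by apply/funext => y; rewrite /current !fE /=; ring.
Qed.

End abstract_current_algebra.

(** * The current algebra acting on polynomials *)

Section current_algebra.
Context d (X : measurableType d) (R : realType).
Hypothesis msing : forall x : X, measurable [set x].
Variables (alpha : {measure set X -> \bar R}) (S : set X).
Hypotheses (mS : measurable S) (alphaS : (alpha S < +oo)%E).

Implicit Types (eta : config X R) (phi theta psi : X -> R[i]).
Implicit Types (F G H : config X R -> R[i]).

Local Notation test := (test_on S).
Local Notation "phi ** psi" := (fun x => phi x * psi x) (at level 40).

(** Everything below concerns configurations with finitely many points in [S];
    all functions are extended by zero to the others, so that the relations
    become plain equalities of functions. *)
Definition vacuum eta : R[i] := if (eta S < +oo)%E then 1 else 0.

Definition number phi F eta : R[i] := cintegral eta phi * F eta.

Definition raise phi F eta : R[i] :=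
  if (eta S < +oo)%E then
    cintegral eta (fun x => phi x * F (config_add eta x)) +
    cintegral alpha (fun x => phi x * F (config_add eta x))
  else 0.

Definition lower phi F eta : R[i] :=
  if (eta S < +oo)%E then
    cintegral eta (fun x => phi x * F (config_sub eta x)) else 0.

(** Generating the polynomials from the vacuum lets one check linear relations on
    generators. *)
Inductive pol : (config X R -> R[i]) -> Prop :=
| pol_vacuum : pol vacuum
| pol_number phi F : test phi -> pol F -> pol (number phi F)
| pol_lin a F G : pol F -> pol G -> pol (a *: F + G).

Lemma pol0 : pol 0.
Proof. by rewrite -[0](subrr vacuum) addrC -scaleN1r; apply: pol_lin; exact: pol_vacuum. Qed.

Lemma polZ a F : pol F -> pol (a *: F).
Proof. by move=> pF; rewrite -[_ *: _]addr0; apply: pol_lin => //; exact: pol0. Qed.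

Lemma polD F G : pol F -> pol G -> pol (F + G).
Proof. by move=> pF pG; rewrite -[F]scale1r; exact: pol_lin. Qed.

Lemma pol_bad F eta : pol F -> ~~ (eta S < +oo)%E -> F eta = 0.
Proof.
move=> pF /negbTE bad; elim: pF => {F} [|phi F _ _ ih|a F G _ ihF _ ihG].
- by rewrite /vacuum bad.
- by rewrite /number ih mulr0.
- by rewrite -[LHS]/(a * F eta + G eta) ihF ihG mulr0 addr0.
Qed.

Lemma test_integrable (mu : {measure set X -> \bar R}) phi :
  (mu S < +oo)%E -> test phi -> cintegrable mu phi.
Proof. by move=> muS; exact: cintegrable_test_on. Qed.

(** Adding a point changes a polynomial in a bounded measurable way; this makes
    all the integrals below converge. *)
Lemma pol_cbounded F eta : pol F -> (eta S < +oo)%E ->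
  cbounded (fun x => F (config_add eta x)).
Proof.
move=> pF fin; elim: pF => {F} [|phi F tphi _ ih|a F G _ ihF _ ihG].
- rewrite /vacuum; under [X in cbounded X]eq_fun do rewrite config_add_fin//.
  exact: cbounded_cst.
- under [X in cbounded X]eq_fun do rewrite /number (cintegral_config_add _ mS fin tphi).
  apply: cboundedM => //; apply: cboundedD; first exact: cbounded_cst.
  exact: test_on_cbounded tphi.
- apply: (cboundedD _ ihG); apply: (cboundedM _ ihF).
  exact: cbounded_cst.
Qed.

Lemma test_pol F eta phi : pol F -> (eta S < +oo)%E -> test phi ->
  test (phi ** (fun x => F (config_add eta x))).
Proof. by move=> pF fin tphi; apply: test_onM => //; exact: pol_cbounded. Qed.

Lemma number_lin phi : linear_on pol (number phi).
Proof.
move=> a F G _ _; apply/funext => eta.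
rewrite -[RHS]/(a * (cintegral eta phi * F eta) + cintegral eta phi * G eta).
by rewrite -[LHS]/(cintegral eta phi * (a * F eta + G eta)); ring.
Qed.

Lemma raise_lin phi : test phi -> linear_on pol (raise phi).
Proof.
move=> tphi a F G pF pG; apply/funext => eta.
rewrite -[RHS]/(a * raise phi F eta + raise phi G eta) /raise.
case: ifPn => [fin|_]; last by rewrite mulr0 addr0.
have E (mu : {measure set X -> \bar R}) : (mu S < +oo)%E ->
  cintegral mu (fun x => phi x * (a *: F + G) (config_add eta x)) =
  a * cintegral mu (fun x => phi x * F (config_add eta x)) +
  cintegral mu (fun x => phi x * G (config_add eta x)).
  move=> muS; rewrite -cintegralZ; last by apply: test_integrable => //; exact: test_pol.
  rewrite -cintegralD.
  - by apply: eq_cintegral => x; rewrite mulrCA -mulrDr.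
  - by apply: cintegrableZ; apply: test_integrable => //; exact: test_pol.
  - by apply: test_integrable => //; exact: test_pol.
by rewrite !E//; ring.
Qed.

Lemma lowerE phi F eta : test phi -> (eta S < +oo)%E ->
  lower phi F eta = \sum_(x <- points S eta) phi x * F (config_sub eta x).
Proof. by move=> tphi fin; rewrite /lower fin (cintegral_sub_points msing _ mS fin). Qed.

Lemma lower_lin phi : test phi -> linear_on pol (lower phi).
Proof.
move=> tphi a F G pF pG; apply/funext => eta.
rewrite -[RHS]/(a * lower phi F eta + lower phi G eta).
have [fin|bad] := boolP (eta S < +oo)%E; last by rewrite /lower (negbTE bad) mulr0 addr0.
rewrite !lowerE// mulr_sumr -big_split /=; apply: eq_bigr => x _.
rewrite -[(a *: F + G) _]/(a * F (config_sub eta x) + G (config_sub eta x)); ring.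
Qed.

(** Moving a multiplication operator across [raise] costs the value of its test
    function at the added point, hence a single correction term; the same
    holds for [lower]. All other relations follow from these two. *)
Lemma raise_number phi psi F : test phi -> test psi -> pol F ->
  raise phi (number psi F) = number psi (raise phi F) + raise (phi ** psi) F.
Proof.
move=> tphi tpsi pF; apply/funext => eta.
rewrite -[RHS]/(cintegral eta psi * raise phi F eta + raise (phi ** psi) F eta) /raise.
case: ifPn => [fin|_]; last by rewrite mulr0 addr0.
have E (mu : {measure set X -> \bar R}) : (mu S < +oo)%E ->
  cintegral mu (fun x => phi x * number psi F (config_add eta x)) =
  cintegral eta psi * cintegral mu (fun x => phi x * F (config_add eta x)) +
  cintegral mu (fun x => phi x * psi x * F (config_add eta x)).
  move=> muS; rewrite -cintegralZ; last by apply: test_integrable => //; exact: test_pol.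
  rewrite -cintegralD.
  - apply: eq_cintegral => x; rewrite /number (cintegral_config_add _ mS fin tpsi); ring.
  - by apply: cintegrableZ; apply: test_integrable => //; exact: test_pol.
  - by apply: test_integrable => //; apply: test_pol => //; exact: test_onMt.
by rewrite !E//; ring.
Qed.

Lemma lower_number phi psi F : test phi -> test psi ->
  lower phi (number psi F) = number psi (lower phi F) - lower (phi ** psi) F.
Proof.
move=> tphi tpsi; apply/funext => eta.
rewrite -[RHS]/(cintegral eta psi * lower phi F eta - lower (phi ** psi) F eta).
have [fin|bad] := boolP (eta S < +oo)%E; last by rewrite /lower (negbTE bad) mulr0 subr0.
rewrite !lowerE//; last exact: test_onMt.
rewrite mulr_sumr -sumrB; apply: eq_big_seq => x xs.
by rewrite /number (cintegral_config_sub mS fin xs tpsi); ring.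
Qed.

Lemma number_comm phi psi F : number phi (number psi F) = number psi (number phi F).
Proof. by apply/funext => eta; rewrite /number mulrCA. Qed.

Lemma raise_vacuum phi : test phi ->
  raise phi vacuum = number phi vacuum + cintegral alpha phi *: vacuum.
Proof.
move=> tphi; apply/funext => eta.
rewrite -[RHS]/(cintegral eta phi * vacuum eta + cintegral alpha phi * vacuum eta).
rewrite /raise {3 4}/vacuum; case: ifPn => [fin|_]; last by rewrite !mulr0 addr0.
rewrite !mulr1.
by congr (_ + _); apply: eq_cintegral => x; rewrite /vacuum config_add_fin// mulr1.
Qed.

Lemma lower_vacuum phi : test phi -> lower phi vacuum = number phi vacuum.
Proof.
move=> tphi; apply/funext => eta; rewrite /number {2}/vacuum.
have [fin|bad] := boolP (eta S < +oo)%E; last by rewrite /lower (negbTE bad) mulr0.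
rewrite lowerE// mulr1 (cintegral_points mS fin); [|by case: tphi..].
apply: eq_big_seq => x xs; rewrite /vacuum.
by rewrite (config_sub_fin fin xs fin) mulr1.
Qed.

Lemma pol_raise phi F : test phi -> pol F -> pol (raise phi F).
Proof.
move=> + pF; elim: pF phi => {F} [|psi F tpsi pF ih|a F G pF ihF pG ihG] phi tphi.
- rewrite raise_vacuum// addrC; apply: pol_lin; first exact: pol_vacuum.
  by apply: pol_number => //; exact: pol_vacuum.
- rewrite raise_number//; apply: polD; last by apply: ih; exact: test_onMt.
  by apply: pol_number => //; exact: ih.
- by rewrite raise_lin//; apply: pol_lin; [exact: ihF|exact: ihG].
Qed.

Lemma pol_lower phi F : test phi -> pol F -> pol (lower phi F).
Proof.
move=> + pF; elim: pF phi => {F} [|psi F tpsi pF ih|a F G pF ihF pG ihG] phi tphi.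
- by rewrite lower_vacuum//; apply: pol_number => //; exact: pol_vacuum.
- rewrite lower_number// addrC -scaleN1r; apply: pol_lin.
    by apply: ih; exact: test_onMt.
  by apply: pol_number => //; exact: ih.
- by rewrite lower_lin//; apply: pol_lin; [exact: ihF|exact: ihG].
Qed.

Lemma pol_current_action :
  current_action (fun phi psi : X -> R[i] => phi ** psi) test pol number raise lower
    (fun phi => 2^-1 * cintegral alpha phi) vacuum.
Proof.
split.
- by move=> phi psi; exact: test_onMt.
- by move=> phi psi; apply/funext => x; rewrite mulrC.
- by move=> phi psi theta; apply/funext => x; rewrite mulrA.
- exact: pol_vacuum.
- exact: pol_lin.
- move=> P Pv Pn Pl F; elim=> {F} [//|phi F tphi pF PF|a F G pF PF pG PG].
    exact: Pn.
  exact: Pl.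
- exact: pol_number.
- exact: pol_raise.
- exact: pol_lower.
- by move=> phi _; exact: number_lin.
- exact: raise_lin.
- exact: lower_lin.
- exact: number_comm.
- exact: raise_number.
- by move=> phi psi F tphi tpsi _; exact: lower_number.
- by move=> phi tphi; rewrite mulrA divff ?mul1r ?pnatr_eq0//; exact: raise_vacuum.
- exact: lower_vacuum.
Qed.

End current_algebra.

(** * Polynomials and the pointwise operators *)

Section coefficient_identities.
Variables (K : comRingType) (h : K).
Hypothesis hK : 2 * h = 1.

Let double (x : K) : x = (2 * h) * x. Proof. by rewrite hK mul1r. Qed.

(** The differences and the diagonal terms of the pointwise operators recombine into
    multiples of raising [E + A], lowering [L] and the Cartan term [J + I / 2]. *)
Lemma kplus_coeff (U a b E A L J I f : K) :
  U * (a * (E + A) + b * L) - U * (2 * J + I) * f =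
  U * a * (E + A) + U * b * L + - (2 * U) * ((J + h * I) * f).
Proof. by rewrite {1}[I]double; ring. Qed.

Lemma kminus_coeff (U E A L J I f : K) :
  U * (A + E - (I + J) * f + (L - J * f)) =
  U * (E + A) + U * L + - (2 * U) * ((J + h * I) * f).
Proof. by rewrite {1}[I]double; ring. Qed.

Lemma kzero_coeff (U s t E A L J I f : K) : U * (t - s) = 1 ->
  - U * (s * (A + E - (I + J) * f) + t * (L - J * f)) + h * I * f =
  - (U * s) * (E + A) + - (U * t) * L + U * (s + t) * ((J + h * I) * f).
Proof.
move=> Uts; have -> : h * I * f = U * (t - s) * (h * I * f) by rewrite Uts mul1r.
by rewrite {1}[I]double; ring.
Qed.

End coefficient_identities.

Section polynomial_operators.
Context d (X : measurableType d) (R : realType).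
Hypothesis msing : forall x : X, measurable [set x].
Variables (alpha : {measure set X -> \bar R}) (S : set X).
Hypotheses (mS : measurable S) (alphaS : (alpha S < +oo)%E).

Implicit Types (eta : config X R) (phi theta psi : X -> R[i]).
Implicit Types (F G H : config X R -> R[i]).

Local Notation test := (test_on S).
Local Notation vacuum := (@vacuum _ X R S).
Local Notation raise := (raise alpha S).
Local Notation lower := (lower S).
Local Notation pol := (pol S).

Definition pol_current :=
  current (@number _ X R) raise lower (fun phi => 2^-1 * cintegral alpha phi).

Lemma pol_currentE v phi F eta : pol_current v phi F eta =
  v.1.1 * raise phi F eta + v.1.2 * lower phi F eta
  + v.2 * ((cintegral eta phi + 2^-1 * cintegral alpha phi) * F eta).
Proof. by rewrite mulrDl. Qed.

Lemma pol_mul F G : pol F -> pol G -> pol (fun eta => F eta * G eta).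
Proof.
move=> pF pG; elim: pF => {F} [|phi F tphi _ ih|a F G' _ ihF _ ihG].
- rewrite (_ : (fun _ => _) = G)//; apply/funext => eta; rewrite /vacuum.
  by case: ifPn => [_|/(pol_bad pG) ->]; rewrite ?mul1r ?mulr0.
- rewrite (_ : (fun _ => _) = number phi (fun eta => F eta * G eta)).
    exact: pol_number.
  by apply/funext => eta; rewrite /number mulrA.
- rewrite (_ : (fun _ => _) = a *: (fun eta => F eta * G eta) + (fun eta => G' eta * G eta)).
    exact: pol_lin.
  apply/funext => eta.
  by rewrite -[RHS]/(a * (F eta * G eta) + G' eta * G eta) mulrA -mulrDl.
Qed.

Lemma vacuum_pol F eta : pol F -> vacuum eta * F eta = F eta.
Proof.
rewrite /vacuum; case: ifPn => [_ _|bad pF]; first by rewrite mul1r.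
by rewrite (pol_bad pF bad) mulr0.
Qed.

Lemma pol_cst a : pol (fun eta => vacuum eta * a).
Proof.
rewrite (_ : (fun _ => _) = a *: vacuum); first by apply: polZ; exact: pol_vacuum.
by apply/funext => eta; rewrite mulrC.
Qed.

Lemma pol_sum (I : Type) (r : seq I) (G : I -> config X R -> R[i]) :
  (forall i, pol (fun eta => vacuum eta * G i eta)) ->
  pol (fun eta => vacuum eta * \sum_(i <- r) G i eta).
Proof.
move=> pG; elim: r => [|i r ih].
  by under [X in pol X]eq_fun do rewrite big_nil; exact: pol_cst.
by under [X in pol X]eq_fun do rewrite big_cons mulrDr; exact: polD.
Qed.

Lemma pol_prod2 F G : pol (fun eta => vacuum eta * F eta) ->
  pol (fun eta => vacuum eta * G eta) ->
  pol (fun eta => vacuum eta * (F eta * G eta)).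
Proof.
move=> pF pG; have := pol_mul pF pG; congr pol; apply/funext => eta.
by rewrite mulrACA; congr (_ * _); rewrite vacuum_pol//; exact: pol_vacuum.
Qed.

Lemma pol_prod (I : Type) (r : seq I) (G : I -> config X R -> R[i]) :
  (forall i, pol (fun eta => vacuum eta * G i eta)) ->
  pol (fun eta => vacuum eta * \prod_(i <- r) G i eta).
Proof.
move=> pG; elim: r => [|i r ih].
  by under [X in pol X]eq_fun do rewrite big_nil; exact: pol_cst.
by under [X in pol X]eq_fun do rewrite big_cons; exact: pol_prod2.
Qed.

Lemma pol_cintegral phi : test phi -> pol (fun eta => vacuum eta * cintegral eta phi).
Proof.
move=> tphi; rewrite (_ : (fun _ => _) = number phi vacuum).
  by apply: pol_number => //; exact: pol_vacuum.
by apply/funext => eta; rewrite mulrC.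
Qed.

(** Only finitely many monomials occur, and each is a product of integrals. *)
Lemma pol_meval n (P : mpoly.mpoly n R[i]) (phi : 'I_n -> X -> R[i]) :
  (forall i, test (phi i)) ->
  pol (fun eta => vacuum eta * mpoly.meval (fun i => cintegral eta (phi i)) P).
Proof.
move=> tphi; under [X in pol X]eq_fun do rewrite mpoly.mevalE.
apply: pol_sum => m; apply: pol_prod2; first exact: pol_cst.
apply: pol_prod => i; elim: (mpoly.fun_of_multinom m i) => [|k ih].
  by under [X in pol X]eq_fun do rewrite expr0; exact: pol_cst.
by under [X in pol X]eq_fun do rewrite exprS; apply: pol_prod2 => //; exact: pol_cintegral.
Qed.

Lemma pol_conj F : pol F -> pol (fun eta => conjc (F eta)).
Proof.
move=> pF; elim: pF => {F} [|phi F tphi pF ih|a F G _ ihF _ ihG].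
- rewrite (_ : (fun _ => _) = vacuum); first exact: pol_vacuum.
  apply/funext => eta; by rewrite /vacuum; case: ifP => _; rewrite /= oppr0.
- rewrite (_ : (fun _ => _) = number (fun x => conjc (phi x)) (fun eta => conjc (F eta))).
    by apply: pol_number => //; exact: test_on_conj.
  apply/funext => eta; rewrite /number conjcM.
  have [fin|/(pol_bad pF) ->] := boolP (eta S < +oo)%E; last by rewrite !conjc0 !mulr0.
  by rewrite cintegral_conj//; exact: (test_integrable mS fin tphi).
- rewrite (_ : (fun _ => _) =
    conjc a *: (fun eta => conjc (F eta)) + (fun eta => conjc (G eta))).
    exact: pol_lin.
  by apply/funext => eta; rewrite -[LHS]/(conjc (a * F eta + G eta)) conjcD conjcM.
Qed.

Lemma conj_raise phi F eta : test phi -> pol F ->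
  conjc (raise phi F eta) = raise (fun x => conjc (phi x)) (fun eta => conjc (F eta)) eta.
Proof.
move=> tphi pF; rewrite /raise; case: ifPn => [fin|_]; last exact: conjc0.
have E (mu : {measure set X -> \bar R}) : (mu S < +oo)%E ->
  cintegral mu (fun x => conjc (phi x) * conjc (F (config_add eta x))) =
  conjc (cintegral mu (fun x => phi x * F (config_add eta x))).
  move=> muS; rewrite -cintegral_conj.
    by apply: eq_cintegral => x; rewrite conjcM.
  by apply: (test_integrable mS) => //; exact: test_pol.
by rewrite !E// conjcD.
Qed.

Lemma conj_lower phi F eta : test phi ->
  conjc (lower phi F eta) = lower (fun x => conjc (phi x)) (fun eta => conjc (F eta)) eta.
Proof.
move=> tphi; have [fin|bad] := boolP (eta S < +oo)%E; last first.
  by rewrite /lower (negbTE bad) conjc0.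
rewrite !lowerE// ?conjc_sum; last exact: test_on_conj.
by apply: eq_bigr => x _; rewrite conjcM.
Qed.

Definition vconj (v : R[i] * R[i] * R[i]) := (conjc v.1.1, conjc v.1.2, conjc v.2).

Lemma conj_current v phi F eta : test phi -> pol F ->
  conjc (pol_current v phi F eta) =
  pol_current (vconj v) (fun x => conjc (phi x)) (fun eta => conjc (F eta)) eta.
Proof.
move=> tphi pF; rewrite !pol_currentE !(conjcD, conjcM).
rewrite conj_raise// conj_lower//; congr (_ + _ + _ * _).
have [fin|/(pol_bad pF) ->] := boolP (eta S < +oo)%E; last by rewrite !conjc0 !mulr0.
have ie := test_integrable mS fin tphi; have ia := test_integrable mS alphaS tphi.
by rewrite !cintegral_conj// conjcV conjc_nat.
Qed.

Lemma number_test_lin a phi theta F : test phi -> test theta -> pol F ->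
  number (a *: phi + theta) F = a *: number phi F + number theta F.
Proof.
move=> tphi ttheta pF; apply/funext => eta.
rewrite -[RHS]/(a * number phi F eta + number theta F eta) /number.
have [fin|/(pol_bad pF) ->] := boolP (eta S < +oo)%E; last by rewrite !(mulr0, addr0).
by rewrite cintegral_lin; [ring|exact: (test_integrable mS)..].
Qed.

Lemma raise_test_lin a phi theta F : test phi -> test theta -> pol F ->
  raise (a *: phi + theta) F = a *: raise phi F + raise theta F.
Proof.
move=> tphi ttheta pF; apply/funext => eta.
rewrite -[RHS]/(a * raise phi F eta + raise theta F eta) /raise.
case: ifPn => [fin|_]; last by rewrite mulr0 addr0.
have E (mu : {measure set X -> \bar R}) : (mu S < +oo)%E ->
  cintegral mu (fun x => (a *: phi + theta) x * F (config_add eta x)) =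
  a * cintegral mu (fun x => phi x * F (config_add eta x)) +
  cintegral mu (fun x => theta x * F (config_add eta x)).
  move=> muS; rewrite -cintegral_lin.
  - by apply: eq_cintegral => x; rewrite mulrA -mulrDl.
  - by apply: (test_integrable mS) => //; exact: test_pol.
  - by apply: (test_integrable mS) => //; exact: test_pol.
by rewrite !E//; ring.
Qed.

Lemma lower_test_lin a phi theta F : test phi -> test theta ->
  lower (a *: phi + theta) F = a *: lower phi F + lower theta F.
Proof.
move=> tphi ttheta; apply/funext => eta.
rewrite -[RHS]/(a * lower phi F eta + lower theta F eta).
have [fin|bad] := boolP (eta S < +oo)%E; last by rewrite /lower (negbTE bad) mulr0 addr0.
have tl : test (a *: phi + theta) by apply: test_onD => //; exact: test_onZ.
rewrite !lowerE// mulr_sumr -big_split; apply: eq_bigr => x _ /=.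
by rewrite mulrA -mulrDl.
Qed.

Lemma current_test_lin v a phi theta F : test phi -> test theta -> pol F ->
  pol_current v (a *: phi + theta) F =
  a *: pol_current v phi F + pol_current v theta F.
Proof.
move=> tphi ttheta pF; apply: current_arg_lin.
- exact: raise_test_lin.
- exact: lower_test_lin.
- exact: number_test_lin.
- by rewrite cintegral_lin; [ring|exact: (test_integrable mS)..].
Qed.

Lemma vconj_real a b c : vconj (a%:C, b%:C, c%:C) = (a%:C, b%:C, c%:C).
Proof. by rewrite /vconj /= !oppr0. Qed.

Variable p : R.
Let u : R[i] := (su11_c p)^-1%:C.
Let r := Num.sqrt p.

Let half2 : 2 * 2^-1 = 1 :> R[i]. Proof. by rewrite divff// pnatr_eq0. Qed.

(** Coordinates of the three operators on the raising, lowering and Cartan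
    generators, read off from the coefficients of the pointwise formulas. *)
Definition kplus : R[i] * R[i] * R[i] := (u * p%:C, u * p^-1%:C, - (2 * u)).
Definition kminus : R[i] * R[i] * R[i] := (u, u, - (2 * u)).
Definition kzero : R[i] * R[i] * R[i] :=
  (- (u * r%:C), - (u * r^-1%:C), u * (r + r^-1)%:C).

Lemma raise_measure_add phi F F' eta (mu nu : {measure set X -> \bar R}) : test phi ->
  pol F -> (eta S < +oo)%E -> (forall eta, (eta S < +oo)%E -> F' eta = F eta) ->
  (mu S < +oo)%E -> (nu S < +oo)%E ->
  cintegral (measure_add mu nu) (fun x => phi x * F' (config_add eta x)) =
  cintegral mu (fun x => phi x * F (config_add eta x)) +
  cintegral nu (fun x => phi x * F (config_add eta x)).
Proof.
move=> tphi pF fin FF' muS nuS; rewrite -cintegral_measure_add.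
- by apply: eq_cintegral => x; rewrite FF'// config_add_fin.
- by apply: (test_integrable mS) => //; exact: test_pol.
- by apply: (test_integrable mS) => //; exact: test_pol.
Qed.

Lemma lower_ext phi F F' eta : test phi -> (eta S < +oo)%E ->
  (forall eta, (eta S < +oo)%E -> F' eta = F eta) ->
  cintegral eta (fun x => phi x * F' (config_sub eta x)) = lower phi F eta.
Proof.
move=> tphi fin FF'; rewrite lowerE// (cintegral_sub_points msing F' mS fin)//.
by apply: eq_big_seq => x xs; rewrite FF'// (config_sub_fin fin xs fin).
Qed.

(** A representative [F'] that agrees with [F] on the configurations finite in [S]
    gives the same value there, since adding or removing points preserves this
    finiteness. *)
Lemma Kplus_current phi F F' eta : test phi -> pol F -> (eta S < +oo)%E ->
  (forall eta, (eta S < +oo)%E -> F' eta = F eta) ->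
  Kplus alpha p phi F' eta = pol_current kplus phi F eta.
Proof.
move=> tphi pF fin FF'; rewrite pol_currentE /Kplus (raise_measure_add tphi pF)//.
rewrite (lower_ext tphi fin FF') /raise fin FF'// /kplus -/u /=.
set E := cintegral eta _; set A := cintegral alpha _; set L := lower _ _ _.
have := kplus_coeff half2 u p%:C (p^-1)%:C E A L (cintegral eta phi) (cintegral alpha phi) (F eta).
exact.
Qed.

Lemma diff_add phi F F' eta (mu nu : {measure set X -> \bar R}) : test phi ->
  pol F -> (eta S < +oo)%E -> (forall eta, (eta S < +oo)%E -> F' eta = F eta) ->
  (mu S < +oo)%E -> (nu S < +oo)%E ->
  cintegral (measure_add mu nu) (fun x => phi x * difference_add x F' eta) =
  cintegral mu (fun x => phi x * F (config_add eta x)) +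
  cintegral nu (fun x => phi x * F (config_add eta x)) -
  (cintegral mu phi + cintegral nu phi) * F eta.
Proof.
move=> tphi pF fin FF' muS nuS.
have E (m : {measure set X -> \bar R}) : (m S < +oo)%E ->
    cintegrable m (fun x => phi x * difference_add x F' eta) /\
    cintegral m (fun x => phi x * difference_add x F' eta) =
    cintegral m (fun x => phi x * F (config_add eta x)) - cintegral m phi * F eta.
  move=> mfin.
  have -> : (fun x => phi x * difference_add x F' eta) =
      (fun x => - F eta * phi x + phi x * F (config_add eta x)).
    apply/funext => x; rewrite /difference_add !FF'// ?config_add_fin//; ring.
  have i1 : cintegrable m phi by exact: (test_integrable mS).
  have i2 : cintegrable m (fun x => phi x * F (config_add eta x)).
    by apply: (test_integrable mS) => //; exact: test_pol.
  split; last by rewrite cintegral_lin//; ring.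
  by apply: cintegrableD => //; exact: cintegrableZ.
have [i1 e1] := E mu muS; have [i2 e2] := E nu nuS.
by rewrite cintegral_measure_add// e1 e2; ring.
Qed.

Lemma diff_sub phi F F' eta : test phi -> (eta S < +oo)%E ->
  (forall eta, (eta S < +oo)%E -> F' eta = F eta) ->
  cintegral eta (fun x => phi x * difference_sub x F' eta) =
  lower phi F eta - cintegral eta phi * F eta.
Proof.
move=> tphi fin FF'.
rewrite (cintegral_sub_points msing (fun zeta => F' zeta - F' eta) mS fin)// lowerE//.
rewrite (cintegral_points mS fin (f := phi)); [|by case: tphi..].
rewrite mulr_suml -sumrB; apply: eq_big_seq => x xs.
by rewrite !FF'// ?(config_sub_fin fin xs fin)// mulrBr.
Qed.

Lemma Kminus_current phi F F' eta : test phi -> pol F -> (eta S < +oo)%E ->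
  (forall eta, (eta S < +oo)%E -> F' eta = F eta) ->
  Kminus alpha p phi F' eta = pol_current kminus (fun x => conjc (phi x)) F eta.
Proof.
move=> /test_on_conj tphi pF fin FF'; rewrite pol_currentE /Kminus (diff_add tphi pF)//.
rewrite (diff_sub tphi fin FF') /raise fin /kminus -/u /=.
set E := cintegral eta _; set A := cintegral alpha _; set L := lower _ _ _.
have := kminus_coeff half2 u E A L (cintegral eta (fun x => conjc (phi x)))
  (cintegral alpha (fun x => conjc (phi x))) (F eta).
exact.
Qed.

Hypothesis p01 : 0 < p < 1.

Lemma sqrtp_gt0 : 0 < r. Proof. by case/andP: p01 => p0 _; rewrite sqrtr_gt0. Qed.

Lemma sqrtp_sqr : r ^+ 2 = p. Proof. by case/andP: p01 => /ltW p0 _; rewrite sqr_sqrtr. Qed.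

Lemma su11_cE : su11_c p = (1 - p) / r.
Proof.
have r0 : r != 0 by rewrite gt_eqF// sqrtp_gt0.
by rewrite /su11_c -/r -sqrtp_sqr; field.
Qed.

Lemma su11_c_gt0 : 0 < su11_c p.
Proof.
rewrite su11_cE divr_gt0 ?sqrtp_gt0// subr_gt0.
by case/andP: p01.
Qed.

Lemma Kzero_current phi F F' eta : test phi -> pol F -> (eta S < +oo)%E ->
  (forall eta, (eta S < +oo)%E -> F' eta = F eta) ->
  Kzero alpha p phi F' eta = pol_current kzero phi F eta.
Proof.
move=> tphi pF fin FF'; rewrite pol_currentE /Kzero (diff_add tphi pF)//.
rewrite (diff_sub tphi fin FF') /raise fin FF'// /kzero -/u -/r /=.
rewrite rmorphD; set E := cintegral eta _; set A := cintegral alpha _; set L := lower _ _ _.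
have Uts : u * ((r^-1)%:C - r%:C) = 1.
  rewrite -rmorphB -[r^-1 - r]/(su11_c p) -rmorphM /= mulVf ?rmorph1// gt_eqF//.
  exact: su11_c_gt0.
have := kzero_coeff half2 E A L (cintegral eta phi) (cintegral alpha phi) (F eta) Uts.
exact.
Qed.

Lemma u_neq0 : u != 0.
Proof.
by rewrite /u eq_complex /= eqxx andbT invr_eq0 gt_eqF// su11_c_gt0.
Qed.

End polynomial_operators.

(** * The negative binomial distribution *)

Section negative_binomial.
Context (R : realType) (p : R).
Hypothesis p01 : 0 < p < 1.
Implicit Types (a : R) (n k : nat).

Let p_gt0 : 0 < p. Proof. by case/andP: p01. Qed.
Let p_lt1 : p < 1. Proof. by case/andP: p01. Qed.

Lemma risingS a n : rising a n.+1 = rising a n * (a + n%:R).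
Proof. by rewrite /rising big_ord_recr. Qed.

Lemma rising_ge0 a n : 0 <= a -> 0 <= rising a n.
Proof. by move=> a0; apply: prodr_ge0 => i _; rewrite addr_ge0. Qed.

Lemma pascal_pmf_ge0 a n : 0 <= a -> 0 <= pascal_pmf p a n.
Proof.
move=> a0; rewrite /pascal_pmf mulr_ge0 ?rising_ge0// mulr_ge0 ?powR_ge0//.
by rewrite divr_ge0// exprn_ge0// ltW.
Qed.

Lemma pascal_pmf_gt0 a n : 0 < a -> 0 < pascal_pmf p a n.
Proof.
move=> a0; apply: mulr_gt0; first apply: mulr_gt0.
- by rewrite powR_gt0// subr_gt0.
- by rewrite divr_gt0 ?exprn_gt0// ltr0n fact_gt0.
- by apply: prodr_gt0 => i _; rewrite ltr_wpDr.
Qed.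

Lemma pascal_pmfS a n :
  n.+1%:R * pascal_pmf p a n.+1 = p * (n%:R + a) * pascal_pmf p a n.
Proof.
have nf : n`!%:R != 0 :> R by rewrite pnatr_eq0 -lt0n fact_gt0.
have n1 : n.+1%:R != 0 :> R by rewrite pnatr_eq0.
rewrite /pascal_pmf risingS factS natrM exprS.
move: (rising a n) ((1 - p) `^ a) (p ^+ n) (n`!%:R) (n.+1%:R) nf n1 => x y z f m f0 m0.
by field; rewrite f0.
Qed.

Lemma pascal_pmf_0 n : pascal_pmf p 0 n = (n == 0)%:R.
Proof.
rewrite /pascal_pmf powRr0 mul1r; case: n => [|n].
  by rewrite /rising big_ord0 fact0 divr1 expr0 !mulr1.
by rewrite /rising big_ord_recl /= add0r mul0r mulr0.
Qed.

(** Decay rate of the weights: any ratio strictly between [p] and 1 would do, and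
    [(1 + p) / 2] is one. *)
Definition pascal_rate : R := - ln ((1 + p) / 2).

Lemma pascal_rate_gt0 : 0 < pascal_rate.
Proof. by rewrite oppr_gt0 ln_lt0//; have := p01; lra. Qed.

Lemma expR_pascal_rate n : expR (- pascal_rate * n%:R) = ((1 + p) / 2) ^+ n.
Proof.
by rewrite /pascal_rate opprK expRM_natr lnK// posrE; have := p01; lra.
Qed.

(** The ratio of consecutive weights tends to [p], hence is eventually below
    any ratio larger than [p]. *)
Lemma pascal_pmf_le a : 0 <= a ->
  exists2 C, 0 <= C & forall n, pascal_pmf p a n <= C * expR (- pascal_rate * n%:R).
Proof.
move=> a0; set r := (1 + p) / 2.
have [pr r1] : p < r /\ r < 1 by rewrite /r; have := p01; lra.
have r0 : 0 < r by exact: lt_trans pr.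
(* Beyond [N] the ratio [p (n + a) / (n + 1)] is at most [r]; the constant absorbs
   the earlier weights. *)
pose N := Num.truncn (p * a / (r - p)).
have HN n : (N < n)%N -> pascal_pmf p a n.+1 <= r * pascal_pmf p a n.
  move=> Nn; rewrite -(ler_pM2l (_ : 0 < n.+1%:R))// pascal_pmfS.
  rewrite [leRHS]mulrA ler_wpM2r ?pascal_pmf_ge0//.
  have : p * a / (r - p) < n%:R.
    by apply: lt_le_trans (truncnS_gt _) _; rewrite ler_nat.
  by rewrite ltr_pdivrMr ?subr_gt0// -[n.+1%:R]natr1; lra.
have rn0 n : 0 < r ^+ n by rewrite exprn_gt0.
pose C := \sum_(i < N.+2) pascal_pmf p a i / r ^+ i.
have term0 i : 0 <= pascal_pmf p a i / r ^+ i by rewrite divr_ge0 ?pascal_pmf_ge0// ltW.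
exists C; first by apply: sumr_ge0.
move=> n; rewrite expR_pascal_rate -/r.
have small i : (i < N.+2)%N -> pascal_pmf p a i <= C * r ^+ i.
  move=> iN; rewrite -ler_pdivrMr// /C (bigD1 (Ordinal iN))//= lerDl.
  by apply: sumr_ge0.
elim: n => [|n ih]; first exact: small.
have [nN|Nn] := ltnP n.+1 N.+2; first exact: small.
rewrite exprS mulrCA; apply: le_trans (HN _ _) _ => //.
by rewrite ler_wpM2l// ltW.
Qed.

Lemma natr_exp_le_expR (e : R) k n : 0 < e ->
  n%:R ^+ k <= (k`!%:R / e ^+ k) * expR (e * n%:R).
Proof.
move=> e0; have ek : 0 < e ^+ k by rewrite exprn_gt0.
have kf : 0 < k`!%:R :> R by rewrite ltr0n fact_gt0.
have -> : n%:R ^+ k = k`!%:R / e ^+ k * ((e * n%:R) ^+ k / k`!%:R).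
  rewrite exprMn; have := lt0r_neq0 kf; have := lt0r_neq0 ek.
  by move: (e ^+ k) (n%:R ^+ k) (k`!%:R) => x y f x0 f0; field; rewrite x0 f0.
rewrite ler_wpM2l//; first by rewrite divr_ge0// ltW.
have en0 : 0 <= e * n%:R by rewrite mulr_ge0// ltW.
case: {ek kf} k => [|k]; first by rewrite expr0 fact0 divr1 (le_trans _ (expR_ge1Dx _))// lerDl.
by apply: le_trans (expR_ge1Dxn k en0); rewrite lerDr.
Qed.

Lemma cvg_expR_rate (e : R) : 0 < e ->
  (fun n => expR (- e * n%:R)) @ \oo --> (0 : R).
Proof.
move=> e0; under eq_fun do rewrite expRM_natr.
by apply: cvg_expr; rewrite ger0_norm ?expR_ge0// expR_lt1 oppr_lt0.
Qed.

Lemma pascal_pmf_moment_cvg0 a k : 0 <= a ->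
  (fun n => n%:R ^+ k * pascal_pmf p a n) @ \oo --> (0 : R).
Proof.
move=> a0; have [C C0 HC] := pascal_pmf_le a0.
pose e := pascal_rate / 2; have e0 : 0 < e by rewrite divr_gt0// pascal_rate_gt0.
apply: (@squeeze_cvgr _ _ _ _ (cst 0)
   (fun n => (k`!%:R / e ^+ k) * C * expR (- e * n%:R))); last 2 first.
- exact: cvg_cst.
- rewrite -[X in _ --> X](mulr0 ((k`!%:R / e ^+ k) * C)).
  by apply: cvgM; [exact: cvg_cst|exact: cvg_expR_rate].
apply: nearW => n; rewrite mulr_ge0 ?exprn_ge0 ?pascal_pmf_ge0//=.
apply: le_trans (ler_pM _ _ (natr_exp_le_expR k n e0) (HC n)) _.
- by rewrite exprn_ge0.
- exact: pascal_pmf_ge0.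
rewrite mulrACA -expRD ler_wpM2l//.
  by rewrite mulr_ge0// divr_ge0 ?exprn_ge0// ltW.
by rewrite ler_expR -mulrDl /e; lra.
Qed.

Let coef a k : R := rising a k / k`!%:R.

Let psum a n : {poly R} := \sum_(k < n) coef a k *: 'X^k.

Let coefS a k : k.+1%:R * coef a k.+1 = (a + k%:R) * coef a k.
Proof.
have nf : k`!%:R != 0 :> R by rewrite pnatr_eq0 -lt0n fact_gt0.
have n1 : k.+1%:R != 0 :> R by rewrite pnatr_eq0.
rewrite /coef risingS factS natrM.
move: (rising a k) (k`!%:R) (k.+1%:R) nf n1 => x f m f0 m0.
by field; rewrite f0.
Qed.

Let psumS a n : psum a n.+1 = psum a n + coef a n *: 'X^n.
Proof. by rewrite /psum big_ord_recr. Qed.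

(** The binomial series of [(1 - x) `^ (- a)] solves [(1 - x) y' = a y]; its partial
    sums do so up to their next coefficient. *)
Let psum_ode a n (x : R) : (1 - x) * (psum a n.+1)^`().[x] =
  a * (psum a n.+1).[x] - n.+1%:R * coef a n.+1 * x ^+ n.
Proof.
elim: n => [|n ih].
  rewrite /psum big_ord1 coefS expr0 alg_polyC derivC hornerC horner0 mulr0.
  by rewrite addr0 mulr1 subrr.
rewrite !(psumS a n.+1) derivD !hornerD mulrDr ih derivZ derivXn.
rewrite !hornerZ hornerMn !hornerXn (coefS a n.+1) -[_ *+ n.+1]mulr_natr exprS /=.
by ring.
Qed.

(** The derivative of [y `^ a * psum a n (1 - y)] reduces to its last term,
    which tends to zero. *)
Lemma pascal_pmf_sum1 a : 0 <= a -> series (pascal_pmf p a) @ \oo --> (1 : R).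
Proof.
move=> a0; pose q : R := 1 - p.
have [q0 q1] : 0 < q /\ q < 1 by rewrite /q; have := p01; lra.
have qE : 1 - q = p by rewrite /q; ring.
pose g n (y : R) := y `^ a * (psum a n \Po (1 - 'X)).[y].
pose dg n (y : R) := y `^ (a - 1) * (n.+1%:R * coef a n.+1 * (1 - y) ^+ n).
have gE n : series (pascal_pmf p a) n = g n q.
  rewrite /g horner_comp !hornerE qE /series/= /psum horner_sum.
  rewrite mulr_sumr big_mkord; apply: eq_bigr => k _.
  rewrite hornerZ hornerXn /pascal_pmf /coef -/q.
  by move: (q `^ a) (rising a k) (p ^+ k) (k`!%:R^-1) => x y z t; ring.
have g1 n : g n.+1 1 = 1.
  rewrite /g powR1 mul1r horner_comp !hornerE subrr horner_sum big_ord_recl.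
  rewrite big1 ?addr0; last by move=> k _; rewrite !hornerE /= expr0n mulr0.
  by rewrite hornerZ hornerXn expr0 /coef /rising big_ord0 fact0 divr1 mulr1.
have dgE n (y : R) : 0 < y -> is_derive y (1 : R) (g n.+1 : R -> R) (dg n y).
  move=> y0.
  have d1 : is_derive y (1 : R) (fun z : R => z `^ a) (a * y `^ (a - 1)) by exact: is_derive1_powR.
  pose Q := psum a n.+1 \Po (1 - 'X).
  have d2 : is_derive y (1 : R) (horner Q : R -> R) Q^`().[y].
    apply: DeriveDef; first exact: derivable_horner.
    by rewrite -derive1E -derivE.
  apply: is_derive_eq.
  rewrite /dg -[_ *: _]/(_ * _) -[X in _ + X]/(_ * _).
  have -> : y `^ a = y `^ (a - 1) * y.
    by rewrite -{1}(subrK 1 a) [LHS]powRD ?powRr1 ?ltW// (gt_eqF y0) implybT.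
  have E1 : (1 - 'X).[y] = 1 - y by rewrite !hornerE.
  rewrite /Q deriv_comp derivB derivC derivX sub0r mulrN1 hornerN !horner_comp E1.
  set P := psum a n.+1; have ode := psum_ode a n (1 - y).
  have -> : n.+1%:R * coef a n.+1 * (1 - y) ^+ n = a * P.[1 - y] - y * P^`().[1 - y].
    have yE : 1 - (1 - y) = y by ring.
    by move: ode; rewrite -/P yE => ->; ring.
  move: (y `^ _) (P.[_]) (P^`().[_]) => A B C; ring.
(* The mean value theorem on [q, 1] bounds the distance to 1 by a derivative,
   which is the first omitted term up to a constant factor. *)
have mvt n : exists2 y : R, y \in `]q, 1[ & g n.+1 q = 1 - dg n y * p.
  have [y yq E] : exists2 y : R, y \in `]q, 1[ & g n.+1 1 - g n.+1 q = dg n y * (1 - q).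
    apply: MVT => // [x|].
      by rewrite in_itv/= => /andP[qx _]; apply: dgE; exact: lt_trans qx.
    apply: derivable_within_continuous => x; rewrite in_itv/= => /andP[qx _].
    by have [] := dgE n x (lt_le_trans q0 qx).
  exists y => //; move: E; rewrite g1 qE => <-.
  by rewrite opprB addrC subrK.
pose Mx := expR (`|a - 1| * - ln q).
(* Here [1 - y <= p], as [y] is at least [q = 1 - p]. *)
have bound n (y : R) : y \in `]q, 1[ ->
    0 <= dg n y * p <= Mx * expR (- (a * ln q)) * (n.+1%:R ^+ 1 * pascal_pmf p a n.+1).
  rewrite in_itv/= => /andP[qy y1]; have y0 := lt_trans q0 qy.
  have c0 : 0 <= coef a n.+1 by rewrite divr_ge0 ?rising_ge0.
  have t0 : 0 <= 1 - y by rewrite subr_ge0 ltW.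
  apply/andP; split.
    rewrite mulr_ge0 ?(ltW p_gt0)// /dg mulr_ge0 ?powR_ge0//.
    by apply: mulr_ge0; [exact: mulr_ge0|exact: exprn_ge0].
  rewrite /dg /pascal_pmf expr1.
  have -> : (1 - p) `^ a = expR (a * ln q) by rewrite /powR -/q gt_eqF.
  rewrite [leRHS](_ : _ = Mx * (n.+1%:R * coef a n.+1 * p ^+ n.+1)); last first.
    rewrite expRN /coef; have := gt_eqF (expR_gt0 (a * ln q)).
    have nf : n.+1`!%:R != 0 :> R by rewrite pnatr_eq0 -lt0n fact_gt0.
    move: (expR (a * _)) (rising _ _) (n.+1`!%:R) (p ^+ n.+1) nf => e x f z f0 /negbT e0.
    by field; rewrite f0 e0.
  rewrite [leLHS](_ : _ = y `^ (a - 1) * (n.+1%:R * coef a n.+1 * ((1 - y) ^+ n * p))); last ring.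
  apply: ler_pM.
  - exact: powR_ge0.
  - by apply: mulr_ge0; [exact: mulr_ge0|rewrite mulr_ge0 ?exprn_ge0// ltW].
  - rewrite /powR gt_eqF// ler_expR; apply: le_trans (ler_norm _) _.
    have ly : ln y <= 0 by rewrite ln_le0// ltW.
    by rewrite normrM ler_wpM2l// (ler0_norm ly) lerN2 ler_ln ?posrE// ltW.
  - rewrite exprSr; apply: ler_wpM2l; first exact: mulr_ge0.
    apply: ler_wpM2r; first exact: ltW.
    by apply: lerXn2r; rewrite ?nnegrE ?(ltW p_gt0)//; move: qy; rewrite /q; lra.
rewrite -cvg_shiftS /=.
have -> : (fun n => series (pascal_pmf p a) n.+1) = (fun n => g n.+1 q).
  by apply/funext => n; rewrite gE.
pose K := Mx * expR (- (a * ln q)).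
apply: (@squeeze_cvgr _ _ _ _
   (fun n => 1 - K * (n.+1%:R ^+ 1 * pascal_pmf p a n.+1)) (cst 1)); last 2 first.
- rewrite -[X in _ --> X]subr0 -[X in _ --> _ - X](mulr0 K).
  apply: cvgB; first exact: cvg_cst.
  apply: cvgM; first exact: cvg_cst.
  have := pascal_pmf_moment_cvg0 1 a0; rewrite -cvg_shiftS /=; exact.
- exact: cvg_cst.
apply: nearW => n; have [y yI ->] := mvt n; have /andP[b1 b2] := bound n y yI.
by rewrite lerD2l lerN2 b2 /= gerDl oppr_le0.
Qed.

End negative_binomial.

(** * The law of finitely many counts *)

Section discrete_integral.
Context d (Omega : measurableType d) (R : realType).
Variables (mu : {measure set Omega -> \bar R}) (K : countType) (D : set Omega).
Variable (N : Omega -> K).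
Hypothesis mN : forall k, measurable (D `&` [set w | N w = k]).

Let fib i := D `&` [set w | pickle (N w) = i].

Let mfib i : measurable (fib i).
Proof.
case E : (pickle_inv i : option K) => [k|].
  rewrite (_ : fib i = D `&` [set w | N w = k])//.
  have pk : pickle k = i by have := @pickle_invK K i; rewrite E.
  apply/seteqP; split=> w [Dw]; rewrite /= => Nw; split=> //=; last by rewrite Nw.
  by apply: (pcan_inj pickleK); rewrite pk.
rewrite (_ : fib i = set0) //; apply/seteqP; split=> // w [_ /= Nw].
by move: E; rewrite -Nw pickleK_inv.
Qed.

Let D_fib : D = \bigcup_i fib i.
Proof. by apply/seteqP; split=> [w Dw|w [i _ []]//]; exists (pickle (N w)). Qed.

(** A map with countably many values and measurable fibres makes every function of
    it measurable; the values are enumerated by [pickle]. *)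
Lemma measurable_discrete d' (Y : measurableType d') (g : K -> Y) :
  measurable_fun D (fun w => g (N w)).
Proof.
move=> mD B mB; rewrite (_ : _ `&` _ =
  \bigcup_(i in [set i | exists k, pickle k = i /\ B (g k)]) fib i).
  by apply: bigcup_measurable => i _; exact: mfib.
apply/seteqP; split=> w.
  by move=> [Dw Bw]; exists (pickle (N w)) => //; exists (N w).
move=> [i [k [ki Bk]]] [Dw /= Nw]; split=> //=.
by rewrite (_ : N w = k)//; apply: (pcan_inj pickleK); rewrite Nw.
Qed.

Lemma ge0_integral_discrete (g : K -> \bar R) : (forall k, 0 <= g k)%E ->
  (\int[mu]_(w in D) g (N w) =
   \esum_(k in [set: K]) g k * mu (D `&` [set w | N w = k]))%E.
Proof.
move=> g0.
have mg : measurable_fun D (g \o N) by exact: measurable_discrete.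
pose c i := oapp g 0%E (pickle_inv i : option K).
have c0 i : (0 <= c i)%E by rewrite /c; case: (pickle_inv i) => /=.
have intE : (\int[mu]_(w in D) g (N w) = \sum_(i <oo) c i * mu (fib i))%E.
  rewrite {1}D_fib ge0_integral_bigcup//; last 2 first.
  - by rewrite -D_fib.
  - move=> i j _ _ [w [[_ <-] [_ <-]]] //.
  apply: eq_eseriesr => i _; rewrite -integral_cst//; apply: eq_integral => w.
  by rewrite inE => -[_ /= Nw]; rewrite /c -Nw pickleK_inv.
rewrite intE nneseries_esumT; last by move=> i; rewrite mule_ge0.
transitivity (\esum_(i in [set pickle k | k in [set: K]]) c i * mu (fib i))%E.
  rewrite [RHS]esum_mkcond; apply: eq_esum => i _; case: ifPn => // /negP ni.
  rewrite (_ : fib i = set0) ?measure0 ?mule0//; apply/seteqP; split=> // w [_ /= Nw].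
  by apply: ni; rewrite inE; exists (N w).
rewrite esum_image; last by move=> x y _ _; exact: (pcan_inj pickleK).
apply: eq_esum => k _; rewrite /c pickleK_inv; congr (_ * mu _)%E.
apply/seteqP; split=> w [Dw /= Nw]; split=> //=; last by rewrite Nw.
exact: (pcan_inj pickleK).
Qed.

End discrete_integral.

Section counts.
Context d (X : measurableType d) (R : realType).
Variables (alpha : {measure set X -> \bar R}) (p : R).
Variable rho : probability (config X R) R.
Hypotheses (p01 : 0 < p < 1) (hrho : pascal_process p alpha rho).
Implicit Types (eta : config X R) (B : set X).

Lemma measurable_eval B : measurable B ->
  measurable_fun [set: config X R] (fun eta => eta B : \bar R).
Proof.
move=> mB _ A mA; apply: sub_sigma_algebra; exists B => //=.
by exists A.
Qed.

Definition count B eta : nat := Num.truncn (fine (eta B)).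

Lemma count_finE B eta : (eta B < +oo)%E -> eta B = ((count B eta)%:R)%:E.
Proof.
move=> fin; suff [n nE] : exists n : nat, eta B = (n%:R)%:E.
  by rewrite /count nE /= natrK.
have [s [sB /(_ B)]] := exists_points fin; rewrite setIid => ->.
exists (size s); rewrite (eq_big_seq (fun=> 1%E)).
  by elim: s {sB} => [|x s ih]; rewrite ?big_nil// big_cons ih /= -natr1 EFinD addeC.
by move=> x /sB Bx; rewrite diracE mem_set.
Qed.

Lemma measurable_count_eq B n : measurable B ->
  measurable [set eta : config X R | eta B = n%:R%:E].
Proof.
move=> mB; have := measurable_eval mB measurableT (emeasurable_set1 n%:R%:E).
by rewrite setTI.
Qed.

Lemma pascal_count_law B n : measurable B -> (alpha B < +oo)%E ->
  rho [set eta : config X R | eta B = n%:R%:E] = (pascal_pmf p (fine (alpha B)) n)%:E.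
Proof.
move=> mB fin; have mE := @measurable_count_eq B n mB.
have [a0|a0] := eqVneq (alpha B) 0%E; last first.
  by apply: (pascal_count hrho); rewrite // fin andbT lt0e a0 measure_ge0.
have null := pascal_null hrho mB a0.
rewrite a0 /= pascal_pmf_0; case: n mE => [|n] mE /=.
  have E0 : rho (~` [set eta : config X R | eta B = 0%:R%:E]) = 0%E.
    by apply: measure_negligible => //; exact: measurableC.
  by rewrite -[X in rho X]setCK probability_setC ?E0 ?sube0//; exact: measurableC.
apply: measure_negligible => //; apply: negligibleS null => eta /= ->.
by move/eqP; rewrite eqe pnatr_eq0.
Qed.

Lemma measurable_count_fin B : measurable B ->
  measurable [set eta : config X R | (eta B < +oo)%E].
Proof.
move=> mB; have := measurable_eval mB measurableT.
have mI : measurable [set x : \bar R | (x < +oo)%E].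
  by have := @emeasurable_itv R `]-oo, +oo%E[; rewrite set_itvE.
by move=> /(_ _ mI); rewrite setTI.
Qed.

Lemma pascal_count_fin B : measurable B -> (alpha B < +oo)%E ->
  rho [set eta : config X R | (eta B < +oo)%E] = 1%E.
Proof.
move=> mB fin.
have -> : [set eta : config X R | (eta B < +oo)%E] =
    \bigcup_n [set eta : config X R | eta B = n%:R%:E].
  apply/seteqP; split=> eta /=; last by move=> [n _ /= ->]; exact: ltry.
  by move=> /count_finE E; exists (count B eta).
rewrite measure_bigcup//; last 2 first.
- by move=> n _; exact: measurable_count_eq.
- move=> i j _ _ [eta [/= -> /eqP]]; rewrite eqe eqr_nat => /eqP //.
have a0 : 0 <= fine (alpha B) by rewrite fine_ge0.
apply: cvg_lim => //=.
rewrite (_ : (fun n => _) = EFin \o series (pascal_pmf p (fine (alpha B)))).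
  apply: cvg_EFin; first exact: nearW.
  exact: pascal_pmf_sum1.
apply/funext => n; rewrite /series /= -sumEFin.
by rewrite big_mkcond/=; apply: eq_bigr => i _; rewrite in_setT pascal_count_law.
Qed.

Lemma pascal_fin_ae B : measurable B -> (alpha B < +oo)%E ->
  {ae rho, forall eta : config X R, (eta B < +oo)%E}.
Proof.
move=> mB fin; exists (~` [set eta : config X R | (eta B < +oo)%E]); split => //.
- by apply: measurableC; exact: measurable_count_fin.
- by rewrite probability_setC ?pascal_count_fin ?subee//; exact: measurable_count_fin.
Qed.

End counts.

Section joint_counts.
Context d (X : measurableType d) (R : realType).
Variables (alpha : {measure set X -> \bar R}) (p : R).
Variable rho : probability (config X R) R.
Hypotheses (p01 : 0 < p < 1) (hrho : pascal_process p alpha rho).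
Variables (T : finType) (C : T -> set X).
Hypotheses (mC : forall t, measurable (C t)) (tC : trivIset [set: T] C).
Hypothesis fC : forall t, (alpha (C t) < +oo)%E.
Implicit Types (eta : config X R) (n : {ffun T -> nat}) (t : T).

Definition counts eta : {ffun T -> nat} := [ffun t => count (C t) eta].

Definition counts_fin : set (config X R) := [set eta | forall t, (eta (C t) < +oo)%E].

Definition counts_weight n : R := \prod_t pascal_pmf p (fine (alpha (C t))) (n t).

Lemma measurable_forall_fin (P : T -> set (config X R)) :
  (forall t, measurable (P t)) -> measurable [set eta | forall t, P t eta].
Proof.
move=> mP; rewrite (_ : [set eta | _] = \big[setI/setT]_(t : T) P t).
  by apply: bigsetI_measurable => t _; exact: mP.
apply/seteqP; split=> eta /=.
  move=> H; elim/big_ind: _ => // A A' HA HA'; by split.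
by move=> H t; move: H; rewrite (bigD1 t)//= => -[].
Qed.

Lemma measurable_counts_fin : measurable counts_fin.
Proof.
by apply: (@measurable_forall_fin (fun t => [set eta | (eta (C t) < +oo)%E])) => t;
  exact: measurable_count_fin.
Qed.

Lemma ae_forall_fin (P : T -> config X R -> Prop) :
  (forall t, {ae rho, forall eta, P t eta}) -> {ae rho, forall eta, forall t, P t eta}.
Proof.
move=> aeP.
suff H (s : seq T) : {ae rho, forall eta, forall t, t \in s -> P t eta}.
  by apply: filterS (H (enum T)) => eta + t; apply; rewrite mem_enum.
elim: s => [|t s ih]; first by apply: aeW => eta t.
by apply: filterS2 (aeP t) ih => eta Pt Ps u; rewrite inE => /orP[/eqP ->//|/Ps].
Qed.

Lemma counts_fin_null : rho (~` counts_fin) = 0%E.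
Proof.
apply: measure_negligible; first by apply: measurableC; exact: measurable_counts_fin.
by apply: ae_forall_fin => t; exact: (pascal_fin_ae p01 hrho).
Qed.

Lemma counts_fiber n :
  counts_fin `&` [set eta | counts eta = n] =
  [set eta | forall t, eta (C t) = ((n t)%:R)%:E].
Proof.
apply/seteqP; split=> eta /=.
  by move=> [fin <-] t; rewrite ffunE; exact: count_finE (fin t).
move=> E; split; first by move=> t; rewrite E ltry.
by apply/ffunP => t; rewrite ffunE /count E /= natrK.
Qed.

(** Independence gives the product of the one-cell laws. For fewer than two cells
    there is nothing to be independent of, and the formula is checked directly. *)
Lemma counts_law n :
  rho (counts_fin `&` [set eta | counts eta = n]) = (counts_weight n)%:E.
Proof.
rewrite counts_fiber.
pose B (i : 'I_#|T|) := C (enum_val i).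
pose A (i : 'I_#|T|) : set (\bar R) := [set ((n (enum_val i))%:R)%:E].
have ind : rho [set eta : config X R | forall i, A i (eta (B i))]
    = (\prod_(i < #|T|) rho [set eta : config X R | A i (eta (B i))])%E.
  have tB : trivIset [set: 'I_#|T|] B.
    by move=> i j _ _ h; apply: enum_val_inj; exact: (tC Logic.I Logic.I h).
  have mB i : measurable (B i) by exact: mC.
  have mA i : measurable (A i) by exact: emeasurable_set1.
  move: tB mB mA; move: (#|T|) B A => [|[|k]] B A tB mB mA.
  - rewrite big_ord0 (_ : [set eta | _] = setT) ?probability_setT//.
    by apply/seteqP; split=> // eta _ [].
  - rewrite big_ord1; congr (rho _); apply/seteqP; split=> eta /= => [|H i]; first exact.
    by rewrite (ord1 i).
  - exact: (pascal_independent hrho).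
transitivity (rho [set eta : config X R | forall i, A i (eta (B i))]).
  congr (rho _); apply/seteqP; split=> eta /= H => [i|t]; first exact: H.
  by have := H (enum_rank t); rewrite /A /B enum_rankK.
rewrite ind /counts_weight -prodEFin [RHS]big_enum_val; apply: eq_bigr => i _.
by rewrite -(pascal_count_law hrho).
Qed.

Lemma ge0_integral_full (D : set (config X R)) (f : config X R -> \bar R) :
  measurable D -> rho (~` D) = 0%E -> measurable_fun setT f -> (forall x, 0 <= f x)%E ->
  (\int[rho]_x f x = \int[rho]_(x in D) f x)%E.
Proof.
move=> mD D0 mf f0; rewrite (ge0_negligible_integral (measurableC mD))//.
by rewrite setDE setCK setTI.
Qed.

Lemma measurable_count_fiber B k : measurable B ->
  measurable [set eta : config X R | count B eta = k].
Proof.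
move=> mB; rewrite (_ : [set eta | _] =
  [set eta : config X R | eta B = k%:R%:E] `|`
  ((~` [set eta : config X R | (eta B < +oo)%E]) `&`
   (if k == 0%N then setT else set0))).
  apply: measurableU; first exact: measurable_count_eq.
  apply: measurableI; last by case: ifP.
  by apply: measurableC; exact: measurable_count_fin.
apply/seteqP; split=> eta /=.
  move=> ck; have [fin|/negP nfin] := boolP (eta B < +oo)%E.
    by left; rewrite (count_finE fin) ck.
  right; split=> //; move: ck; rewrite /count.
  by move: nfin => /negP; rewrite -leNgt leye_eq => /eqP -> /= <-; rewrite truncn0.
case=> [E|[/negP]]; first by rewrite /count E /= natrK.
rewrite -leNgt leye_eq => /eqP e; rewrite /count e /= truncn0.
by case: eqP.
Qed.

Lemma measurable_counts_fiber n : measurable (setT `&` [set eta | counts eta = n]).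
Proof.
rewrite setTI (_ : [set eta | _] = [set eta | forall t, count (C t) eta = n t]).
  apply: (@measurable_forall_fin (fun t => [set eta | count (C t) eta = n t])) => t.
  exact: measurable_count_fiber.
by apply/seteqP; split=> eta /= => [<- t|H]; [rewrite ffunE|apply/ffunP => t; rewrite ffunE].
Qed.

Lemma integral_counts (g : {ffun T -> nat} -> \bar R) : (forall n, 0 <= g n)%E ->
  (\int[rho]_eta g (counts eta) =
   \esum_(n in [set: {ffun T -> nat}]) (g n * (counts_weight n)%:E))%E.
Proof.
move=> g0; rewrite (ge0_integral_full measurable_counts_fin counts_fin_null)//; last first.
  by apply: measurable_discrete => n; exact: measurable_counts_fiber.
rewrite ge0_integral_discrete//.
  by apply: eq_esum => n _; congr (_ * _)%E; exact: counts_law.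
move=> n; apply: measurableI; first exact: measurable_counts_fin.
by have := measurable_counts_fiber n; rewrite setTI.
Qed.

Definition incr t n : {ffun T -> nat} := [ffun s => (n s + (s == t))%N].

Let a t : R := fine (alpha (C t)).

Let a_ge0 t : 0 <= a t. Proof. exact: fine_ge0. Qed.

Lemma counts_weight_incr t n :
  (n t).+1%:R * counts_weight (incr t n) = p * ((n t)%:R + a t) * counts_weight n.
Proof.
rewrite /counts_weight (bigD1 t)//= ffunE eqxx addn1 [LHS]mulrA pascal_pmfS.
rewrite [in RHS](bigD1 t)//= [RHS]mulrA; congr (_ * _).
by apply: eq_bigr => s /negbTE st; rewrite ffunE st addn0.
Qed.

(** The recursion of the weights becomes, after a shift of the summation index,
    Mecke's equation for functions of finitely many counts. *)
Lemma ge0_mecke_counts t (Q : {ffun T -> nat} -> R) : (forall n, 0 <= Q n) ->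
  (\int[rho]_eta (((counts eta t)%:R * Q (counts eta))%:E) =
   \int[rho]_eta
     ((p * ((counts eta t)%:R + a t) * Q (incr t (counts eta)))%:E))%E.
Proof.
move=> Q0; have p0 : 0 < p by case/andP: p01.
pose g1 n := ((n t)%:R * Q n)%:E.
pose g2 n := (p * ((n t)%:R + a t) * Q (incr t n))%:E.
rewrite (integral_counts (g := g1)); last by move=> n; rewrite lee_fin mulr_ge0.
rewrite (integral_counts (g := g2)); last first.
  by move=> n; rewrite lee_fin mulr_ge0// mulr_ge0 ?addr_ge0// ltW.
transitivity (\esum_(n in [set n : {ffun T -> nat} | (0 < n t)%N])
    (g1 n * (counts_weight n)%:E))%E.
  rewrite [RHS]esum_mkcond; apply: eq_esum => n _; case: ifPn => // /negP nt.
  rewrite /g1; move: nt; rewrite inE /= lt0n => /negP; rewrite negbK => /eqP ->.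
  by rewrite mul0r mul0e.
rewrite (reindex_esum [set: {ffun T -> nat}] _ (incr t)).
  apply: eq_esum => n _; rewrite /g1 /g2 ffunE eqxx addn1 -!EFinM; congr EFin.
  by rewrite mulrAC counts_weight_incr mulrAC.
split.
- by move=> n _ /=; rewrite ffunE eqxx addn1.
- move=> n m _ _ /ffunP nm; apply/ffunP => s; have := nm s.
  by rewrite !ffunE => /addIn.
- move=> n /= nt; exists [ffun s => (n s - (s == t))%N] => //.
  apply/ffunP => s; rewrite !ffunE subnK//.
  by case: eqP => // ->.
Qed.

Lemma mecke_counts t (Q : {ffun T -> nat} -> R) :
  \int[rho]_eta ((counts eta t)%:R * Q (counts eta)) =
  \int[rho]_eta (p * ((counts eta t)%:R + a t) * Q (incr t (counts eta))).
Proof.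
have p0 : 0 < p by case/andP: p01.
have pos (c x : R) : 0 <= c -> maxe (c * x)%:E 0%E = (c * Num.max x 0)%:E.
  by move=> c0; rewrite maxr_pMr// mulr0 -EFin_max.
have neg (c x : R) : 0 <= c -> maxe (- (c * x)%:E)%E 0%E = (c * Num.max (- x) 0)%:E.
  by move=> c0; rewrite -EFinN -mulrN pos.
have pa n : 0 <= p * ((n t)%:R + a t) by rewrite mulr_ge0 ?addr_ge0// ltW.
rewrite /Rintegral; congr fine; rewrite integralE [RHS]integralE; congr (_ - _)%E.
  under eq_integral do rewrite funeposE pos//.
  under [RHS]eq_integral do rewrite funeposE pos//.
  apply: (ge0_mecke_counts t (Q := fun n => Num.max (Q n) 0)) => n.
  by rewrite le_max lexx orbT.
under eq_integral do rewrite funenegE neg//.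
under [RHS]eq_integral do rewrite funenegE neg//.
apply: (ge0_mecke_counts t (Q := fun n => Num.max (- Q n) 0)) => n.
by rewrite le_max lexx orbT.
Qed.

End joint_counts.

Section count_moments.
Context d (X : measurableType d) (R : realType).
Variables (alpha : {measure set X -> \bar R}) (p : R).
Variable rho : probability (config X R) R.
Hypotheses (p01 : 0 < p < 1) (hrho : pascal_process p alpha rho).
Variable (S : set X).
Hypotheses (mS : measurable S) (alphaS : (alpha S < +oo)%E).

Lemma measurable_of_count d' (Y : measurableType d') (g : nat -> Y) :
  measurable_fun [set: config X R] (fun eta => g (count S eta)).
Proof.
by apply: measurable_discrete => k; rewrite setTI; exact: measurable_count_fiber.
Qed.

(** All moments, and even small exponential moments, of a count are finite. *)
Lemma count_exp_integrable (g : nat -> R) (K : R) :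
  (forall n, `|g n| <= K * expR (pascal_rate p / 2 * n%:R)) ->
  rho.-integrable setT (EFin \o (fun eta => g (count S eta))).
Proof.
move=> gK; apply/integrableP; split.
  by apply/measurable_EFinP; exact: measurable_of_count.
have a0 : 0 <= fine (alpha S) by exact: fine_ge0.
have [C C0 HC] := pascal_pmf_le p01 a0.
have K0 : 0 <= K by have := le_trans (normr_ge0 _) (gK 0%N); rewrite mulr0 expR0 mulr1.
pose D := [set eta : config X R | (eta S < +oo)%E].
have mD : measurable D by exact: measurable_count_fin.
have D0 : rho (~` D) = 0%E.
  by rewrite probability_setC// /D (pascal_count_fin p01 hrho)// subee.
rewrite (ge0_integral_full mD D0)//; last first.
  by apply: (measurable_of_count (fun n => `|(g n)%:E|%E)).
have mF k : measurable (D `&` [set eta | count S eta = k]).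
  by apply: measurableI => //; exact: measurable_count_fiber.
rewrite (ge0_integral_discrete rho mF (g := fun n => `|(g n)%:E|%E))//.
rewrite -nneseries_esumT//.
pose e := pascal_rate p / 2; have e0 : 0 < e by rewrite divr_gt0// pascal_rate_gt0.
pose z := expR (- e).
have z1 : `|z| < 1 by rewrite ger0_norm ?expR_ge0// expR_lt1 oppr_lt0.
have fE k : D `&` [set eta | count S eta = k] = [set eta : config X R | eta S = k%:R%:E].
  apply/seteqP; split=> eta /=; first by move=> [fin <-]; exact: count_finE.
  by move=> E; split; [rewrite /D /= E ltry|rewrite /count E /= natrK].
(* The weights decay at twice the rate at which [g] may grow. *)
apply: (@le_lt_trans _ _ (\sum_(k <oo) (geometric (K * C) z k)%:E)%E).
  apply: lee_nneseries => // k _. 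
  rewrite [X in (_ * X)%E](_ : _ = (pascal_pmf p (fine (alpha S)) k)%:E); last first.
    by have := pascal_count_law hrho k mS alphaS; rewrite -fE.
  rewrite abse_EFin -EFinM lee_fin /geometric /=.
  apply: le_trans (ler_pM _ _ (gK k) (HC k)) _ => //.
    exact: pascal_pmf_ge0.
  rewrite mulrACA -expRD -expRM_natr ler_wpM2l ?mulr_ge0// ler_expR.
  by rewrite -mulrDl ler_wpM2r// /e; lra.
have KC0 : 0 <= K * C by exact: mulr_ge0.
have cv := @cvg_geometric_series R (K * C) z z1.
rewrite (_ : (\sum_(k <oo) _)%E = ((K * C) * (1 - z)^-1)%:E) ?ltry//.
apply: cvg_lim => //.
rewrite (_ : (fun n => _) = EFin \o series (geometric (K * C) z)).
  by apply: cvg_EFin; [exact: nearW|exact: cv].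
by apply/funext => k; rewrite /series /= -sumEFin.
Qed.

Lemma count_moment_integrable k :
  rho.-integrable setT (EFin \o (fun eta : config X R => (1 + (count S eta)%:R) ^+ k)).
Proof.
pose e := pascal_rate p / 2; have e0 : 0 < e by rewrite divr_gt0// pascal_rate_gt0.
apply: (@count_exp_integrable (fun n => (1 + n%:R) ^+ k) (k`!%:R / e ^+ k * expR e)) => n.
rewrite ger0_norm ?exprn_ge0 ?addr_ge0// -/e nat1r.
apply: le_trans (natr_exp_le_expR _ _ e0) _.
by rewrite -[leRHS]mulrA -expRD -natr1 mulrDr mulr1 addrC.
Qed.

End count_moments.

(** * Expectations of polynomials *)

Section complex_convergence.
Context (R : realType).

Definition ccvg (u : nat -> R[i]) (l : R[i]) : Prop :=
  (fun k => Re (u k)) @ \oo --> Re l /\ (fun k => Im (u k)) @ \oo --> Im l.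

Lemma ccvg_cst (l : R[i]) : ccvg (fun=> l) l.
Proof. by split; exact: cvg_cst. Qed.

Lemma ccvgD u v l m : ccvg u l -> ccvg v m -> ccvg (fun k => u k + v k) (l + m).
Proof.
move=> [u1 u2] [v1 v2]; split.
  by under eq_fun do rewrite ReD; rewrite ReD; exact: cvgD.
by under eq_fun do rewrite ImD; rewrite ImD; exact: cvgD.
Qed.

Lemma ccvgM u v l m : ccvg u l -> ccvg v m -> ccvg (fun k => u k * v k) (l * m).
Proof.
move=> [u1 u2] [v1 v2]; split.
  by under eq_fun do rewrite ReM; rewrite ReM; apply: cvgB; exact: cvgM.
by under eq_fun do rewrite ImM; rewrite ImM; apply: cvgD; exact: cvgM.
Qed.

Lemma ccvg_unique u l m : ccvg u l -> ccvg u m -> l = m.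
Proof.
move=> [u1 u2] [v1 v2]; apply: complex_eqP.
  exact: (cvg_unique _ u1 v1).
exact: (cvg_unique _ u2 v2).
Qed.

Lemma cintegral_dominated_cvg d (T : measurableType d) (mu : {measure set T -> \bar R})
    (f_ : nat -> T -> R[i]) (f : T -> R[i]) (g : T -> R) :
  (forall k, cmeasurable (f_ k)) -> cmeasurable f ->
  (forall x, ccvg (f_ ^~ x) (f x)) ->
  (forall k x, normc (f_ k x) <= g x) -> mu.-integrable setT (EFin \o g) ->
  ccvg (fun k => cintegral mu (f_ k)) (cintegral mu f).
Proof.
move=> mf_ mf ff fg ig.
have H (h_ : nat -> T -> R) (h : T -> R) :
    (forall k, measurable_fun setT (h_ k)) -> measurable_fun setT h ->
    (forall x, h_ ^~ x @ \oo --> h x) -> (forall k x, `|h_ k x| <= g x) ->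
    (fun k => \int[mu]_x h_ k x) @ \oo --> \int[mu]_x h x.
  move=> mh_ mh hh hg.
  have [] := @dominated_convergence _ T R mu setT measurableT
    (fun k x => (h_ k x)%:E) (fun x => (h x)%:E) (EFin \o g).
  - by move=> k; exact/measurable_EFinP.
  - exact/measurable_EFinP.
  - by apply: aeW => x _; apply: cvg_EFin; [exact: nearW|exact: hh].
  - exact: ig.
  - by apply: aeW => x k _; rewrite lee_fin.
  move=> ih _ cv.
  by apply: fine_cvg; rewrite fineK//; exact: (integrable_fin_num _ ih).
split; apply: H.
- by move=> k; case: (mf_ k).
- by case: mf.
- by move=> x; case: (ff x).
- by move=> k x; apply: le_trans (normr_Re_le _) _.
- by move=> k; case: (mf_ k).
- by case: mf.
- by move=> x; case: (ff x).
- by move=> k x; apply: le_trans (normr_Im_le _) _.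
Qed.

End complex_convergence.

Section polynomial_moments.
Context d (X : measurableType d) (R : realType).
Hypothesis msing : forall x : X, measurable [set x].
Variables (alpha : {measure set X -> \bar R}) (S : set X).
Hypotheses (mS : measurable S) (alphaS : (alpha S < +oo)%E).

Implicit Types (eta : config X R) (phi theta psi : X -> R[i]).
Implicit Types (F G H : config X R -> R[i]).

Local Notation test := (test_on S).
Local Notation vacuum := (@vacuum _ X R S).
Local Notation pol := (pol S).

(** The identity is a kernel from configurations to points, so that integration
    against it preserves measurability. *)
Lemma measurable_Rintegral_config (f : X -> R) : measurable_fun setT f ->
  measurable_fun [set: config X R] (fun eta => \int[eta]_x f x).
Proof.
move=> mf; apply: measurableT_comp; first exact: fine_measurable.
under eq_fun do rewrite integralE.
have mE : measurable_fun setT (EFin \o f) by exact/measurable_EFinP.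
apply: emeasurable_funB.
  apply: (@measurable_fun_integral_kernel _ _ (config X R) X R (@config_measure d X R)) => //.
    by move=> U mU; exact: measurable_eval.
  exact: measurable_funepos.
apply: (@measurable_fun_integral_kernel _ _ (config X R) X R (@config_measure d X R)) => //.
  by move=> U mU; exact: measurable_eval.
exact: measurable_funeneg.
Qed.

Lemma cmeasurable_cintegral phi : cmeasurable phi ->
  cmeasurable (fun eta : config X R => cintegral eta phi).
Proof. by move=> [m1 m2]; split; exact: measurable_Rintegral_config. Qed.

Lemma cmeasurable_vacuum : cmeasurable vacuum.
Proof.
have -> : vacuum = (fun eta => (\1_[set eta : config X R | (eta S < +oo)%E] eta)%:C).
  apply/funext => eta; rewrite /vacuum indicE; case: ifPn => h.
    by rewrite mem_set.
  by rewrite memNset//; exact/negP.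
split; last exact: measurable_cst.
by apply: measurable_indic; exact: measurable_count_fin.
Qed.

Lemma pol_cmeasurable F : pol F -> cmeasurable F.
Proof.
elim=> {F} [|phi F tphi _ mF|a F G _ mF _ mG]; first exact: cmeasurable_vacuum.
  by apply: cmeasurableM => //; apply: cmeasurable_cintegral; case: tphi.
apply: (cmeasurableD _ mG); apply: (cmeasurableM _ mF); exact: cmeasurable_cst.
Qed.

(** Polynomials are dominated by powers of the number of points in [S], which have
    all moments; the value 0 on the other configurations matches [vacuum]. *)
Definition growth m eta : R := if (eta S < +oo)%E then (1 + (count S eta)%:R) ^+ m else 0.

Lemma growth_ge0 m eta : 0 <= growth m eta.
Proof. by rewrite /growth; case: ifP => // _; rewrite exprn_ge0// addr_ge0. Qed.

Lemma growthD m n eta : growth m eta * growth n eta = growth (m + n) eta.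
Proof. by rewrite /growth; case: ifP; rewrite ?mulr0// exprD. Qed.

Lemma growth_mono m n eta : (m <= n)%N -> growth m eta <= growth n eta.
Proof.
by move=> mn; rewrite /growth; case: ifP => // _; rewrite ler_weXn2l// lerDl.
Qed.

Lemma size_points eta : (eta S < +oo)%E -> size (points S eta) = count S eta.
Proof.
move=> fin; have [sS /(_ S)] := pointsP fin; rewrite setIid /count => ->.
rewrite (eq_big_seq (fun=> 1%E)); last by move=> x /sS Sx; rewrite diracE mem_set.
rewrite (_ : (\sum_(i <- _) _)%E = (size (points S eta))%:R%:E) /= ?natrK//.
elim: (points S eta) => [|x s ih]; first by rewrite big_nil.
by rewrite big_cons ih /= -natr1 EFinD addeC.
Qed.

Lemma normc_sum (I : Type) (s : seq I) (f : I -> R[i]) :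
  normc (\sum_(i <- s) f i) <= \sum_(i <- s) normc (f i).
Proof.
elim: s => [|i s ih]; first by rewrite !big_nil ComplexField.Normc.normc0.
by rewrite !big_cons; apply: le_trans (le_normcD _ _) _; rewrite lerD2l.
Qed.

(** The integral is a sum over the points in [S]. *)
Lemma normc_cintegral_config phi M eta : test phi -> (forall x, normc (phi x) <= M) ->
  (eta S < +oo)%E -> normc (cintegral eta phi) <= M * (1 + (count S eta)%:R).
Proof.
move=> [mphi _ phi0] HM fin; rewrite (cintegral_points mS fin)//.
apply: le_trans (normc_sum _ _) _.
have M0 : 0 <= M by apply: le_trans (normc_ge0 (phi point)) (HM _).
apply: (@le_trans _ _ (\sum_(x <- points S eta) M)); first by apply: ler_sum => x _.
rewrite big_const_seq count_predT size_points// iter_addr addr0 -[M *+ _]mulr_natr.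
by rewrite ler_wpM2l// lerDr.
Qed.

Lemma pol_growth F : pol F ->
  exists K m, 0 <= K /\ forall eta, normc (F eta) <= K * growth m eta.
Proof.
elim=> {F} [|phi F tphi _ [K [m [K0 HK]]]|a F G _ [K [m [K0 HK]]] _ [L [n [L0 HL]]]].
- exists 1, 0%N; split=> // eta; rewrite /vacuum /growth mul1r.
  by case: ifP => _; rewrite ?ComplexField.Normc.normc0// ComplexField.Normc.normc1 expr0.
- have [_ [M HM] _] := tphi.
  have M0 : 0 <= M by apply: le_trans (normc_ge0 (phi point)) (HM _).
  exists (M * K), (1 + m)%N; split=> [|eta]; first exact: mulr_ge0.
  rewrite -growthD mulrACA ComplexField.Normc.normcM.
  have [fin|bad] := boolP (eta S < +oo)%E; last first.
    have := HK eta; rewrite /growth (negbTE bad) !mulr0 => H.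
    by rewrite (_ : normc (F eta) = 0) ?mulr0//; apply/eqP; rewrite eq_le H normc_ge0.
  apply: ler_pM; rewrite ?normc_ge0//.
  by rewrite /growth fin expr1; exact: normc_cintegral_config.
- exists (normc a * K + L), (m + n)%N; split=> [|eta].
    by rewrite addr_ge0// mulr_ge0// normc_ge0.
  rewrite -[(_ + _) eta]/(a * F eta + G eta); apply: le_trans (le_normcD _ _) _.
  rewrite mulrDl ComplexField.Normc.normcM lerD//.
    rewrite -mulrA ler_wpM2l ?normc_ge0//; apply: le_trans (HK eta) _.
    by rewrite ler_wpM2l// growth_mono// leq_addr.
  by apply: le_trans (HL eta) _; rewrite ler_wpM2l// growth_mono// leq_addl.
Qed.

Variables (p : R) (rho : probability (config X R) R).
Hypotheses (p01 : 0 < p < 1) (hrho : pascal_process p alpha rho).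

Lemma measurable_growth m : measurable_fun setT (growth m).
Proof.
rewrite (_ : growth m = (fun eta => (1 + (count S eta)%:R) ^+ m *
    \1_[set eta : config X R | (eta S < +oo)%E] eta)).
  apply: measurable_funM.
    have := @measurable_of_count _ X R S mS _ (measurableTypeR R)
      (fun n => (1 + n%:R) ^+ m : R).
    exact.
  by apply: measurable_indic; exact: measurable_count_fin.
apply/funext => eta; rewrite /growth indicE; case: ifPn => h.
  by rewrite mem_set// mulr1.
by rewrite memNset ?mulr0//; exact/negP.
Qed.

Lemma growth_integrable m : rho.-integrable setT (EFin \o growth m).
Proof.
have := count_moment_integrable p01 hrho mS alphaS m; apply: le_integrable => //.
  by apply/measurable_EFinP; exact: measurable_growth.
move=> eta _ /=; rewrite lee_fin ger0_norm ?growth_ge0// ger0_norm ?exprn_ge0 ?addr_ge0//.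
by rewrite /growth; case: ifP => // _; rewrite exprn_ge0// addr_ge0.
Qed.

Lemma pol_integrable F : pol F -> cintegrable rho F.
Proof.
move=> pF; have [K [m [K0 HK]]] := pol_growth pF.
apply: (cintegrable_dominated (pol_cmeasurable pF) _ HK).
by apply: integrable_scale; exact: growth_integrable.
Qed.

Definition expect F : R[i] := cintegral rho F.

Lemma expect_lin a F G : pol F -> pol G ->
  expect (a *: F + G) = a * expect F + expect G.
Proof. by move=> pF pG; rewrite -[RHS]cintegral_lin//; exact: pol_integrable. Qed.

(** Convergence of test functions, and of functions of configurations, that
    allows passing to the limit in expectations. *)
Definition test_cvg (phis : nat -> X -> R[i]) phi : Prop :=
  [/\ forall k, test (phis k), test phi,
      exists M, forall k x, normc (phis k x) <= M &
      forall x, ccvg (phis ^~ x) (phi x)].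

Definition pol_cvg (Fs : nat -> config X R -> R[i]) F : Prop :=
  [/\ forall k, pol (Fs k), pol F,
      exists K m, forall k eta, normc (Fs k eta) <= K * growth m eta &
      forall eta, ccvg (Fs ^~ eta) (F eta)].

Lemma test_cvg_cintegral (mu : {measure set X -> \bar R}) phis phi :
  (mu S < +oo)%E -> test_cvg phis phi ->
  ccvg (fun k => cintegral mu (phis k)) (cintegral mu phi).
Proof.
move=> muS [t_ t [M HM] cv].
apply: (@cintegral_dominated_cvg _ _ _ _ _ _ (fun x => M * \1_S x)) => //.
- by move=> k; case: (t_ k).
- by case: t.
- move=> k x; rewrite indicE; case: (pselect (S x)) => Sx.
    by rewrite mem_set// mulr1.
  by have [_ _ ->//] := t_ k; rewrite memNset// mulr0 ComplexField.Normc.normc0.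
- by apply: integrable_scale; exact: integrable_finite_indic.
Qed.

Lemma pol_cvg_expect Fs F : pol_cvg Fs F -> ccvg (fun k => expect (Fs k)) (expect F).
Proof.
move=> [p_ pF [K [m HK]] cv].
apply: (@cintegral_dominated_cvg _ _ _ _ _ _ (fun eta => K * growth m eta)) => //.
- by move=> k; exact: pol_cmeasurable.
- exact: pol_cmeasurable.
- by apply: integrable_scale; exact: growth_integrable.
Qed.

Lemma test_cvgM phis phi psis psi : test_cvg phis phi -> test_cvg psis psi ->
  test_cvg (fun k x => phis k x * psis k x) (fun x => phi x * psi x).
Proof.
move=> [t_ t [M HM] cv] [u_ u [N HN] dv]; split.
- by move=> k; exact: test_onMt.
- exact: test_onMt.
- exists (M * N) => k x; rewrite ComplexField.Normc.normcM.
  by apply: ler_pM => //; exact: normc_ge0.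
- by move=> x; exact: ccvgM.
Qed.

Lemma pol_cvg_vacuum : pol_cvg (fun=> vacuum) vacuum.
Proof.
split; try by move=> *; exact: pol_vacuum.
- have [K [m [_ HK]]] := pol_growth (@pol_vacuum _ X R S).
  by exists K, m.
- by move=> eta; exact: ccvg_cst.
Qed.

Lemma pol_cvg_number phis phi Fs F : test_cvg phis phi -> pol_cvg Fs F ->
  pol_cvg (fun k => number (phis k) (Fs k)) (number phi F).
Proof.
move=> cphi [p_ pF [K [m HK]] cv]; have [t_ t [M HM] _] := cphi.
have M0 : 0 <= M by apply: le_trans (normc_ge0 (phis 0%N point)) (HM _ _).
split.
- by move=> k; exact: pol_number.
- exact: pol_number.
- exists (M * K), (1 + m)%N => k eta.
  rewrite -growthD mulrACA ComplexField.Normc.normcM.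
  have [fin|bad] := boolP (eta S < +oo)%E; last first.
    by rewrite (pol_bad (p_ k) bad) ComplexField.Normc.normc0 mulr0 /growth (negbTE bad) !mulr0.
  apply: ler_pM; rewrite ?normc_ge0//.
  by rewrite /growth fin expr1; exact: normc_cintegral_config.
- move=> eta; have [fin|bad] := boolP (eta S < +oo)%E.
    by apply: ccvgM => //; exact: test_cvg_cintegral.
  rewrite /number (pol_bad pF bad) mulr0.
  rewrite (_ : (fun k => _) = (fun=> 0)); first exact: ccvg_cst.
  by apply/funext => k; rewrite (pol_bad (p_ k) bad) mulr0.
Qed.

Lemma pol_cvgD Fs F Gs G : pol_cvg Fs F -> pol_cvg Gs G ->
  pol_cvg (fun k => Fs k + Gs k) (F + G).
Proof.
move=> [p_ pF [K [m HK]] cv] [q_ pG [L [n HL]] dv]; split.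
- by move=> k; exact: polD.
- exact: polD.
- exists (`|K| + `|L|), (m + n)%N => k eta.
  rewrite -[(_ + _) eta]/(Fs k eta + Gs k eta); apply: le_trans (le_normcD _ _) _.
  rewrite mulrDl lerD//.
    apply: le_trans (HK k eta) _; apply: (@le_trans _ _ (`|K| * growth m eta)).
      by rewrite ler_wpM2r ?growth_ge0// ler_norm.
    by rewrite ler_wpM2l// growth_mono// leq_addr.
  apply: le_trans (HL k eta) _; apply: (@le_trans _ _ (`|L| * growth n eta)).
    by rewrite ler_wpM2r ?growth_ge0// ler_norm.
  by rewrite ler_wpM2l// growth_mono// leq_addl.
- by move=> eta; exact: ccvgD.
Qed.

Lemma pol_cvgZ a_ a F : ccvg a_ a -> pol F -> pol_cvg (fun k => a_ k *: F) (a *: F).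
Proof.
move=> ca pF; split.
- by move=> k; exact: polZ.
- exact: polZ.
- have [K [m [K0 HK]]] := pol_growth pF.
  have [c1 c2] := ca.
  have [M1 [_ H1]] := cvg_seq_bounded (cvgP _ c1).
  have [M2 [_ H2]] := cvg_seq_bounded (cvgP _ c2).
  exists ((M1 + 1 + (M2 + 1)) * K), m => k eta.
  rewrite -[(_ *: _) eta]/(a_ k * F eta) ComplexField.Normc.normcM -mulrA.
  apply: ler_pM; rewrite ?normc_ge0//.
  apply: le_trans (normc_le _) _; apply: lerD.
    by apply: H1 => //; rewrite ltrDl.
  by apply: H2 => //; rewrite ltrDl.
- by move=> eta; apply: ccvgM => //; exact: ccvg_cst.
Qed.

Definition monomial (s : seq (X -> R[i])) : config X R -> R[i] := foldr (@number _ X R) vacuum s.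

Lemma pol_monomial s : {in s, forall phi, test phi} -> pol (monomial s).
Proof.
elim: s => [|phi s ih] ts; first exact: pol_vacuum.
apply: pol_number; first by apply: ts; rewrite mem_head.
by apply: ih => psi ps; apply: ts; rewrite inE ps orbT.
Qed.

End polynomial_moments.

(** * Mecke's equation for polynomials *)

Section cells.
Context d (X : measurableType d) (R : realType).
Hypothesis msing : forall x : X, measurable [set x].
Variables (alpha : {measure set X -> \bar R}) (S : set X).
Hypotheses (mS : measurable S) (alphaS : (alpha S < +oo)%E).
Variables (p : R) (rho : probability (config X R) R).
Hypotheses (p01 : 0 < p < 1) (hrho : pascal_process p alpha rho).

Implicit Types (eta : config X R) (phi theta psi : X -> R[i]).
Implicit Types (F G : config X R -> R[i]).

Local Notation test := (test_on S).
Local Notation vacuum := (@vacuum _ X R S).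
Local Notation raise := (raise alpha S).
Local Notation pol := (pol S).
Local Notation monomial := (monomial S).

Definition mecke phi F : Prop :=
  expect rho (number phi F) = p%:C * expect rho (raise phi F).

Lemma mecke_pol_lin phi a F G : test phi -> pol F -> pol G ->
  mecke phi F -> mecke phi G -> mecke phi (a *: F + G).
Proof.
move=> tphi pF pG mF mG; rewrite /mecke.
rewrite (number_lin phi a pF pG) (raise_lin mS alphaS tphi a pF pG).
rewrite (expect_lin mS alphaS p01 hrho a (pol_number tphi pF) (pol_number tphi pG)).
rewrite (expect_lin mS alphaS p01 hrho a (pol_raise mS alphaS tphi pF)
  (pol_raise mS alphaS tphi pG)).
by rewrite mF mG mulrDr mulrCA.
Qed.

Lemma mecke_test_lin a phi theta F : test phi -> test theta -> pol F ->
  mecke phi F -> mecke theta F -> mecke (a *: phi + theta) F.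
Proof.
move=> tphi ttheta pF mF mG; rewrite /mecke.
rewrite (number_test_lin mS a tphi ttheta pF) (raise_test_lin mS alphaS a tphi ttheta pF).
rewrite (expect_lin mS alphaS p01 hrho a (pol_number tphi pF) (pol_number ttheta pF)).
rewrite (expect_lin mS alphaS p01 hrho a (pol_raise mS alphaS tphi pF)
  (pol_raise mS alphaS ttheta pF)).
by rewrite mF mG mulrDr mulrCA.
Qed.

Lemma expect_good (f g : config X R -> R[i]) : cmeasurable f -> cmeasurable g ->
  (forall eta, (eta S < +oo)%E -> f eta = g eta) -> expect rho f = expect rho g.
Proof.
move=> [f1 f2] [g1 g2] fg.
have H (h k : config X R -> R) : measurable_fun setT h -> measurable_fun setT k ->
    (forall eta, (eta S < +oo)%E -> h eta = k eta) -> \int[rho]_x h x = \int[rho]_x k x.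
  move=> mh mk hk; rewrite /Rintegral; congr fine; apply: ae_eq_integral => //.
  - exact/measurable_EFinP.
  - exact/measurable_EFinP.
  - by apply: filterS (pascal_fin_ae p01 hrho mS alphaS) => eta fin _; rewrite hk.
by apply: complex_eqP; apply: H => // eta fin; rewrite fg.
Qed.

Variables (T : finType) (C : T -> set X).
Hypotheses (mC : forall t, measurable (C t)) (tC : trivIset [set: T] C).
Hypothesis CS : forall t, C t `<=` S.

Let fC t : (alpha (C t) < +oo)%E.
Proof. by apply: le_lt_trans alphaS; rewrite le_measure ?inE//; exact: CS. Qed.

Let finC eta t : (eta S < +oo)%E -> (eta (C t) < +oo)%E.
Proof. by apply: le_lt_trans; rewrite le_measure ?inE//; exact: CS. Qed.

Definition cell t : X -> R[i] := fun x => (\1_(C t) x)%:C.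

Definition cellular (g : T -> R[i]) : X -> R[i] := fun x => \sum_t g t * cell t x.

Lemma test_cell t : test (cell t).
Proof.
split; first by split; [exact: measurable_indic|exact: measurable_cst].
  exists 1 => x; rewrite /cell normc_real ger0_norm// indicE; by case: (_ \in _).
by move=> x Sx; rewrite /cell indicE memNset// => /CS.
Qed.

Lemma test_sum (I : Type) (s : seq I) (f : I -> X -> R[i]) :
  (forall i, test (f i)) -> test (fun x => \sum_(i <- s) f i x).
Proof.
move=> tf; elim: s => [|i s ih].
  by under [X in test X]eq_fun do rewrite big_nil; exact: test_on0.
by under [X in test X]eq_fun do rewrite big_cons; exact: test_onD.
Qed.

Lemma test_cellular g : test (cellular g).
Proof. by apply: test_sum => t; apply: test_onZ; exact: test_cell. Qed.

Lemma cintegral_cell (mu : {measure set X -> \bar R}) t :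
  cintegral mu (cell t) = (fine (mu (C t)))%:C.
Proof.
apply: complex_eqP => /=; last by rewrite Rintegral_cst// mul0r.
by rewrite /Rintegral integral_indic// setIT.
Qed.

Lemma cintegral_cellular (mu : {measure set X -> \bar R}) g : (mu S < +oo)%E ->
  cintegral mu (cellular g) = \sum_t g t * (fine (mu (C t)))%:C.
Proof.
move=> muS; rewrite /cellular; elim: (index_enum T) => [|t s ih].
  under eq_cintegral do rewrite big_nil.
  by rewrite big_nil cintegral0.
under eq_cintegral do rewrite big_cons.
rewrite big_cons cintegral_lin ?ih ?cintegral_cell//.
  exact: (test_integrable mS muS (test_cell t)).
apply: (test_integrable mS muS); apply: test_sum => u.
by apply: test_onZ; exact: test_cell.
Qed.

Lemma fine_count eta t : (eta S < +oo)%E -> fine (eta (C t)) = (count (C t) eta)%:R.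
Proof. by move=> /(finC t)/count_finE ->. Qed.

Definition cell_poly (gs : seq (T -> R[i])) (n : {ffun T -> nat}) : R[i] :=
  \prod_(g <- gs) \sum_t g t * (n t)%:R%:C.

Lemma monomial_cellular gs eta : (eta S < +oo)%E ->
  monomial (map cellular gs) eta = cell_poly gs (counts C eta).
Proof.
move=> fin; elim: gs => [|g gs ih]; first by rewrite /cell_poly big_nil /= /vacuum fin.
rewrite /= /number ih /cell_poly big_cons cintegral_cellular//; congr (_ * _).
by apply: eq_bigr => t _; rewrite fine_count// ffunE.
Qed.

Lemma counts_add eta x t : (eta S < +oo)%E -> C t x ->
  counts C (config_add eta x) = incr t (counts C eta).
Proof.
move=> fin Ctx; apply/ffunP => s; rewrite !ffunE {1}/count config_addE.
rewrite (count_finE (finC s fin)) diracE.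
have -> : (x \in C s) = (s == t).
  apply/idP/eqP => [|->]; last by rewrite mem_set.
  by rewrite inE => Csx; apply: (tC Logic.I Logic.I); exists x.
by rewrite -EFinD /= -natrD natrK.
Qed.

(** The integrand is constant on the cell, where adding a point increments one
    count. *)
Lemma raise_cellE t F (Q : {ffun T -> nat} -> R[i]) eta :
  (forall eta, (eta S < +oo)%E -> F eta = Q (counts C eta)) -> (eta S < +oo)%E ->
  raise (cell t) F eta =
  ((count (C t) eta)%:R + fine (alpha (C t)))%:C * Q (incr t (counts C eta)).
Proof.
move=> FQ fin; rewrite /raise fin.
rewrite (_ : (fun x => _) = fun x => Q (incr t (counts C eta)) * cell t x); last first.
  apply/funext => x; have [Ctx|Ctx] := pselect (C t x).
    by rewrite FQ ?config_add_fin// (counts_add fin Ctx) mulrC.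
  by rewrite /cell indicE memNset// mulr0 mul0r.
rewrite !cintegralZ; [|exact: (test_integrable mS _ (test_cell t))..].
by rewrite !cintegral_cell fine_count// rmorphD mulrDl ![Q _ * _]mulrC.
Qed.

Lemma cmeasurable_counts (Q : {ffun T -> nat} -> R[i]) :
  cmeasurable (fun eta => Q (counts C eta)).
Proof.
have H (g : {ffun T -> nat} -> R) :
    measurable_fun [set: config X R] (fun eta => g (counts C eta) : measurableTypeR R).
  by apply: measurable_discrete => n; exact: measurable_counts_fiber.
by split; [exact: (H (fun n => Re (Q n)))|exact: (H (fun n => Im (Q n)))].
Qed.

(** Both sides are expectations of functions of the counts, to which the discrete
    equation applies, separately for real and imaginary parts. *)
Lemma mecke_cell t gs : mecke (cell t) (monomial (map cellular gs)).
Proof.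
have pM : pol (monomial (map cellular gs)).
  by apply: pol_monomial => phi /mapP[g _ ->]; exact: test_cellular.
have tc := test_cell t.
have pR : pol (raise (cell t) (monomial (map cellular gs))) by exact: pol_raise.
pose Q := cell_poly gs; pose a := fine (alpha (C t)).
pose G1 (n : {ffun T -> nat}) := (n t)%:R%:C * Q n; pose G2 (n : {ffun T -> nat}) := (p * ((n t)%:R + a))%:C * Q (incr t n).
rewrite /mecke; have -> : expect rho (number (cell t) (monomial (map cellular gs))) =
    expect rho (fun eta => G1 (counts C eta)).
  apply: expect_good.
  - by apply: (pol_cmeasurable mS); exact: pol_number.
  - exact: cmeasurable_counts.
  - move=> eta fin; rewrite /number monomial_cellular// cintegral_cell fine_count//.
    by rewrite /G1 ffunE.
have -> : p%:C * expect rho (raise (cell t) (monomial (map cellular gs))) =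
    expect rho (fun eta => G2 (counts C eta)).
  rewrite /expect -cintegralZ; last exact: (pol_integrable mS alphaS p01 hrho).
  apply: expect_good.
  - apply: cmeasurableM; first exact: cmeasurable_cst.
    exact: (pol_cmeasurable mS).
  - exact: cmeasurable_counts.
  - move=> eta fin; have FQ (zeta : config X R) : (zeta S < +oo)%E ->
        monomial (map cellular gs) zeta = Q (counts C zeta) by exact: monomial_cellular.
    rewrite (raise_cellE t FQ fin).
    by rewrite /G2 ffunE mulrA rmorphM.
have H (q : {ffun T -> nat} -> R) := mecke_counts p01 hrho mC tC fC t q.
have ReZ (x : R) z : Re (x%:C * z) = x * Re z by rewrite ReM /= mul0r subr0.
have ImZ (x : R) z : Im (x%:C * z) = x * Im z by rewrite ImM /= mul0r addr0.
apply: complex_eqP => /=.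
  under eq_Rintegral do rewrite /G1 ReZ; under [RHS]eq_Rintegral do rewrite /G2 ReZ.
  exact: (H (fun n => Re (Q n))).
under eq_Rintegral do rewrite /G1 ImZ; under [RHS]eq_Rintegral do rewrite /G2 ImZ.
exact: (H (fun n => Im (Q n))).
Qed.

Lemma mecke_cellular g gs : mecke (cellular g) (monomial (map cellular gs)).
Proof.
have pM : pol (monomial (map cellular gs)).
  by apply: pol_monomial => phi /mapP[h _ ->]; exact: test_cellular.
rewrite [X in mecke X]/cellular; elim: (index_enum T) => [|t s ih].
  rewrite (_ : (fun x => _) = (fun=> 0)); last by apply/funext => x; rewrite big_nil.
  have Z (F : config X R -> R[i]) : number (fun=> 0) F = 0 * 1 *: F /\
      raise (fun=> 0) F = 0 * 1 *: F.
    rewrite mul0r scale0r; split; apply/funext => eta.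
      by rewrite /number cintegral0 mul0r.
    rewrite /raise; case: ifP => // _.
    have E0 (mu : {measure set X -> \bar R}) :
        cintegral mu (fun x => 0 * F (config_add eta x)) = 0.
      by under eq_cintegral do rewrite mul0r; exact: cintegral0.
    by rewrite !E0 addr0.
  have [Z1 Z2] := Z (monomial (map cellular gs)).
  rewrite /mecke [X in expect rho X = _]Z1 [X in _ = _ * expect rho X]Z2.
  by rewrite mul0r scale0r /expect cintegral0 mulr0.
have ts : test (fun x => \sum_(u <- s) g u * cell u x).
  by apply: test_sum => u; apply: test_onZ; exact: test_cell.
have E : (fun x => \sum_(u <- t :: s) g u * cell u x) =
    g t *: cell t + (fun x => \sum_(u <- s) g u * cell u x).
  by apply/funext => x; rewrite big_cons.
rewrite E; exact: (mecke_test_lin (g t) (test_cell t) ts pM (mecke_cell t gs) ih).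
Qed.

End cells.

Section finite_valued.
Context d (X : measurableType d) (R : realType).
Hypothesis msing : forall x : X, measurable [set x].
Variables (alpha : {measure set X -> \bar R}) (S : set X).
Hypotheses (mS : measurable S) (alphaS : (alpha S < +oo)%E).
Variables (p : R) (rho : probability (config X R) R).
Hypotheses (p01 : 0 < p < 1) (hrho : pascal_process p alpha rho).

Implicit Types (phi psi : X -> R[i]).

Local Notation test := (test_on S).
Local Notation monomial := (monomial S).
Local Notation mecke := (mecke alpha S p rho).

(** Finitely many test functions with finitely many values are constant on the
    cells of a common finite partition. *)
Lemma mecke_finite_valued (V : seq R[i]) phi s :
  {in phi :: s, forall psi, test psi /\ forall x, psi x \in V} ->
  mecke phi (monomial s).
Proof.
move=> H; pose L := phi :: s.
pose T : finType := {ffun 'I_(size L) -> seq_sub V}.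
(* A cell is the set of points of [S] where the test functions take prescribed
   values. *)
pose C (t : T) : set X := S `&` [set x | forall i : 'I_(size L), nth phi L i x = ssval (t i)].
have LP (i : 'I_(size L)) : test (nth phi L i) /\ forall x, nth phi L i x \in V.
  by apply: H; exact: mem_nth.
have mC t : measurable (C t).
  apply: measurableI => //; rewrite (_ : [set x | _] =
      \big[setI/setT]_(i < size L) [set x | nth phi L i x = ssval (t i)]).
    apply: bigsetI_measurable => i _; have [[[m1 m2] _ _] _] := LP i.
    rewrite (_ : [set x | _] =
      [set x | Re (nth phi L i x) = Re (ssval (t i))] `&`
      [set x | Im (nth phi L i x) = Im (ssval (t i))]).
      apply: measurableI.
        by have := m1 measurableT _ (measurable_set1 (Re (ssval (t i)))); rewrite setTI.
      by have := m2 measurableT _ (measurable_set1 (Im (ssval (t i)))); rewrite setTI.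
    by apply/seteqP; split=> x /= => [->//|[e1 e2]]; exact: complex_eqP.
  apply/seteqP; split=> x /= Hx.
    by elim/big_ind: _ => [//|A B HA HB|i _]; [split|exact: Hx].
  by move=> i; move: Hx; rewrite (bigD1 i)//= => -[].
have tC : trivIset [set: T] C.
  move=> t u _ _ [x [[_ /= tx] [_ /= ux]]]; apply/ffunP => i; apply: val_inj.
  by rewrite /= -tx -ux.
have CS t : C t `<=` S by move=> x [].
pose key x : T := [ffun i => SeqSub (proj2 (LP i) x)].
have cellE (i : 'I_(size L)) : nth phi L i = cellular C (fun t => ssval (t i)) :> (X -> R[i]).
  apply/funext => x; rewrite /cellular /cell; have [Sx|Sx] := pselect (S x).
    rewrite (bigD1 (key x))//= big1 ?addr0; last first.
      move=> t tx; rewrite indicE memNset ?mulr0// => -[_ /= xt].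
      move: tx => /eqP; apply; apply/ffunP => j; apply: val_inj; by rewrite /= ffunE /= xt.
    rewrite indicE mem_set ?mulr1 ?ffunE//; split=> //= j.
    by rewrite ffunE.
  have [[_ _ ->//] _] := LP i.
  by rewrite big1// => t _; rewrite indicE memNset ?mulr0// => -[].
pose gs := [seq (fun t : T => ssval (t i)) | i <- behead (enum 'I_(size L))].
have sE : s = map (cellular C) gs.
  apply: (@eq_from_nth _ phi).
    by rewrite !size_map size_behead size_enum_ord.
  move=> i si.
  have iL : (i.+1 < size L)%N by [].
  rewrite -map_comp (nth_map (Ordinal iL)); last by rewrite size_behead size_enum_ord.
  rewrite nth_behead /= -cellE.
  by rewrite nth_enum_ord.
have phiE : phi = cellular C (fun t => ssval (t ord0)) by rewrite -cellE.
rewrite sE phiE; exact: mecke_cellular.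
Qed.

End finite_valued.

Section floor_approximation.
Context d (X : measurableType d) (R : realType) (S : set X).

Implicit Types (phi psi : X -> R[i]).

Local Notation test := (test_on S).

(** Rounding down to multiples of [1 / (k + 1)] is bounded, converges everywhere,
    keeps the value 0 off the support, and leaves finitely many values. *)
Definition approx (k : nat) phi : X -> R[i] := fun x =>
  ((Num.floor (k.+1%:R * Re (phi x)))%:~R / k.+1%:R) +i*
  ((Num.floor (k.+1%:R * Im (phi x)))%:~R / k.+1%:R).

Lemma floor_approx (k : nat) (z : R) :
  z - k.+1%:R^-1 <= (Num.floor (k.+1%:R * z))%:~R / k.+1%:R <= z.
Proof.
have k0 : 0 < k.+1%:R :> R by [].
have /andP[f1 f2] := floor_itv (k.+1%:R * z).
rewrite ler_pdivlMr// ler_pdivrMr// mulrBl mulVf ?gt_eqF// [z * _]mulrC f1 andbT.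
by rewrite lerBlDr ltW// -[1]/(1%:~R) -intrD.
Qed.

Lemma floor_approx_cvg (z : R) :
  (fun k => (Num.floor (k.+1%:R * z))%:~R / k.+1%:R) @ \oo --> z.
Proof.
apply: (@squeeze_cvgr _ _ _ _ (fun k => z - k.+1%:R^-1) (cst z)).
- by apply: nearW => k; exact: floor_approx.
- rewrite -[X in _ --> X]subr0; apply: cvgB; first exact: cvg_cst.
  exact: cvg_harmonic.
- exact: cvg_cst.
Qed.

Lemma floor_approx_norm (k : nat) (z M : R) : `|z| <= M ->
  `|(Num.floor (k.+1%:R * z))%:~R / k.+1%:R| <= M + 1.
Proof.
rewrite ler_norml => /andP[z1 z2]; have /andP[f1 f2] := floor_approx k z.
have k1 : k.+1%:R^-1 <= 1 :> R by rewrite invf_le1// ler1n.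
rewrite ler_norml; apply/andP; split.
  by rewrite opprD (le_trans _ f1)// lerB.
by rewrite (le_trans f2)// (le_trans z2)// lerDl.
Qed.

Lemma measurable_floor_approx (k : nat) (f : X -> R) : measurable_fun setT f ->
  measurable_fun setT (fun x => (Num.floor (k.+1%:R * f x))%:~R / k.+1%:R : R).
Proof.
move=> mf.
have mg : measurable_fun [set: R]
    (fun z : R => (Num.floor (k.+1%:R * z))%:~R / k.+1%:R : R).
  apply: nondecreasing_measurable => // x y xy.
  by rewrite ler_pM2r ?invr_gt0// ler_int le_floor// ler_pM2l.
exact: (measurableT_comp mg mf).
Qed.

Lemma test_approx_cvg phi : test phi -> test_cvg S (fun k => approx k phi) phi.
Proof.
move=> tphi; have [[m1 m2] [M HM] phi0] := tphi.
have R1 x : `|Re (phi x)| <= M by apply: le_trans (normr_Re_le _) _.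
have I1 x : `|Im (phi x)| <= M by apply: le_trans (normr_Im_le _) _.
have B k x : normc (approx k phi x) <= (M + 1) + (M + 1).
  by apply: le_trans (normc_le _) _; apply: lerD; exact: floor_approx_norm.
split=> //.
- move=> k; split.
  + by split; exact: measurable_floor_approx.
  + by exists ((M + 1) + (M + 1)).
  + by move=> x Sx; rewrite /approx phi0//= mulr0 floor0 mul0r.
- by exists ((M + 1) + (M + 1)).
- by move=> x; split; exact: floor_approx_cvg.
Qed.

Lemma approx_finite (k : nat) phi : test phi ->
  exists V : seq R[i], forall x, approx k phi x \in V.
Proof.
move=> [_ [M HM] _].
pose N := (Num.truncn (k.+1%:R * (M + 1))).+1.
pose zr := [seq (i%:Z - N%:Z) | i <- iota 0 (2 * N).+1].
have zrP (z : R) : `|z| <= M -> Num.floor (k.+1%:R * z) \in zr.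
  move=> zM; have k0 : 0 < k.+1%:R :> R by [].
  have := floor_approx_norm k zM; rewrite normrM normfV [`|k.+1%:R|]gtr0_norm//.
  rewrite ler_pdivrMr// [leRHS]mulrC => fM.
  have fN : `|(Num.floor (k.+1%:R * z))%:~R : R| <= N%:R.
    by apply: le_trans fM _; rewrite ltW// truncnS_gt.
  move: fN; rewrite -intr_norm -[N%:R]/(N%:Z%:~R) ler_int.
  move: (Num.floor _) => m mN; apply/mapP; exists (absz (m + N%:Z)).
    rewrite mem_iota; lia.
  lia.
pose V := [seq (a%:~R / k.+1%:R : R) +i* (b%:~R / k.+1%:R) | a <- zr, b <- zr].
exists V => x; apply/allpairsP.
exists (Num.floor (k.+1%:R * Re (phi x)), Num.floor (k.+1%:R * Im (phi x))).
split=> //=.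
  by apply: zrP; exact: le_trans (normr_Re_le (phi x)) (HM x).
by apply: zrP; exact: le_trans (normr_Im_le (phi x)) (HM x).
Qed.

End floor_approximation.

Section mecke_polynomials.
Context d (X : measurableType d) (R : realType).
Hypothesis msing : forall x : X, measurable [set x].
Variables (alpha : {measure set X -> \bar R}) (S : set X).
Hypotheses (mS : measurable S) (alphaS : (alpha S < +oo)%E).
Variables (p : R) (rho : probability (config X R) R).
Hypotheses (p01 : 0 < p < 1) (hrho : pascal_process p alpha rho).

Implicit Types (phi psi : X -> R[i]) (F G : config X R -> R[i]).

Local Notation test := (test_on S).
Local Notation pol := (pol S).
Local Notation vacuum := (@vacuum _ X R S).
Local Notation monomial := (monomial S).
Local Notation mecke := (mecke alpha S p rho).
Local Notation raise := (raise alpha S).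
Local Notation lower := (lower S).

Let approx_monomial (s : seq (X -> R[i])) k := monomial (map (approx k) s).

Let pol_approx s k : {in s, forall phi, test phi} -> pol (approx_monomial s k).
Proof.
move=> ts; apply: pol_monomial => phi /mapP[psi /ts tpsi ->].
by have [t _ _ _] := test_approx_cvg tpsi.
Qed.

Let approx_monomial_cvg s : {in s, forall phi, test phi} ->
  pol_cvg S (approx_monomial s) (monomial s).
Proof.
elim: s => [|psi s ih] ts; first exact: pol_cvg_vacuum.
have tpsi : test psi by apply: ts; rewrite mem_head.
have {}ih : pol_cvg S (approx_monomial s) (monomial s).
  by apply: ih => phi ps; apply: ts; rewrite inE ps orbT.
exact: (pol_cvg_number mS (test_approx_cvg tpsi) ih).
Qed.

Let raise_approx_cvg s phis phi : {in s, forall phi, test phi} -> test_cvg S phis phi ->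
  pol_cvg S (fun k => raise (phis k) (approx_monomial s k)) (raise phi (monomial s)).
Proof.
elim: s phis phi => [|psi s ih] phis phi ts cphi.
  have [tphis tphi _ _] := cphi.
  rewrite (_ : (fun k => _) =
    (fun k => number (phis k) vacuum + cintegral alpha (phis k) *: vacuum)); last first.
    by apply/funext => k; exact: (raise_vacuum alpha (tphis k)).
  rewrite [X in pol_cvg _ _ X](raise_vacuum alpha tphi).
  apply: pol_cvgD; first exact: (pol_cvg_number mS cphi (pol_cvg_vacuum R mS)).
  apply: (pol_cvgZ mS); last exact: pol_vacuum.
  exact: (test_cvg_cintegral mS alphaS cphi).
have [tphis tphi _ _] := cphi.
have tpsi : test psi by apply: ts; rewrite mem_head.
have ts' : {in s, forall phi, test phi}.
  by move=> theta ps; apply: ts; rewrite inE ps orbT.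
have cpsi := test_approx_cvg tpsi; have [tpsis _ _ _] := cpsi.
rewrite (_ : (fun k => _) = (fun k =>
   number (approx k psi) (raise (phis k) (approx_monomial s k)) +
   raise (fun x => phis k x * approx k psi x) (approx_monomial s k))); last first.
  by apply/funext => k; apply: raise_number => //; exact: pol_approx.
rewrite [X in pol_cvg _ _ X](raise_number mS alphaS tphi tpsi (pol_monomial ts')).
apply: pol_cvgD; first exact: (pol_cvg_number mS cpsi (ih _ _ ts' cphi)).
by apply: ih => //; exact: test_cvgM.
Qed.

(** Both sides are continuous under bounded pointwise convergence of the test
    functions, and rounded test functions have finitely many values. *)
Lemma mecke_monomial phi s : test phi -> {in s, forall phi, test phi} ->
  mecke phi (monomial s).
Proof.
move=> tphi ts; have cphi := test_approx_cvg tphi.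
have [tphis _ _ _] := cphi.
have c1 := pol_cvg_expect mS alphaS p01 hrho (pol_cvg_number mS cphi (approx_monomial_cvg ts)).
have c2 := pol_cvg_expect mS alphaS p01 hrho (raise_approx_cvg ts cphi).
apply: (ccvg_unique c1).
have -> : (fun k => expect rho (number (approx k phi) (approx_monomial s k))) =
    (fun k => p%:C * expect rho (raise (approx k phi) (approx_monomial s k))).
  apply/funext => k.
  have [V HV] : exists V : seq R[i], {in phi :: s, forall psi x, approx k psi x \in V}.
    have : {in phi :: s, forall psi, test psi}.
      by move=> psi; rewrite inE => /orP[/eqP ->//|/ts].
    elim: (phi :: s) => [|psi u ih] tu; first by exists [::].
    have [V HV] : exists V : seq R[i], {in u, forall psi x, approx k psi x \in V}.
      by apply: ih => theta tu'; apply: tu; rewrite inE tu' orbT.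
    have [W HW] := approx_finite k (tu psi (mem_head _ _)).
    exists (W ++ V) => theta; rewrite inE => /orP[/eqP -> x|/HV H x].
      by rewrite mem_cat HW.
    by rewrite mem_cat H orbT.
  apply: (mecke_finite_valued mS alphaS p01 hrho (V := V)) => psi.
  rewrite inE => /orP[/eqP ->|/mapP[theta ths ->]]; split=> //.
  - by apply: HV; rewrite mem_head.
  - by have [t _ _ _] := test_approx_cvg (ts _ ths).
  - by apply: HV; rewrite inE ths orbT.
by apply: ccvgM => //; exact: ccvg_cst.
Qed.

Lemma mecke_pol phi F : test phi -> pol F -> mecke phi F.
Proof.
move=> tphi pF.
suff H s : {in s, forall psi, test psi} -> pol (foldr (@number _ X R) F s) /\
    mecke phi (foldr (@number _ X R) F s) by have [] := H [::].
elim: pF s => {F} [|psi F tpsi pF ih|a F G pF ihF pG ihG] s ts.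
- by split; [exact: pol_monomial|exact: mecke_monomial].
- rewrite -foldr_rcons; apply: ih => theta; rewrite mem_rcons inE.
  by move=> /orP[/eqP ->//|/ts].
- have -> : foldr (@number _ X R) (a *: F + G) s =
      a *: foldr (@number _ X R) F s + foldr (@number _ X R) G s.
    elim: s ts => [//|theta s ih] ts /=.
    have ts' : {in s, forall psi, test psi}.
      by move=> psi ps; apply: ts; rewrite inE ps orbT.
    rewrite ih//; have [pF' _] := ihF s ts'; have [pG' _] := ihG s ts'.
    exact: (number_lin theta a pF' pG').
  have [pF' mF'] := ihF s ts; have [pG' mG'] := ihG s ts.
  by split; [exact: pol_lin|exact: mecke_pol_lin].
Qed.

Definition pairing F G : R[i] := expect rho (fun eta => F eta * G eta).

Lemma pairingC F G : pairing F G = pairing G F.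
Proof. by rewrite /pairing; congr expect; apply/funext => eta; rewrite mulrC. Qed.

Lemma pairing_lin a F G H : pol F -> pol G -> pol H ->
  pairing F (a *: G + H) = a * pairing F G + pairing F H.
Proof.
move=> pF pG pH; have pFG := pol_mul pF pG; have pFH := pol_mul pF pH.
rewrite -(expect_lin mS alphaS p01 hrho a pFG pFH); congr expect.
apply/funext => eta.
rewrite -[LHS]/(F eta * (a * G eta + H eta)) -[RHS]/(a * (F eta * G eta) + F eta * H eta).
by rewrite mulrDr mulrCA.
Qed.

Lemma pairing_lin_l a F G H : pol F -> pol G -> pol H ->
  pairing (a *: G + H) F = a * pairing G F + pairing H F.
Proof. by move=> pF pG pH; rewrite pairingC pairing_lin// ![pairing F _]pairingC. Qed.

Lemma pairing_number phi F G : pairing F (number phi G) = pairing (number phi F) G.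
Proof.
rewrite /pairing; congr expect; apply/funext => eta.
by rewrite /number mulrCA mulrA.
Qed.

(** Mecke's equation says that [lower] is the transpose of [raise] on the
    vacuum; the commutators with multiplications propagate this. *)
Lemma pairing_lower phi F G : test phi -> pol F -> pol G ->
  pairing F (lower phi G) = p%:C * pairing (raise phi F) G.
Proof.
move=> + + pG; elim: pG phi F => {G} [|psi G tpsi pG ih|a G H pG ihG pH ihH] phi F tphi pF.
- rewrite (lower_vacuum msing mS tphi) pairing_number.
  have E (f : config X R -> R[i]) : pol f -> pairing f vacuum = expect rho f.
    move=> pf; rewrite pairingC /pairing; congr expect; apply/funext => eta.
    exact: vacuum_pol.
  rewrite E; last exact: pol_number.
  rewrite E; last exact: pol_raise.
  exact: mecke_pol.
- have tpp := test_onMt tphi tpsi.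
  rewrite (lower_number msing mS G tphi tpsi) addrC -scaleN1r pairing_lin//;
    [|exact: pol_lower|apply: pol_number => //; exact: pol_lower].
  rewrite (pairing_number psi F) ih// ih//; last exact: pol_number.
  rewrite (raise_number mS alphaS tphi tpsi pF) (pairing_number psi (raise phi F)).
  rewrite -[number psi (raise phi F)]scale1r pairing_lin_l//;
    [|apply: pol_number => //; exact: pol_raise|exact: pol_raise].
  by rewrite mulN1r mul1r mulrDr addrC addrK scale1r.
- rewrite (lower_lin msing mS tphi a pG pH) !pairing_lin//; [|by [exact: pol_lower|exact: pol_raise]..].
  by rewrite ihG// ihH// mulrDr mulrCA.
Qed.

End mecke_polynomials.

(** * Dense subspaces of a Hilbert space *)

Section hilbert_density.
Context (R : realType) (H : lmodType R[i]) (dot : H -> H -> R[i]).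
Hypothesis hH : hilbert_space dot.
Implicit Types (f g h z : H) (t : R[i]).

Definition nrm2 f : R := Re (dot f f).

Lemma dotDr f g h : dot f (g + h) = dot f g + dot f h.
Proof. by rewrite -[g]scale1r (hilbert_linearr hH) mul1r scale1r. Qed.

Lemma dot0r f : dot f 0 = 0.
Proof.
have := hilbert_linearr hH f (-1) 0 0.
by rewrite scaler0 addr0 mulN1r addNr.
Qed.

Lemma dotZr f t g : dot f (t *: g) = t * dot f g.
Proof. by rewrite -[t *: g]addr0 (hilbert_linearr hH) dot0r addr0. Qed.

Lemma dotNr f g : dot f (- g) = - dot f g.
Proof. by rewrite -scaleN1r dotZr mulN1r. Qed.

Lemma dotBr f g h : dot f (g - h) = dot f g - dot f h.
Proof. by rewrite dotDr dotNr. Qed.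

Lemma dotC f g : dot g f = conjc (dot f g).
Proof. exact: hilbert_conj hH f g. Qed.

Lemma dotBl f g h : dot (f - g) h = dot f h - dot g h.
Proof. by rewrite dotC dotBr conjcD conjcN -!dotC. Qed.

Lemma dotZl t f g : dot (t *: f) g = conjc t * dot f g.
Proof. by rewrite dotC dotZr conjcM -dotC. Qed.

Lemma nrm2_ge0 f : 0 <= nrm2 f.
Proof.
have [->|f0] := eqVneq f 0; first by rewrite /nrm2 dot0r.
have := hilbert_definite hH f0; rewrite /nrm2.
by case: (dot f f) => a b; rewrite ltcE /= => /andP[_ /ltW].
Qed.

Lemma dot_self f : dot f f = (nrm2 f)%:C.
Proof.
have := dotC f f; rewrite /nrm2; case: (dot f f) => a b /= [] h.
by apply: complex_eqP => //=; lra.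
Qed.

Lemma nrm2_eq0 f : nrm2 f = 0 -> f = 0.
Proof.
move=> f0; apply/eqP; apply: contraT => /(hilbert_definite hH).
by rewrite dot_self f0 ltxx.
Qed.

Lemma hnorm_sqr f : hnorm dot f ^+ 2 = nrm2 f.
Proof. by rewrite sqr_sqrtr// nrm2_ge0. Qed.

Lemma hnorm_ge0 f : 0 <= hnorm dot f. Proof. exact: sqrtr_ge0. Qed.

Lemma nrm2B_proj g z : nrm2 g != 0 ->
  nrm2 (z - (dot g z / (nrm2 g)%:C) *: g) = nrm2 z - normc (dot g z) ^+ 2 / nrm2 g.
Proof.
move=> N0; set N := nrm2 g; set w := dot g z.
rewrite /nrm2 dotBl !dotBr dotZr !dotZl dotZr dot_self -/N (dotC g z) -/w.
have -> : w / N%:C = N^-1%:C * w by rewrite mulrC fmorphV.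
rewrite conjcM (_ : conjc (N^-1)%:C = (N^-1)%:C); last by rewrite /= oppr0.
rewrite normc_sqr; case: w => a b; rewrite !ReImE /=; rewrite /nrm2.
by field; rewrite N0.
Qed.

(** Optimizing [nrm2 (z - t *: g)] over [t]: for [d = 0] this is the
    Cauchy-Schwarz inequality; in general it bounds how far [z] is from being
    orthogonal to [g] when no multiple of [g] brings it closer than [d]. *)
Lemma dot_le_dist d g z : (forall t, d <= nrm2 (z - t *: g)) ->
  normc (dot g z) ^+ 2 <= nrm2 g * (nrm2 z - d).
Proof.
move=> Hd; have [N0|N0] := eqVneq (nrm2 g) 0.
  rewrite (nrm2_eq0 N0) dotC dot0r conjc0 ComplexField.Normc.normc0 expr0n /=.
  by rewrite /nrm2 dot0r mul0r.
have := Hd (dot g z / (nrm2 g)%:C); rewrite nrm2B_proj//.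
have Np : 0 < nrm2 g by rewrite lt0r N0 nrm2_ge0.
by rewrite lerBrDr addrC -lerBrDr ler_pdivrMr// mulrC.
Qed.

Lemma cauchy_schwarz g z : normc (dot g z) <= hnorm dot g * hnorm dot z.
Proof.
rewrite -(ler_pXn2r (_ : 0 < 2)%N) ?nnegrE ?normc_ge0 ?mulr_ge0 ?hnorm_ge0//.
rewrite exprMn !hnorm_sqr -[nrm2 z]subr0; apply: dot_le_dist => t.
exact: nrm2_ge0.
Qed.

(** Minimizing sequences of the distance to [D] are asymptotically orthogonal to
    [D], hence Cauchy; the limit of [h - g n] is orthogonal to [D], so it is 0. *)
Lemma hdense_orthogonal (D : set H) : linear_subspace D ->
  (forall z, (forall g, D g -> dot g z = 0) -> z = 0) -> hdense dot D.
Proof.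
move=> [D0 DL] orth h e e0.
pose A := [set nrm2 (h - g) | g in D].
have A0 : A (nrm2 (h - 0)) by exists 0.
have lbA : lbound A 0 by move=> _ [g _ <-]; exact: nrm2_ge0.
have hA : has_inf A by split; [exists (nrm2 (h - 0))|exists 0].
pose d := inf A.
have dA g : D g -> d <= nrm2 (h - g).
  by move=> Dg; apply: ge_inf; [exists 0|exists g].
have gP (n : nat) : exists g, D g /\ nrm2 (h - g) < d + n.+1%:R^-1.
  have [] := @inf_adherent R A n.+1%:R^-1 _ hA; first by rewrite invr_gt0.
  by move=> _ [g Dg <-] lt; exists g.
pose g n := projT1 (cid (gP n)).
have [Dg gd] : (forall n, D (g n)) /\ forall n, nrm2 (h - g n) < d + n.+1%:R^-1.
  by split=> n; rewrite /g; case: (cid _) => x [].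
pose z n := h - g n.
(* By near minimality no multiple of [f] brings [z n] closer to 0, so that [z n]
   is almost orthogonal to [f]. *)
have small n f : D f -> normc (dot f (z n)) <= hnorm dot f * Num.sqrt n.+1%:R^-1.
  move=> Df; rewrite -(ler_pXn2r (_ : 0 < 2)%N) ?nnegrE ?normc_ge0 ?mulr_ge0 ?sqrtr_ge0//.
  rewrite exprMn hnorm_sqr sqr_sqrtr ?invr_ge0//.
  apply: (@le_trans _ _ (nrm2 f * (nrm2 (z n) - d))).
    apply: dot_le_dist => t; rewrite /z -addrA -opprD; apply: dA.
    by rewrite addrC; exact: DL.
  by rewrite ler_wpM2l ?nrm2_ge0// lerBlDl; exact: ltW (gd n).
have Dz m n : D (z m - z n).
  have -> : z m - z n = -1 *: g m + g n by rewrite scaleN1r /z opprB addrC addrA subrK addrC.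
  exact: DL.
have cau m n : hnorm dot (z m - z n) <= Num.sqrt m.+1%:R^-1 + Num.sqrt n.+1%:R^-1.
  have [->|N0] := eqVneq (hnorm dot (z m - z n)) 0.
    by rewrite addr_ge0 ?sqrtr_ge0.
  have Np : 0 < hnorm dot (z m - z n) by rewrite lt0r N0 hnorm_ge0.
  rewrite -(ler_pM2l Np) -expr2 hnorm_sqr /nrm2 dotBr ReD ReN.
  rewrite mulrDr; apply: lerD.
    by apply: le_trans (ler_norm _) _; apply: le_trans (normr_Re_le _) _; exact: small.
  apply: le_trans (ler_norm _) _; rewrite normrN.
  by apply: le_trans (normr_Re_le _) _; exact: small.
have eps (r : R) : 0 < r -> exists N, forall n, (N <= n)%N -> Num.sqrt n.+1%:R^-1 < r.
  move=> r0; exists (Num.truncn (r ^- 2)) => n Nn.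
  rewrite -(ltr_pXn2r (_ : 0 < 2)%N) ?nnegrE ?sqrtr_ge0 ?(ltW r0)//.
  rewrite sqr_sqrtr ?invr_ge0// invf_plt ?posrE ?exprn_gt0//.
  by apply: lt_le_trans (truncnS_gt _) _; rewrite ler_nat.
have [|l Hl] := hilbert_complete hH (u := z).
  move=> r r0; have r20 : 0 < r / 2 by rewrite divr_gt0.
  have [N HN] := eps _ r20; exists N => m n Nm Nn.
  apply: le_lt_trans (cau m n) _.
  by rewrite [ltRHS](splitr r) ltrD// HN.
have l0 : l = 0.
  apply: orth => f Df; apply: ComplexField.Normc.eq0_normc; apply/eqP.
  rewrite eq_le normc_ge0 andbT; apply/ler_addgt0Pl => r r0.
  pose M := hnorm dot f + 1.
  have M0 : 0 < M by rewrite ltr_wpDl ?hnorm_ge0.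
  have q0 : 0 < r / 2 / M by rewrite !divr_gt0.
  have [N1 H1] := Hl _ q0; have [N2 H2] := eps _ q0.
  pose n := maxn N1 N2.
  have := H1 n (leq_maxl _ _); have := H2 n (leq_maxr _ _) => lt2 lt1.
  have -> : l = z n - (z n - l) by rewrite opprB addrC subrK.
  rewrite dotBr addr0; apply: le_trans (le_normcD _ _) _.
  rewrite normcN (splitr r) lerD//.
    apply: le_trans (small n f Df) _.
    apply: (@le_trans _ _ (M * (r / 2 / M))).
      by apply: ler_pM; rewrite ?hnorm_ge0 ?sqrtr_ge0 /M ?lerDl// ltW.
    by rewrite mulrC mulfVK// gt_eqF.
  apply: le_trans (cauchy_schwarz _ _) _.
  apply: (@le_trans _ _ (M * (r / 2 / M))).
    by apply: ler_pM; rewrite ?hnorm_ge0 /M ?lerDl// ltW.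
  by rewrite mulrC mulfVK// gt_eqF.
have [N HN] := Hl e e0; exists (g N) => //.
by have := HN N (leqnn N); rewrite l0 subr0.
Qed.

End hilbert_density.

(** * Square integrable functions form a Hilbert space *)

Lemma cvg_geometric_increments (R : realType) (a : nat -> R) (C r : R) :
  0 <= r < 1 -> (forall k, `|a k.+1 - a k| <= C * r ^+ k) -> cvgn a.
Proof.
move=> /andP[r0 r1] H.
have C0 : 0 <= C by have := le_trans (normr_ge0 _) (H 0%N); rewrite expr0 mulr1.
have cs : cvgn (series (telescope a)).
  apply: normed_cvg; apply: (series_le_cvg (v_ := geometric C r)).
  - by move=> n; rewrite /= normr_ge0.
  - by move=> n; rewrite /geometric /= mulr_ge0 ?exprn_ge0.
  - by move=> n; exact: H.
  - by apply: is_cvg_geometric_series; rewrite ger0_norm.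
rewrite (_ : a = (fun n => a 0%N + series (telescope a) n)); last first.
  by apply/funext => n; exact: eq_sum_telescope.
by apply: is_cvgD => //; exact: is_cvg_cst.
Qed.

Lemma limn_einf_le (R : realType) (u : nat -> \bar R) (c : \bar R) :
  (forall n, u n <= c)%E -> (limn_einf u <= c)%E.
Proof.
move=> uc; rewrite limn_einf_lim; apply: lime_le; first exact: is_cvg_einfs.
apply: nearW => n; apply: le_trans (uc n).
by apply: ereal_inf_lbound; exists n => /=.
Qed.

Section L2_hilbert.
Context d (T : measurableType d) (R : realType).
Variable mu : {measure set T -> \bar R}.
Implicit Types (F G : T -> R[i]) (f g h : L2 mu).

Definition sqint F : Prop :=
  cmeasurable F /\ (\int[mu]_x (normc (F x) ^+ 2)%:E < +oo)%E.

Lemma sqint_repr f : sqint (repr f).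
Proof. by case: (repr f) => F /= /asboolP. Qed.

Lemma sqint_class F : sqint F -> exists f : L2 mu, L2_class_of F f.
Proof.
move=> sF; have FP : F \in square_integrable mu by exact/asboolP.
exists (\pi_(L2 mu) (SquareIntegrableFun FP))%qT.
exact: (repr_L2 (SquareIntegrableFun FP)).
Qed.

Lemma L2_class_eq F f g : L2_class_of F f -> L2_class_of F g -> f = g.
Proof.
move=> cf cg; rewrite -[f]reprK -[g]reprK; apply/piL2.
by apply: filterS2 cf cg => x -> ->.
Qed.

Lemma L2_class_repr f : L2_class_of (repr f) f.
Proof. exact: aeW. Qed.

Lemma L2_class_ae F G f : {ae mu, forall x, F x = G x} ->
  L2_class_of F f -> L2_class_of G f.
Proof. by move=> FG cf; apply: filterS2 FG cf => x -> ->. Qed.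

Lemma L2_class_lin a F G f g : L2_class_of F f -> L2_class_of G g ->
  L2_class_of (fun x => a * F x + G x) (a *: f + g).
Proof.
move=> cf cg; have e1 := repr_L2 (a *: repr f).
have e2 := repr_L2 (repr (a *: f) + repr g).
apply: filterS2 e2 (filterI (filterI e1 cf) cg) => x h2 [[h1 hf] hg].
by rewrite [LHS]h2 sqintD -hg -hf; congr (_ + _); rewrite -sqintZ; exact: h1.
Qed.

Lemma L2_class_scale a F f : L2_class_of F f -> L2_class_of (fun x => a * F x) (a *: f).
Proof.
move=> cf; have e1 := repr_L2 (a *: repr f).
by apply: filterS2 e1 cf => x h1 hf; rewrite [LHS]h1 sqintZ hf.
Qed.

Lemma L2_class0 : L2_class_of (fun=> 0) (0 : L2 mu).
Proof. by have e := repr_L2 (0 : square_integrable_fun mu). Qed.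

Lemma L2_classB F G f g : L2_class_of F f -> L2_class_of G g ->
  L2_class_of (fun x => F x - G x) (f - g).
Proof.
move=> cf cg; rewrite addrC -scaleN1r.
by apply: L2_class_ae (L2_class_lin (-1) cg cf); apply: aeW => x; rewrite mulN1r addrC.
Qed.

Lemma cintegral_ae_eq F G : cmeasurable F -> cmeasurable G ->
  {ae mu, forall x, F x = G x} -> cintegral mu F = cintegral mu G.
Proof.
move=> [f1 f2] [g1 g2] fg.
have H (h k : T -> R) : measurable_fun setT h -> measurable_fun setT k ->
    {ae mu, forall x, h x = k x} -> \int[mu]_x h x = \int[mu]_x k x.
  move=> mh mk hk; rewrite /Rintegral; congr fine; apply: ae_eq_integral => //.
  - exact/measurable_EFinP.
  - exact/measurable_EFinP.
  - by apply: filterS hk => x -> _.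
by apply: complex_eqP; apply: H => //; apply: filterS fg => x ->.
Qed.

Lemma cmeasurable_dot F G : cmeasurable F -> cmeasurable G ->
  cmeasurable (fun x => conjc (F x) * G x).
Proof. by move=> mF mG; apply: cmeasurableM => //; exact: cmeasurable_conj. Qed.

Lemma L2dotE F G f g : cmeasurable F -> cmeasurable G ->
  L2_class_of F f -> L2_class_of G g ->
  L2dot mu f g = cintegral mu (fun x => conjc (F x) * G x).
Proof.
move=> mF mG cf cg; have [mf _] := sqint_repr f; have [mg _] := sqint_repr g.
apply: cintegral_ae_eq; [exact: cmeasurable_dot|exact: cmeasurable_dot|].
by apply: filterS2 cf cg => x -> ->.
Qed.

Lemma sqint_integrable F : sqint F -> mu.-integrable setT (EFin \o (fun x => normc (F x) ^+ 2)).
Proof.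
move=> [mF iF]; apply/integrableP; split.
  by apply/measurable_EFinP; apply: measurable_funX; exact: cmeasurable_normc.
apply: le_lt_trans iF; rewrite le_eqVlt; apply/orP; left; apply/eqP.
by apply: eq_integral => x _; rewrite /= ger0_norm// sqr_ge0.
Qed.

Lemma cintegrable_dot F G : sqint F -> sqint G ->
  cintegrable mu (fun x => conjc (F x) * G x).
Proof.
move=> sF sG; have [mF _] := sF; have [mG _] := sG.
have iFG := integrable_addr (sqint_integrable sF) (sqint_integrable sG).
apply: (cintegrable_dominated (cmeasurable_dot mF mG) iFG) => x.
rewrite ComplexField.Normc.normcM normc_conj.
have := normc_ge0 (F x); have := normc_ge0 (G x).
move: (normc _) (normc _) => a b a0 b0.
by have := sqr_ge0 (a - b); have := sqr_ge0 a; have := sqr_ge0 b; rewrite sqrrB; nra.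
Qed.

Lemma L2dot_linearr f a g h :
  L2dot mu f (a *: g + h) = a * L2dot mu f g + L2dot mu f h.
Proof.
have [[sf sg] sh] := (sqint_repr f, sqint_repr g, sqint_repr h).
rewrite (L2dotE (F := repr f) (G := fun x => a * repr g x + repr h x)).
- rewrite /L2dot -cintegral_lin; [|exact: cintegrable_dot..].
  by apply: eq_cintegral => x; rewrite mulrDr mulrCA.
- by case: sf.
- by apply: cmeasurableD; [apply: cmeasurableM; [exact: cmeasurable_cst|case: sg]|case: sh].
- exact: L2_class_repr.
- by apply: L2_class_lin; exact: L2_class_repr.
Qed.

Lemma L2dot_conj f g : L2dot mu g f = conjc (L2dot mu f g).
Proof.
rewrite /L2dot -cintegral_conj; last by apply: cintegrable_dot; exact: sqint_repr.
by apply: eq_cintegral => x; rewrite conjcM conjcK mulrC.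
Qed.

Lemma conjc_mul_self (z : R[i]) : conjc z * z = (normc z ^+ 2)%:C.
Proof. by apply: complex_eqP; rewrite !ReImE /= ?normc_sqr; ring. Qed.

Lemma L2dot_self f :
  L2dot mu f f = (\int[mu]_x (normc (repr f x) ^+ 2))%:C.
Proof.
rewrite /L2dot; under eq_cintegral do rewrite conjc_mul_self.
by apply: complex_eqP => //=; rewrite Rintegral_cst// mul0r.
Qed.

Lemma L2dot_definite f : f != 0 -> 0 < L2dot mu f f.
Proof.
move=> f0; rewrite L2dot_self ltcE /= eqxx /= lt0r Rintegral_ge0 ?andbT; last first.
  by move=> x _; rewrite sqr_ge0.
apply: contra f0 => /eqP i0.
have sf := sqint_repr f; have [mf _] := sf.
have mN : measurable_fun setT (fun x => (normc (repr f x) ^+ 2)%:E).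
  by apply/measurable_EFinP; apply: measurable_funX; exact: cmeasurable_normc.
have N0 : ae_eq mu setT (fun x => (normc (repr f x) ^+ 2)%:E) (cst 0%E).
  apply/(ae_eq_integral_abs mu measurableT mN).
  rewrite (eq_integral (fun x => (normc (repr f x) ^+ 2)%:E)); last first.
    by move=> x _; rewrite /= ger0_norm// sqr_ge0.
  have fin := integrable_fin_num measurableT (sqint_integrable sf).
  by rewrite -(fineK fin) [fine _]i0.
apply/eqP; apply: (L2_class_eq (F := fun=> 0)); last exact: L2_class0.
apply: filterS N0 => x /(_ Logic.I) /= /eqP; rewrite eqe sqrf_eq0 => /eqP.
exact: ComplexField.Normc.eq0_normc.
Qed.

Lemma nrm2_class F f : cmeasurable F -> L2_class_of F f ->
  hnorm (L2dot mu) f ^+ 2 = \int[mu]_x (normc (F x) ^+ 2).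
Proof.
move=> mF cf; rewrite /hnorm (L2dotE mF mF cf cf).
under eq_cintegral do rewrite conjc_mul_self.
by rewrite /= sqr_sqrtr//; apply: Rintegral_ge0 => x _; rewrite sqr_ge0.
Qed.

Lemma sqint_lin a F G : sqint F -> sqint G -> sqint (fun x => a * F x + G x).
Proof.
move=> sF sG.
have FP : F \in square_integrable mu by exact/asboolP.
have GP : G \in square_integrable mu by exact/asboolP.
by have [_ /(_ a F G FP GP) /asboolP] := square_integrable_submod_closed mu.
Qed.

Lemma nrm2_classE F f : sqint F -> L2_class_of F f ->
  (\int[mu]_x (normc (F x) ^+ 2)%:E)%E = (hnorm (L2dot mu) f ^+ 2)%:E.
Proof.
move=> sF cf; have [mF _] := sF; rewrite (nrm2_class mF cf) /Rintegral.
by rewrite fineK//; exact: (integrable_fin_num measurableT (sqint_integrable sF)).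
Qed.

Lemma measurable_normc_sqr F : cmeasurable F ->
  measurable_fun setT (fun x => (normc (F x) ^+ 2)%:E).
Proof.
by move=> mF; apply/measurable_EFinP; apply: measurable_funX; exact: cmeasurable_normc.
Qed.

(** A subsequence with summable increments converges almost everywhere, because
    the weighted sum of the squared increments has finite integral; the limit
    is also the limit in norm by Fatou's lemma. *)
Lemma L2_complete (u : nat -> L2 mu) :
  (forall e : R, 0 < e -> exists N : nat, forall m n : nat,
     (N <= m)%N -> (N <= n)%N -> hnorm (L2dot mu) (u m - u n) < e) ->
  exists l : L2 mu, forall e : R, 0 < e -> exists N : nat, forall n : nat,
     (N <= n)%N -> hnorm (L2dot mu) (u n - l) < e.
Proof.
move=> cau; pose e (k : nat) : R := 2^-1 ^+ k.
have e_gt0 k : 0 < e k by rewrite exprn_gt0// invr_gt0.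
pose N k := projT1 (cid (cau (e k) (e_gt0 k))).
have HN k m n : (N k <= m)%N -> (N k <= n)%N -> hnorm (L2dot mu) (u m - u n) < e k.
  by rewrite /N; case: (cid _) => /= M; apply.
(* The subsequence [phi] has increments below [2 ^ (- k)], whose squares are still
   summable against the weights [2 ^ k]. *)
pose phi k := (\max_(i < k.+1) N i)%N.
have phiN i k : (i <= k)%N -> (N i <= phi k)%N.
  by move=> ik; apply: (@leq_bigmax _ (fun j : 'I_k.+1 => N j) (Ordinal (ik : (i < k.+1)%N))).
pose f k := repr (u (phi k)).
have sf k : sqint (f k) by exact: sqint_repr.
have mf k : cmeasurable (f k) by case: (sf k).
pose D k x : R := normc (f k.+1 x - f k x) ^+ 2.
have D0 k x : 0 <= D k x by exact: sqr_ge0.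
have sdiff F G : sqint F -> sqint G -> sqint (fun x => F x - G x).
  move=> sF sG; have := sqint_lin (-1) sG sF.
  by congr sqint; apply/funext => x; rewrite mulN1r addrC.
have intD (m n i : nat) : (N i <= m)%N -> (N i <= n)%N ->
    (\int[mu]_x (normc (repr (u m) x - repr (u n) x) ^+ 2)%:E <= ((e i) ^+ 2)%:E)%E.
  move=> im jn; rewrite (nrm2_classE (f := u m - u n)); last 2 first.
  - by apply: sdiff; exact: sqint_repr.
  - by apply: L2_classB; exact: L2_class_repr.
  by rewrite lee_fin lerXn2r ?nnegrE ?sqrtr_ge0 ?(ltW (e_gt0 _)) ?(ltW (HN _ _ _ _ _)).
have mD k : measurable_fun setT (fun x => (2 ^+ k * D k x)%:E).
  apply/measurable_EFinP; apply: measurable_funM => //; apply/measurable_EFinP.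
  by apply: measurable_normc_sqr; case: (sdiff _ _ (sf k.+1) (sf k)).
pose W x : \bar R := (\sum_(k <oo) (2 ^+ k * D k x)%:E)%E.
have t0 k x : (0 <= (2 ^+ k * D k x)%:E)%E by rewrite lee_fin mulr_ge0// exprn_ge0.
have mW : measurable_fun setT W by apply: ge0_emeasurable_sum => // k x _ _; exact: t0.
have W0 x : (0 <= W x)%E by apply: nneseries_ge0 => k _ _; exact: t0.
have iW : (\int[mu]_x W x < +oo)%E.
  rewrite integral_nneseries//.
  apply: (@le_lt_trans _ _ (\sum_(k <oo) (geometric 1 2^-1 k)%:E)%E).
    apply: lee_nneseries => [k *|k *]; first by apply: integral_ge0 => x _; exact: t0.
    under eq_integral do rewrite EFinM.
    have mDk : measurable_fun setT (fun x => (D k x)%:E).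
      by apply: measurable_normc_sqr; case: (sdiff _ _ (sf k.+1) (sf k)).
    rewrite ge0_integralZl_EFin ?exprn_ge0//; last by move=> x _; rewrite lee_fin.
    apply: le_trans (lee_wpmul2l _ (intD (phi k.+1) (phi k) k _ _)) _.
    - by rewrite lee_fin exprn_ge0.
    - exact/phiN/leqnSn.
    - exact: phiN.
    rewrite -EFinM lee_fin /geometric /= mul1r /e -exprM mulnC exprM -exprMn.
    by rewrite expr2 mulrA divff// mul1r.
  have h1 : `|2^-1 : R| < 1 by rewrite ger0_norm// invf_lt1// ltr1n.
  have cv := @cvg_geometric_series R 1 2^-1 h1.
  rewrite (_ : (\sum_(k <oo) _)%E = (1 * (1 - 2^-1)^-1)%:E) ?ltry//.
  apply: cvg_lim => //.
  rewrite (_ : (fun n => _) = EFin \o series (geometric 1 2^-1)).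
    by apply: cvg_EFin; [exact: nearW|exact: cv].
  by apply/funext => k; rewrite /series /= -sumEFin.
(* Each increment is at most [sqrt (W x) (sqrt (1 / 2)) ^ k], so that the
   subsequence converges off the null set where [W] is infinite; it is replaced
   by 0 on that set. *)
pose A := [set x | (W x < +oo)%E].
have mA : measurable A.
  have mI : measurable [set x : \bar R | (x < +oo)%E].
    by have := @emeasurable_itv R `]-oo, +oo%E[; rewrite set_itvE.
  by have := mW measurableT _ mI; rewrite setTI.
have aeA : {ae mu, forall x, A x}.
  have : mu.-integrable setT W.
    apply/integrableP; split=> //; rewrite (eq_integral W)// => x _.
    by rewrite gee0_abs.
  move=> /integrable_ae => /(_ measurableT); apply: filterS => x /(_ Logic.I).
  by rewrite fin_numE /A /= ltey => /andP[].
pose fA k x : R[i] := (\1_A x)%:C * f k x.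
have c1A : cmeasurable (fun x => (\1_A x : R)%:C).
  by split; [exact: measurable_indic|exact: measurable_cst].
have mfA k : cmeasurable (fA k) by exact: cmeasurableM.
have aefA k : {ae mu, forall x, fA k x = f k x}.
  by apply: filterS aeA => x Ax; rewrite /fA indicE mem_set// mul1r.
have incr x k : normc (fA k.+1 x - fA k x) <= Num.sqrt (fine (W x)) * Num.sqrt 2^-1 ^+ k.
  rewrite /fA -mulrBr ComplexField.Normc.normcM normc_real indicE.
  have [Ax|Ax] := pselect (A x); last first.
    by rewrite memNset// normr0 mul0r mulr_ge0 ?exprn_ge0 ?sqrtr_ge0.
  rewrite mem_set// normr1 mul1r.
  rewrite -(ler_pXn2r (_ : 0 < 2)%N) ?nnegrE ?normc_ge0 ?mulr_ge0 ?exprn_ge0 ?sqrtr_ge0//.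
  rewrite exprMn sqr_sqrtr ?fine_ge0// -exprM mulnC exprM sqr_sqrtr ?invr_ge0//.
  rewrite -[X in X <= _]/(D k x) exprVn ler_pdivlMr ?exprn_gt0// mulrC.
  rewrite -lee_fin fineK; last by rewrite ge0_fin_numE.
  apply: le_trans (nneseries_lim_ge k.+1 (fun i _ _ => t0 i x)).
  by rewrite big_nat_recr//= leeDr// sume_ge0.
have r01 : 0 <= (Num.sqrt 2^-1 : R) < 1.
  by rewrite sqrtr_ge0 -[ltRHS]sqrtr1 ltr_sqrt// invf_lt1// ltr1n.
have cvRe x : cvgn (fun k => Re (fA k x)).
  apply: (cvg_geometric_increments r01 (C := Num.sqrt (fine (W x)))) => k.
  by apply: le_trans (incr x k); rewrite -ReN -ReD; exact: normr_Re_le.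
have cvIm x : cvgn (fun k => Im (fA k x)).
  apply: (cvg_geometric_increments r01 (C := Num.sqrt (fine (W x)))) => k.
  by apply: le_trans (incr x k); rewrite -ImN -ImD; exact: normr_Im_le.
pose l x : R[i] := limn (fun k => Re (fA k x)) +i* limn (fun k => Im (fA k x)).
have ml : cmeasurable l.
  have [m1 m2] : (forall k, measurable_fun setT (fun x => Re (fA k x))) /\
      forall k, measurable_fun setT (fun x => Im (fA k x)).
    by split=> k; case: (mfA k).
  split=> /=.
    apply: (measurable_fun_cvg m1) => x _; exact: cvRe.
  apply: (measurable_fun_cvg m2) => x _; exact: cvIm.
have close i n : (N i <= n)%N ->
    (\int[mu]_x (normc (l x - repr (u n) x) ^+ 2)%:E <= ((e i) ^+ 2)%:E)%E.
  move=> Nn; pose h m x : \bar R := (normc (fA (m + i)%N x - repr (u n) x) ^+ 2)%:E.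
  have mrn : cmeasurable (repr (u n)) by case: (sqint_repr (u n)).
  have mh m : measurable_fun setT (h m).
    apply: measurable_normc_sqr; apply: (cmeasurableD (mfA _)).
    rewrite (_ : (fun x => _) = (fun x => -1 * repr (u n) x)).
      by apply: cmeasurableM => //; exact: cmeasurable_cst.
    by apply/funext => x; rewrite mulN1r.
  have hl x : limn_einf (h ^~ x) = (normc (l x - repr (u n) x) ^+ 2)%:E.
    have cv : h ^~ x @ \oo --> (normc (l x - repr (u n) x) ^+ 2)%:E.
      apply: cvg_EFin; first exact: nearW.
      rewrite (_ : _ \o _ = (fun m => (Re (fA (m + i)%N x) - Re (repr (u n) x)) ^+ 2 +
         (Im (fA (m + i)%N x) - Im (repr (u n) x)) ^+ 2)); last first.
        by apply/funext => m; rewrite /h /= normc_sqr !ReImE.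
      have cvsqr (v : nat -> R) (a : R) : v @ \oo --> a -> (fun m => v m ^+ 2) @ \oo --> a ^+ 2.
        by move=> va; rewrite expr2; under eq_fun do rewrite expr2; exact: cvgM.
      rewrite normc_sqr !ReImE; apply: cvgD; apply: cvsqr; apply: cvgB; try exact: cvg_cst.
        by rewrite (cvg_shiftn i (fun m => Re (fA m x))); exact: cvRe.
      by rewrite (cvg_shiftn i (fun m => Im (fA m x))); exact: cvIm.
    by rewrite is_cvg_limn_einfE; [exact: (cvg_lim _ cv)|exact: (cvgP _ cv)].
  under eq_integral do rewrite -hl.
  apply: le_trans (fatou _ _ _ _) _ => //; first by move=> m x _; rewrite lee_fin sqr_ge0.
  apply: limn_einf_le => m.
  rewrite (ae_eq_integral (fun x => (normc (f (m + i)%N x - repr (u n) x) ^+ 2)%:E))//.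
  - by apply: intD => //; apply: phiN; exact: leq_addl.
  - by apply: measurable_normc_sqr; case: (sdiff _ _ (sf (m + i)%N) (sqint_repr (u n))).
  - by apply: filterS (aefA (m + i)%N) => x fx _; rewrite /h fx.
have sl : sqint l.
  have s1 : sqint (fun x => l x - repr (u (N 0%N)) x).
    split; last by apply: le_lt_trans (close 0%N (N 0%N) (leqnn _)) _; exact: ltry.
    have [m0 _] := sqint_repr (u (N 0%N)).
    apply: (cmeasurableD ml).
    rewrite (_ : (fun x => _) = (fun x => -1 * repr (u (N 0%N)) x)).
      by apply: cmeasurableM => //; exact: cmeasurable_cst.
    by apply/funext => x; rewrite mulN1r.
  have := sqint_lin 1 s1 (sqint_repr (u (N 0%N))).
  by congr sqint; apply/funext => x; rewrite mul1r subrK.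
have [L cL] := sqint_class sl.
exists L => r r0.
have [i ir] : exists i, e i < r.
  have h1 : `|2^-1 : R| < 1 by rewrite ger0_norm// invf_lt1// ltr1n.
  have /cvgr0_norm_lt /(_ r r0) [i _ Hi] := cvg_expr h1.
  by exists i; have := Hi i (leqnn i); rewrite ger0_norm// ltW// e_gt0.
exists (N i) => n Nn; apply: le_lt_trans ir.
rewrite -(ler_pXn2r (_ : 0 < 2)%N) ?nnegrE ?sqrtr_ge0 ?(ltW (e_gt0 i))//.
rewrite -lee_fin -(nrm2_classE (F := fun x => repr (u n) x - l x)); last 2 first.
- by apply: sdiff => //; exact: sqint_repr.
- by apply: L2_classB => //; exact: L2_class_repr.
apply: le_trans (close i n Nn); rewrite le_eqVlt; apply/orP; left; apply/eqP.
by apply: eq_integral => x _; rewrite -normcN opprB.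
Qed.

Lemma L2_hilbert : hilbert_space (L2dot mu).
Proof.
split; [exact: L2dot_linearr|exact: L2dot_conj|exact: L2dot_definite|exact: L2_complete].
Qed.

End L2_hilbert.

(** * Determinacy of exponentially integrable counts *)

Section exponential_moments.
Context d (T : measurableType d) (R : realType) (mu : {measure set T -> \bar R}).
Variables (G : T -> R[i]) (N : T -> nat) (e : R).
Hypotheses (mG : cmeasurable G) (e0 : 0 < e).
Hypothesis mN : forall w : nat -> R, measurable_fun setT (fun x => w (N x)).
Hypothesis iG : mu.-integrable setT (EFin \o (fun x => normc (G x) * expR (e * (N x)%:R))).
Implicit Types w : nat -> R.

(** The integrand is kept in the form of a fixed function times a sequence evaluated
    at [N], so that all limits are taken in the sequence. *)
Definition weighted w : R[i] := cintegral mu (fun x => G x * (w (N x))%:C).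

Definition subexponential (K : R) w : Prop := forall n, `|w n| <= K * expR (e * n%:R).

Lemma cmeasurable_weighted w : cmeasurable (fun x => G x * (w (N x))%:C).
Proof.
by apply: cmeasurableM => //; split; [exact: mN|exact: measurable_cst].
Qed.

Lemma normc_weighted K w x : subexponential K w ->
  normc (G x * (w (N x))%:C) <= K * (normc (G x) * expR (e * (N x)%:R)).
Proof.
move=> Kw; rewrite ComplexField.Normc.normcM normc_real mulrCA ler_wpM2l//.
exact: normc_ge0.
Qed.

Lemma cintegrable_weighted K w : subexponential K w ->
  cintegrable mu (fun x => G x * (w (N x))%:C).
Proof.
move=> Kw; apply: (cintegrable_dominated (cmeasurable_weighted w) _ (fun x => normc_weighted x Kw)).
exact: integrable_scale.
Qed.

Lemma subexponential_sum (I : Type) (r : seq I) (a : I -> R) (ws : I -> nat -> R) :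
  (forall i, exists K, subexponential K (ws i)) ->
  exists K, subexponential K (fun n => \sum_(i <- r) a i * ws i n).
Proof.
move=> Hw; elim: r => [|i r [K HK]].
  by exists 0 => n; rewrite big_nil normr0 mul0r.
have [L HL] := Hw i; exists (`|a i| * L + K) => n.
rewrite big_cons mulrDl; apply: le_trans (ler_normD _ _) _; apply: lerD => //.
by rewrite normrM -mulrA ler_wpM2l.
Qed.

Lemma weighted_sum0 (I : Type) (r : seq I) (a : I -> R) (ws : I -> nat -> R) :
  (forall i, exists K, subexponential K (ws i)) -> (forall i, weighted (ws i) = 0) ->
  weighted (fun n => \sum_(i <- r) a i * ws i n) = 0.
Proof.
move=> Hw w0; elim: r => [|i r ih].
  rewrite -[RHS](@cintegral0 _ T R mu).
  by apply: eq_cintegral => x; rewrite big_nil mulr0.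
have [K HK] := Hw i; have [L HL] := subexponential_sum r a Hw.
rewrite /weighted (@eq_cintegral _ _ _ _ _ (fun x => (a i)%:C * (G x * (ws i (N x))%:C) +
   G x * (\sum_(j <- r) a j * ws j (N x))%:C)); last first.
  by move=> x; rewrite big_cons rmorphD rmorphM/= mulrDr mulrCA.
rewrite cintegral_lin; [|exact: (cintegrable_weighted HK)|exact: (cintegrable_weighted HL)].
rewrite [X in _ * X + _](w0 i) mulr0 add0r; exact: ih.
Qed.

Lemma weighted_lim0 K (ws : nat -> nat -> R) w :
  (forall j, subexponential K (ws j)) -> (forall n, ws ^~ n @ \oo --> w n) ->
  (forall j, weighted (ws j) = 0) -> weighted w = 0.
Proof.
move=> Kw cw w0.
have := @cintegral_dominated_cvg _ _ _ mu (fun j x => G x * (ws j (N x))%:C)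
  (fun x => G x * (w (N x))%:C)
  (fun x => K * (normc (G x) * expR (e * (N x)%:R))).
move=> /(_ (fun j => cmeasurable_weighted (ws j)) (cmeasurable_weighted w)).
case.
- by move=> x; apply: ccvgM; [exact: ccvg_cst|split; [exact: cw|exact: cvg_cst]].
- by move=> j x; exact: normc_weighted.
- exact: integrable_scale.
move=> c1 c2; apply: (@ccvg_unique _ (fun=> 0)); last exact: ccvg_cst.
have -> : (fun=> 0) = (fun j => weighted (ws j)) by apply/funext => j; rewrite w0.
by split.
Qed.

Lemma subexponential_moment k (y : R) : 0 <= y ->
  exists K, subexponential K (fun n => n%:R ^+ k * expR (- y * n%:R)).
Proof.
move=> y0; exists (k`!%:R / e ^+ k) => n.
rewrite ger0_norm ?mulr_ge0 ?exprn_ge0 ?expR_ge0//.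
apply: le_trans (natr_exp_le_expR k n e0).
by rewrite ler_piMr ?exprn_ge0// -expR0 ler_expR mulNr oppr_le0 mulr_ge0.
Qed.

(** The exponential series converges dominatedly against [G] as long as its
    argument grows at half the rate [e]; the step does not depend on [y]. *)
Lemma damped_step (y : R) : 0 <= y ->
  (forall k, weighted (fun n => n%:R ^+ k * expR (- y * n%:R)) = 0) ->
  forall k, weighted (fun n => n%:R ^+ k * expR (- (y + e / 2) * n%:R)) = 0.
Proof.
move=> y0 V k.
have e2 : 0 < e / 2 by rewrite divr_gt0.
pose a (i : nat) : R := (- (e / 2)) ^+ i / i`!%:R.
(* Partial sums of the exponential series: combinations of moments already known
   to vanish. *)
pose ws j n : R := \sum_(i <- iota 0 j) a i * (n%:R ^+ (k + i) * expR (- y * n%:R)).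
have wsE j n : ws j n =
    n%:R ^+ k * expR (- y * n%:R) * series (exp_coeff (- (e / 2) * n%:R)) j.
  rewrite /ws /series /= mulr_sumr /index_iota subn0; apply: eq_bigr => i _.
  by rewrite /a /exp_coeff /= exprMn exprD; ring.
apply: (@weighted_lim0 (k`!%:R / (e / 2) ^+ k) ws).
- move=> j n; rewrite wsE normrM ger0_norm ?mulr_ge0 ?exprn_ge0 ?expR_ge0//.
  have h1 : n%:R ^+ k * expR (- y * n%:R) <= (k`!%:R / (e / 2) ^+ k) * expR (e / 2 * n%:R).
    apply: le_trans (natr_exp_le_expR k n e2).
    by rewrite ler_piMr ?exprn_ge0// -expR0 ler_expR mulNr oppr_le0 mulr_ge0.
  have h2 : `|series (exp_coeff (- (e / 2) * n%:R)) j| <= expR (e / 2 * n%:R).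
    have c0 : 0 <= e / 2 * n%:R by rewrite mulr_ge0// ltW.
    apply: (@le_trans _ _ (series (exp_coeff (e / 2 * n%:R)) j)).
      rewrite /series /=; apply: le_trans (ler_norm_sum _ _ _) _.
      apply: ler_sum => i _; rewrite /exp_coeff /= normrM mulNr normrX normrN ger0_norm//.
      by rewrite ger0_norm ?invr_ge0.
    apply: nondecreasing_cvgn_le; last exact: is_cvg_series_exp_coeff.
    apply: nondecreasing_series => i _ _; exact: exp_coeff_ge0.
  rewrite {3}(splitr e) mulrDl expRD mulrA.
  by apply: ler_pM => //; rewrite mulr_ge0 ?exprn_ge0 ?expR_ge0.
- move=> n; rewrite (_ : ws ^~ n = fun j => n%:R ^+ k * expR (- y * n%:R) *
    series (exp_coeff (- (e / 2) * n%:R)) j); last by apply/funext => j; rewrite wsE.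
  rewrite opprD mulrDl expRD mulrA; apply: cvgMr.
  exact: is_cvg_series_exp_coeff.
- move=> j; apply: weighted_sum0 => i; last exact: V.
  exact: subexponential_moment.
Qed.

Lemma damped_moments : (forall k, weighted (fun n => n%:R ^+ k) = 0) ->
  forall j, weighted (fun n => expR (- (e / 2) * n%:R) ^+ j) = 0.
Proof.
move=> V j.
have H : forall k, weighted (fun n => n%:R ^+ k * expR (- (j%:R * (e / 2)) * n%:R)) = 0.
  elim: j => [|j ih] k.
    rewrite -[RHS](V k); congr weighted; apply/funext => n.
    by rewrite mul0r oppr0 mul0r expR0 mulr1.
  rewrite -natr1 mulrDl mul1r; apply: damped_step => //.
  by rewrite mulr_ge0// divr_ge0// ltW.
rewrite -[RHS](H 0%N); congr weighted; apply/funext => n.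
rewrite expr0 mul1r -expRM_natl; congr expR; ring.
Qed.

(** The powers [(1 - (t - t0)^2)^j] of a function of [t = exp (- e N / 2)] in
    [0, 1] single out the value [t0] in the limit, and [t] determines [N]. *)
Lemma weighted_count_eq : (forall k, weighted (fun n => n%:R ^+ k) = 0) ->
  forall m, weighted (fun n => (n == m)%:R) = 0.
Proof.
move=> V m; pose t n : R := expR (- (e / 2) * n%:R).
have t01 n : 0 < t n <= 1.
  rewrite expR_gt0 /= -expR0 ler_expR mulNr oppr_le0 mulr_ge0// divr_ge0// ltW//.
pose q j : {poly R} := (1 - ('X - (t m)%:P) ^+ 2) ^+ j.
have qE j n : (q j).[t n] = (1 - (t n - t m) ^+ 2) ^+ j by rewrite !hornerE.
have b01 n : 0 <= 1 - (t n - t m) ^+ 2 <= 1.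
  rewrite lerBlDr lerDl sqr_ge0 subr_ge0 andbT -real_normK ?num_real// expr_le1// ler_norml.
  by have := t01 n; have := t01 m; lra.
apply: (@weighted_lim0 1 (fun j n => (q j).[t n])).
- move=> j n; rewrite qE mul1r; have /andP[b0 b1] := b01 n.
  rewrite ger0_norm ?exprn_ge0//; apply: (@le_trans _ _ 1); first exact: exprn_ile1.
  by rewrite -expR0 ler_expR mulr_ge0// ltW.
- move=> n; under eq_fun do rewrite qE.
  have [->|nm] := eqVneq n m.
    by rewrite subrr expr0n /= subr0; under eq_fun do rewrite expr1n; exact: cvg_cst.
  apply: cvg_expr; have /andP[b0 b1] := b01 n; rewrite ger0_norm// ltrBlDr ltrDl.
  rewrite lt_neqAle sqr_ge0 andbT eq_sym sqrf_eq0 subr_eq0.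
  apply: contra nm => /eqP /expR_inj /mulfI H.
  have /H /eqP : - (e / 2) != 0 by rewrite oppr_eq0 gt_eqF// divr_gt0.
  by rewrite eqr_nat.
- move=> j; rewrite (_ : (fun n => _) = fun n =>
    \sum_(i <- index_enum 'I_(size (q j))) (q j)`_i * t n ^+ i); last first.
    by apply/funext => n; rewrite horner_coef.
  apply: weighted_sum0 => i; last exact: damped_moments.
  exists 1 => n; rewrite mul1r; have /andP[b0 b1] := t01 n.
  rewrite normrX (ger0_norm (ltW b0)); apply: (@le_trans _ _ 1).
    by apply: exprn_ile1 => //; exact: ltW.
  by rewrite -expR0 ler_expR mulr_ge0// ltW.
Qed.

End exponential_moments.

(** * Completeness of polynomials *)

Section count_determinacy.
Context d (X : measurableType d) (R : realType).
Variables (alpha : {measure set X -> \bar R}) (S : set X).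
Hypotheses (mS : measurable S) (alphaS : (alpha S < +oo)%E).
Variables (p : R) (rho : probability (config X R) R).
Hypotheses (p01 : 0 < p < 1) (hrho : pascal_process p alpha rho).
Variable h : config X R -> R[i].
Hypothesis sqh : sqint rho h.
Implicit Types (F : config X R -> R[i]) (eta : config X R).

Definition count_event (L : seq (set X * nat)) eta : R[i] :=
  \prod_(Cm <- L) (count Cm.1 eta == Cm.2)%:R.

Definition sub_cells (L : seq (set X * nat)) : Prop :=
  {in L, forall Cm, measurable Cm.1 /\ Cm.1 `<=` S}.

Lemma count_mono C eta : measurable C -> C `<=` S -> (eta S < +oo)%E ->
  (eta C < +oo)%E /\ (count C eta <= count S eta)%N.
Proof.
move=> mC CS fin.
have le : (eta C <= eta S)%E by apply: le_measure; rewrite ?inE.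
have finC := le_lt_trans le fin; split=> //.
by move: le; rewrite (count_finE finC) (count_finE fin) lee_fin ler_nat.
Qed.

Lemma count_event_cons C m L eta :
  count_event ((C, m) :: L) eta = (count C eta == m)%:R * count_event L eta.
Proof. by rewrite /count_event big_cons. Qed.

Lemma count_event_le1 L eta : normc (count_event L eta) <= 1.
Proof.
elim: L => [|[C m] L ih]; first by rewrite /count_event big_nil ComplexField.Normc.normc1.
rewrite count_event_cons ComplexField.Normc.normcM.
case: (_ == _); first by rewrite ComplexField.Normc.normc1 mul1r.
by rewrite ComplexField.Normc.normc0 mul0r.
Qed.

Lemma cmeasurable_count_event L : sub_cells L -> cmeasurable (count_event L).
Proof.
elim: L => [|[C m] L ih] LS.
  rewrite (_ : count_event _ = fun=> 1); first exact: cmeasurable_cst.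
  by apply/funext => eta; rewrite /count_event big_nil.
rewrite (_ : count_event _ = fun eta => ((count C eta == m)%:R : R)%:C * count_event L eta).
  apply: cmeasurableM; last by apply: ih => Cm inL; apply: LS; rewrite inE inL orbT.
  split; last exact: measurable_cst.
  have [mC _] := LS (C, m) (mem_head _ _).
  exact: (measurable_of_count mC (fun n => (n == m)%:R : R)).
by apply/funext => eta; rewrite count_event_cons; congr (_ * _); case: (_ == _).
Qed.

Lemma growth_expR_integrable (K e : R) m : 0 <= K -> 0 < e -> e <= pascal_rate p / 8 ->
  rho.-integrable setT (EFin \o (fun eta =>
    (K * (1 + (count S eta)%:R) ^+ m * expR (e * (count S eta)%:R)) ^+ 2)).
Proof.
move=> K0 e0 er; have r0 := pascal_rate_gt0 p01.
pose c := pascal_rate p / 8; have c0 : 0 < c by rewrite divr_gt0.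
apply: (count_exp_integrable p01 hrho mS alphaS
  (g := fun n => (K * (1 + n%:R) ^+ m * expR (e * n%:R)) ^+ 2)
  (K := (K * (m`!%:R / c ^+ m) * expR c) ^+ 2)) => n.
have b1 : (1 + n%:R) ^+ m <= (m`!%:R / c ^+ m) * (expR c * expR (c * n%:R)).
  by have := natr_exp_le_expR m n.+1 c0; rewrite -natr1 addrC mulrDr mulr1 expRD.
have b2 : expR (e * n%:R) <= expR (c * n%:R) by rewrite ler_expR ler_wpM2r.
rewrite ger0_norm ?sqr_ge0//.
have -> : expR (pascal_rate p / 2 * n%:R) = (expR (c * n%:R) * expR (c * n%:R)) ^+ 2.
  by rewrite -expRD -expRM_natl /c; congr expR; field.
have q0 : 0 <= c ^- m by rewrite invr_ge0 exprn_ge0// ltW.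
rewrite -exprMn lerXn2r ?nnegrE ?mulr_ge0 ?exprn_ge0 ?expR_ge0 ?addr_ge0//.
apply: le_trans (ler_pM _ _ (ler_wpM2l K0 b1) b2) _.
- by rewrite mulr_ge0// exprn_ge0// addr_ge0.
- exact: expR_ge0.
by rewrite le_eqVlt; apply/orP; left; apply/eqP; ring.
Qed.

(** Orthogonality to polynomials passes to joint count events, one count at a
    time: the counts already treated are part of the weight in the moment
    problem for the next one. *)
Lemma count_event_orthogonal L : sub_cells L ->
  (forall F, pol S F -> cintegral rho (fun eta => h eta * F eta) = 0) ->
  forall F, pol S F -> cintegral rho (fun eta => h eta * (count_event L eta * F eta)) = 0.
Proof.
move=> + H0; elim: L => [|[C m] L ih] LS F pF.
  rewrite -[RHS](H0 F pF); apply: eq_cintegral => eta.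
  by rewrite /count_event big_nil mul1r.
have LS' : sub_cells L by move=> Cm inL; apply: LS; rewrite inE inL orbT.
have [mC CS] := LS (C, m) (mem_head _ _).
have {}ih := ih LS'; have [mh ih2] := sqh.
pose G eta := h eta * (count_event L eta * F eta).
have mG : cmeasurable G.
  apply: (cmeasurableM mh); apply: cmeasurableM; first exact: cmeasurable_count_event.
  exact: pol_cmeasurable mS _ pF.
have [e e0 er] : exists2 e : R, 0 < e & e <= pascal_rate p / 8.
  by exists (pascal_rate p / 8); rewrite // divr_gt0// pascal_rate_gt0.
have mN (w : nat -> R) : measurable_fun setT (fun eta => w (count C eta)).
  exact: (measurable_of_count mC w).
have [K [k [K0 HK]]] := pol_growth mS pF.
(* The product of the square integrable [h] and of an exponentially growing
   function of the count in [S] is dominated by the sum of their squares. *)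
have iG : rho.-integrable setT (EFin \o (fun eta => normc (G eta) * expR (e * (count C eta)%:R))).
  have i1 := sqint_integrable sqh.
  have i2 := growth_expR_integrable k K0 e0 er.
  have := integrable_addr i1 i2; apply: le_integrable => //.
    apply/measurable_EFinP; apply: measurable_funM; first exact: cmeasurable_normc.
    exact: (mN (fun n => expR (e * n%:R))).
  move=> eta _ /=; rewrite lee_fin ger0_norm ?mulr_ge0 ?normc_ge0 ?expR_ge0//.
  rewrite ger0_norm; last by rewrite addr_ge0// sqr_ge0.
  set v := K * _ * _.
  have v0 : 0 <= v by rewrite !mulr_ge0 ?expR_ge0 ?exprn_ge0 ?addr_ge0.
  apply: (@le_trans _ _ (normc (h eta) * v)).
    rewrite /G !ComplexField.Normc.normcM -!mulrA ler_wpM2l ?normc_ge0//.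
    have [fin|bad] := boolP (eta S < +oo)%E; last first.
      by rewrite (pol_bad pF bad) ComplexField.Normc.normc0 mul0r mulr0.
    apply: le_trans (ler_pM _ _ (count_event_le1 L eta) (lexx _)) _.
    - exact: normc_ge0.
    - by rewrite mulr_ge0 ?normc_ge0 ?expR_ge0.
    rewrite mul1r; have [_ cc] := count_mono mC CS fin.
    rewrite /v; apply: ler_pM; rewrite ?normc_ge0 ?expR_ge0//.
    - by have := HK eta; rewrite /growth fin.
    - by rewrite ler_expR ler_wpM2l ?ler_nat// ltW.
  have := sqr_ge0 (normc (h eta) - v); have := mulr_ge0 (normc_ge0 (h eta)) v0.
  by rewrite sqrrB; lra.
have tC : test_on S (fun x => (\1_C x : R)%:C).
  split.
  - by split; [exact: measurable_indic|exact: measurable_cst].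
  - by exists 1 => x; rewrite normc_real indicE; case: (_ \in _); rewrite ?normr1 ?normr0.
  - by move=> x nSx; rewrite indicE memNset// => /CS.
have mom j : weighted rho G (count C) (fun n => n%:R ^+ j) = 0.
  have pN : pol S (iter j (@number _ X R (fun x => (\1_C x : R)%:C)) F).
    by elim: j => [//|j ihj] /=; exact: pol_number.
  rewrite -[RHS](ih _ pN); apply: eq_cintegral => eta; rewrite /G -!mulrA.
  congr (_ * (_ * _)).
  have [fin|bad] := boolP (eta S < +oo)%E; last by rewrite (pol_bad pF bad) (pol_bad pN bad) mul0r.
  have [finC _] := count_mono mC CS fin.
  have cE : cintegral eta (fun x => (\1_C x : R)%:C) = ((count C eta)%:R : R)%:C.
    rewrite /cintegral /= Rintegral_cst// mul0r.
    rewrite /Rintegral integral_indic// setIT (count_finE finC).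
    by apply: complex_eqP.
  elim: {pN} j => [|j ihj] /=; first by rewrite mulr1.
  by rewrite /number cE -ihj exprS rmorphM/= mulrCA.
rewrite -[RHS](weighted_count_eq mG e0 mN iG mom m); apply: eq_cintegral => eta.
rewrite /G count_event_cons -!mulrA; congr (_ * _); rewrite mulrC -!mulrA.
by congr (_ * (_ * _)); case: (_ == _).
Qed.

End count_determinacy.

Section completeness.
Context d (X : measurableType d) (R : realType).
Variables (alpha : {measure set X -> \bar R}).
Hypothesis sfin : sigma_finite [set: X] alpha.
Variables (p : R) (rho : probability (config X R) R).
Hypotheses (p01 : 0 < p < 1) (hrho : pascal_process p alpha rho).
Implicit Types (F : config X R -> R[i]) (eta : config X R).

Definition count_events : set (set (config X R)) :=
  [set A | exists L : seq (set X * nat),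
    {in L, forall Cm, measurable Cm.1 /\ (alpha Cm.1 < +oo)%E} /\
    A = [set eta : config X R | {in L, forall Cm, eta Cm.1 = Cm.2%:R%:E}]].

Lemma measurable_count_event A : count_events A -> measurable A.
Proof.
move=> [L [HL ->]]; elim: L HL => [|Cm L ih] HL.
  by rewrite (_ : [set _ | _] = setT)// -subTset => eta _.
rewrite (_ : [set _ | _] = [set eta : config X R | eta Cm.1 = Cm.2%:R%:E] `&`
    [set eta : config X R | {in L, forall Cm, eta Cm.1 = Cm.2%:R%:E}]).
  apply: measurableI.
    by apply: measurable_count_eq; case: (HL Cm (mem_head _ _)).
  by apply: ih => Dn inL; apply: HL; rewrite inE inL orbT.
apply/seteqP; split=> eta /=.
  by move=> H; split=> [|Dn inL]; apply: H; rewrite ?mem_head// inE inL orbT.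
by move=> [h1 h2] Dn; rewrite inE => /orP[/eqP->|/h2].
Qed.

Lemma count_events_setI : setI_closed count_events.
Proof.
move=> A B [L [HL ->]] [L' [HL' ->]]; exists (L ++ L'); split.
  by move=> Cm; rewrite mem_cat => /orP[/HL|/HL'].
apply/seteqP; split=> eta /=.
  by move=> [h1 h2] Cm; rewrite mem_cat => /orP[/h1|/h2].
by move=> H; split=> Cm inL; apply: H; rewrite mem_cat inL ?orbT.
Qed.

Local Notation cellT := (g_sigma_algebraType count_events).

Lemma measurable_cell_eval B : measurable B ->
  measurable_fun [set: cellT] (fun eta : cellT => (eta : config X R) B : \bar R).
Proof.
move=> mB.
have fin_case C : measurable C -> (alpha C < +oo)%E ->
    measurable_fun [set: cellT] (fun eta : cellT => (eta : config X R) C : \bar R).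
  move=> mC aC _ Y mY; rewrite setTI.
  pose E n : set cellT := [set eta : config X R | eta C = n%:R%:E].
  have mE n : measurable (E n).
    apply: sub_sigma_algebra; exists [:: (C, n)]; split.
      by move=> Cm; rewrite inE => /eqP ->.
    apply/seteqP; split=> eta /=; first by move=> En Cm; rewrite inE => /eqP ->.
    by move=> /(_ _ (mem_head _ _)).
  have infE : [set eta : config X R | eta C = +oo%E] = ~` (\bigcup_n E n).
    apply/seteqP; split=> eta /=; first by move=> einf [n _]; rewrite /E /= einf.
    move=> nE; have [fin|] := ltP (eta C) +oo%E; last by rewrite leye_eq => /eqP.
    by exfalso; apply: nE; exists (count C eta) => //; exact: count_finE.
  rewrite (_ : _ @^-1` _ = (\bigcup_n (E n `&` [set eta | Y (n%:R%:E)])) `|`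
     ([set eta : config X R | eta C = +oo%E] `&` [set eta | Y +oo%E])).
    have mK (P : Prop) : measurable ([set eta | P] : set cellT).
      have [HP|HP] := pselect P.
        by rewrite (_ : [set _ | _] = setT)// -subTset => eta _.
      by rewrite (_ : [set _ | _] = set0)// -subset0 => eta.
    apply: measurableU; first by apply: bigcupT_measurable => n; exact: measurableI.
    apply: measurableI => //; rewrite infE; apply: measurableC.
    exact: bigcupT_measurable.
  apply/seteqP; split=> eta /=.
    move=> YC; have [fin|] := ltP (eta C) +oo%E.
      left; exists (count C eta) => //; rewrite /E /= -count_finE//.
    by rewrite leye_eq => /eqP einf; right; rewrite einf in YC *.
  by move=> [[n _ [/= -> //]]|[-> //]].
have [F [FT ndF HF]] := (sigma_finiteP setT alpha).1 sfin.
apply: (@emeasurable_fun_cvg _ cellT R setT (fun n (eta : cellT) => (eta : config X R) (B `&` F n))).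
  move=> n; apply: fin_case; first by apply: measurableI => //; case: (HF n).
  apply: le_lt_trans (HF n).2; apply: le_measure => //; rewrite ?inE//.
  - by apply: measurableI => //; case: (HF n).
  - by case: (HF n).
move=> eta _.
suff : (fun n => (eta : config X R) (B `&` F n)) @ \oo --> (eta : config X R) (\bigcup_n (B `&` F n)).
  by rewrite -setI_bigcupr -FT setIT.
apply: nondecreasing_cvg_mu.
- by move=> n; apply: measurableI => //; case: (HF n).
- by apply: bigcupT_measurable => n; apply: measurableI => //; case: (HF n).
- by move=> m n mn; apply/subsetPset; apply: setIS; apply/subsetPset; exact: ndF.
Qed.

(** The mass of a set is the increasing limit of its masses in regions of finite
    [alpha]-mass, and a mass in such a region is a count or infinite. *)
Lemma measurable_count_events : @measurable _ (config X R) = <<s count_events>>.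
Proof.
apply/seteqP; split; last first.
  by apply: smallest_sub; [exact: sigma_algebra_measurable|exact: measurable_count_event].
apply: smallest_sub; first exact: smallest_sigma_algebra.
move=> A [B mB [Y mY <-]].
exact: (measurable_cell_eval mB measurableT mY).
Qed.

(** The events that a function does not charge form a Dynkin class. *)
Lemma integral_count_events0 (g : config X R -> R) :
  rho.-integrable setT (EFin \o g) ->
  (forall A, count_events A -> (\int[rho]_(eta in A) (g eta)%:E = 0)%E) ->
  {ae rho, forall eta, g eta = 0}.
Proof.
move=> ig g0.
have iA A : measurable A -> rho.-integrable A (EFin \o g).
  by move=> mA; apply: integrableS ig.
have H A : measurable A -> (\int[rho]_(eta in A) (g eta)%:E = 0)%E.
  rewrite measurable_count_events.
  have g0T : (\int[rho]_eta (g eta)%:E = 0)%E.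
    apply: g0; exists [::]; split=> //.
    by rewrite (_ : [set _ | _] = setT)// -subTset => eta _.
  apply: (dynkin_induction (P := fun A => (\int[rho]_(eta in A) (g eta)%:E = 0)%E)
     measurable_count_events count_events_setI) => //.
    move=> S mS S0; have := g0T; rewrite -(setUv S) integral_setU//.
    - by rewrite S0 add0e.
    - exact: measurableC.
    - by rewrite setUv; case/integrableP : ig.
    - by rewrite disj_set2E setICr.
  move=> F mF tF F0; rewrite integral_bigcup//.
    by rewrite (eq_eseriesr (fun i _ => F0 i)) eseries0.
  by apply: iA; exact: bigcupT_measurable.
have := @integral_ae_eq _ _ _ rho setT measurableT (cst 0%E) (EFin \o g) ig.
move=> /(_ (measurable_cst _)) HH.
have : ae_eq rho setT (EFin \o g) (cst 0%E).
  by apply: HH => E _ mE; rewrite [LHS](H E mE) integral0.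
by apply: filterS => eta /(_ Logic.I) /= [].
Qed.

Lemma orthogonal_polynomials0 (h : config X R -> R[i]) : sqint rho h ->
  (forall S, measurable S -> (alpha S < +oo)%E -> forall F, pol S F ->
     cintegral rho (fun eta => h eta * F eta) = 0) ->
  {ae rho, forall eta, h eta = 0}.
Proof.
move=> sqh h0; have [mh _] := sqh.
have ih : cintegrable rho h.
  have s1 : sqint rho (fun=> 1).
    split; first exact: cmeasurable_cst.
    rewrite ComplexField.Normc.normc1 expr1n integral_cst// mul1e.
    by rewrite (le_lt_trans (probability_le1 _ _))// ltry.
  have := cintegrable_dot s1 sqh.
  by rewrite (_ : (fun x => _) = h)//; apply/funext => x; rewrite conjc1 mul1r.
have key A : count_events A -> cintegral rho (fun eta => h eta * (\1_A eta : R)%:C) = 0.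
  move=> cA; have mA := measurable_count_event cA.
  have [L [HL AE]] := cA.
  (* All cells of the event lie in one region, where the previous lemma applies. *)
  pose S : set X := \big[setU/set0]_(Cm <- L) Cm.1.
  have subS : {in L, forall Cm, Cm.1 `<=` S}.
    rewrite /S; elim: (L) => [//|Dn L' ihL] Cm; rewrite inE big_cons => /orP[/eqP->|inL].
      exact: subsetUl.
    by apply: subset_trans (ihL _ inL) _; exact: subsetUr.
  have [mS aS] : measurable S /\ (alpha S < +oo)%E.
    rewrite /S; elim: (L) HL => [_|Dn L' ihL HL].
      by rewrite big_nil measure0; split=> //; exact: ltry.
    rewrite big_cons; have [m1 a1] := HL Dn (mem_head _ _).
    have [|m2 a2] := ihL; first by move=> Cm inL; apply: HL; rewrite inE inL orbT.
    split; first exact: measurableU.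
    by apply: le_lt_trans (measureU2 _ m1 m2) _; exact: lte_add_pinfty.
  have subL : sub_cells S L by move=> Cm inL; have [m1 _] := HL _ inL; split=> //; exact: subS.
  rewrite -[RHS](count_event_orthogonal mS aS p01 hrho sqh subL (h0 S mS aS) (@pol_vacuum _ X R S)).
  apply: cintegral_ae_eq.
  - by apply: cmeasurableM => //; split; [exact: measurable_indic|exact: measurable_cst].
  - apply: cmeasurableM => //; apply: cmeasurableM.
      exact: (@cmeasurable_count_event _ X R S L subL).
    exact: (pol_cmeasurable mS (@pol_vacuum _ X R S)).
  apply: filterS (pascal_fin_ae p01 hrho mS aS) => eta fin.
  congr (_ * _); rewrite /vacuum fin mulr1.
  rewrite indicE AE.
  have EL : count_event L eta = (all (fun Cm => count Cm.1 eta == Cm.2) L)%:R.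
    rewrite /count_event; elim: (L) => [|Cm L' ihL]; first by rewrite big_nil.
    by rewrite big_cons ihL /= -natrM mulnb.
  rewrite EL; case: allP => allL.
    rewrite mem_set// => Cm inL; have [m1 s1] := subL Cm inL.
    have [finC _] := count_mono mS m1 s1 fin.
    by rewrite (count_finE finC) (eqP (allL _ inL)).
  rewrite memNset// => HA; apply: allL => Cm inL /=.
  by rewrite /count HA//= natrK.
have [i1 i2] := ih.
have part (g : config X R -> R) : rho.-integrable setT (EFin \o g) ->
    (forall A, count_events A -> \int[rho]_eta (g eta * \1_A eta) = 0) ->
    {ae rho, forall eta, g eta = 0}.
  move=> ig HA; apply: (integral_count_events0 ig) => A cA.
  have mA := measurable_count_event cA; have HA0 := HA A cA.
  have := integrableS measurableT mA (@subsetT _ _) ig.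
  move=> /(integrable_fin_num mA) finA; rewrite -(fineK finA).
  apply: (congr1 EFin); apply: etrans HA0; rewrite integral_mkcond; congr fine.
  apply: eq_integral => eta _; rewrite patchE indicE /=.
  by case: ifP => _; rewrite ?mulr1 ?mulr0.
have e1 := part _ i1; have e2 := part _ i2.
have {}e1 : {ae rho, forall eta, Re (h eta) = 0}.
  apply: e1 => A /key /(congr1 (fun z : R[i] => Re z)) /= <-.
  by apply: eq_Rintegral => eta _; rewrite ReM /= mulr0 subr0.
have {}e2 : {ae rho, forall eta, Im (h eta) = 0}.
  apply: e2 => A /key /(congr1 (fun z : R[i] => Im z)) /= <-.
  by apply: eq_Rintegral => eta _; rewrite ImM /= mulr0 add0r.
by apply: filterS2 e1 e2 => eta r0 i0; apply: complex_eqP.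
Qed.

End completeness.

(** * Polynomials of configurations and their classes *)

Import (canonicals) mpoly.

Section polynomial_functions.
Context d (X : measurableType d) (R : realType).
Hypothesis msing : forall x : X, measurable [set x].
Variable alpha : {measure set X -> \bar R}.
Implicit Types (phi : X -> R[i]) (F G : config X R -> R[i]) (eta : config X R).

Let mX n (i : 'I_n) : mpoly.mpoly n R[i] := mpoly.mpolyX R[i] (mpoly.mnm1 i).

(** Substitution of disjoint blocks of variables brings two polynomials to the same
    list of test functions. *)
Lemma polynomial_fun_common F G : polynomial_fun alpha F -> polynomial_fun alpha G ->
  exists (n : nat) (P Q : mpoly.mpoly n R[i]) (phi : 'I_n -> X -> R[i]),
    [/\ (0 < n)%N, forall i, test_function alpha (phi i),
        F = (fun eta => mpoly.meval (fun i => cintegral eta (phi i)) P) &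
        G = (fun eta => mpoly.meval (fun i => cintegral eta (phi i)) Q)].
Proof.
move=> [n [P [phi [n0 tphi ->]]]] [m [Q [psi [m0 tpsi ->]]]].
pose chi (i : 'I_(n + m)) := match fintype.split i with inl j => phi j | inr j => psi j end.
exists (n + m)%N, (mpoly.comp_mpoly [tuple mX (lshift m i) | i < n] P),
  (mpoly.comp_mpoly [tuple mX (rshift n i) | i < m] Q), chi; split.
- by rewrite addn_gt0 n0.
- by move=> i; rewrite /chi; case: fintype.split.
- apply/funext => eta; rewrite mpoly.comp_mpoly_meval; apply: mpoly.meval_eq => i.
  rewrite tnth_mktuple mpoly.mevalXU /chi.
  by rewrite -[lshift m i]/(unsplit (inl i)) unsplitK.
- apply/funext => eta; rewrite mpoly.comp_mpoly_meval; apply: mpoly.meval_eq => i.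
  rewrite tnth_mktuple mpoly.mevalXU /chi.
  by rewrite -[rshift n i]/(unsplit (inr i)) unsplitK.
Qed.

Lemma polynomial_fun_lin a F G : polynomial_fun alpha F -> polynomial_fun alpha G ->
  polynomial_fun alpha (fun eta => a * F eta + G eta).
Proof.
move=> pF pG; have [n [P [Q [phi [n0 tphi -> ->]]]]] := polynomial_fun_common pF pG.
exists n, (a *: P + Q), phi; split=> //; apply/funext => eta.
by rewrite mpoly.mevalD mpoly.mevalZ.
Qed.

Lemma polynomial_fun_mul F G : polynomial_fun alpha F -> polynomial_fun alpha G ->
  polynomial_fun alpha (fun eta => F eta * G eta).
Proof.
move=> pF pG; have [n [P [Q [phi [n0 tphi -> ->]]]]] := polynomial_fun_common pF pG.
exists n, (P * Q), phi; split=> //; apply/funext => eta.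
by rewrite mpoly.mevalM.
Qed.

Lemma polynomial_fun_cintegral phi : test_function alpha phi ->
  polynomial_fun alpha (fun eta => cintegral eta phi).
Proof.
move=> tphi; exists 1%N, (mX ord0), (fun=> phi); split=> //.
by apply/funext => eta; rewrite mpoly.mevalXU.
Qed.

Lemma test_function0 : test_function alpha (fun=> 0 : R[i]).
Proof.
split; first exact: cmeasurable_cst.
  by exists 0 => x; rewrite ComplexField.Normc.normc0.
by rewrite (_ : [set _ | _] = set0) ?measure0 ?ltry// -subset0 => x /=; rewrite eqxx.
Qed.

Lemma polynomial_fun_cst a : polynomial_fun alpha (fun=> a).
Proof.
exists 1%N, (mpoly.mpolyC 1 a), (fun=> fun=> 0); split=> //.
  by move=> _; exact: test_function0.
by apply/funext => eta; rewrite mpoly.mevalC.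
Qed.

Definition finite_region (S : set X) : Prop := measurable S /\ (alpha S < +oo)%E.

Lemma finite_region0 : finite_region set0.
Proof. by split=> //; rewrite measure0 ltry. Qed.

Lemma finite_regionU S S' : finite_region S -> finite_region S' -> finite_region (S `|` S').
Proof.
move=> [m1 a1] [m2 a2]; split; first exact: measurableU.
by apply: le_lt_trans (measureU2 _ m1 m2) _; exact: lte_add_pinfty.
Qed.

Lemma test_on_sub S S' phi : S `<=` S' -> test_on S phi -> test_on S' phi.
Proof. by move=> SS' [m b z]; split=> // x nS; apply: z => /SS'. Qed.

Lemma measurable_support phi : cmeasurable phi -> measurable [set x | phi x != 0].
Proof.
move=> mphi.
have -> : [set x | phi x != 0] = ~` ((fun x => normc (phi x)) @^-1` [set 0]).
  apply/seteqP; split=> x /=; first by move=> /eqP h /ComplexField.Normc.eq0_normc.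
  by move=> h; apply/eqP => h0; apply: h; rewrite h0 ComplexField.Normc.normc0.
apply: measurableC; rewrite -[X in measurable X]setTI.
by apply: (cmeasurable_normc mphi) => //; exact: measurable_set1.
Qed.

Lemma test_function_on phi : test_function alpha phi ->
  exists S, finite_region S /\ test_on S phi.
Proof.
move=> [mphi bphi aphi]; exists [set x | phi x != 0]; split; first split=> //.
  exact: measurable_support.
by split=> // x /= /negP; rewrite negbK => /eqP.
Qed.

Lemma test_on_function S phi : finite_region S -> test_on S phi -> test_function alpha phi.
Proof.
move=> [mS aS] [mphi bphi zphi]; split=> //.
apply: le_lt_trans aS; apply: le_measure; rewrite ?inE//.
  exact: measurable_support.
by move=> x /= /eqP h; apply: contrapT => /zphi.
Qed.

Lemma tests_on n (phi : 'I_n -> X -> R[i]) : (forall i, test_function alpha (phi i)) ->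
  exists S, finite_region S /\ forall i, test_on S (phi i).
Proof.
elim: n phi => [|n ih] phi tphi.
  by exists set0; split; [split=> //; rewrite measure0 ltry|case].
have [S [fS HS]] := ih _ (fun i => tphi (lift ord0 i)).
have [S' [fS' HS']] := test_function_on (tphi ord0).
exists (S `|` S'); split; first exact: finite_regionU.
move=> i; case: (unliftP ord0 i) => [j|] ->.
  by apply: test_on_sub (HS j); exact: subsetUl.
by apply: test_on_sub HS'; exact: subsetUr.
Qed.

(** The bridge between the two descriptions of the domain: away from the
    configurations with infinitely many points in a large enough region, the
    polynomial functions are those built from the vacuum. *)
Lemma polynomial_fun_pol F : polynomial_fun alpha F ->
  exists S0, finite_region S0 /\ forall S, finite_region S -> S0 `<=` S ->
    pol S (fun eta => vacuum S eta * F eta).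
Proof.
move=> [n [P [phi [_ tphi ->]]]]; have [S0 [fS0 HS0]] := tests_on tphi.
exists S0; split=> // S [mS aS] S0S; apply: (@pol_meval _ _ _ S).
by move=> i; exact: test_on_sub (HS0 i).
Qed.

Lemma pol_polynomial_fun S F : finite_region S -> pol S F ->
  exists2 F', polynomial_fun alpha F' & forall eta, (eta S < +oo)%E -> F' eta = F eta.
Proof.
move=> fS; elim=> {F} [|phi F tphi _ [F' pF' H]|a F G _ [F' pF' H] _ [G' pG' H']].
- exists (fun=> 1); first exact: polynomial_fun_cst.
  by move=> eta fin; rewrite /vacuum fin.
- exists (fun eta => cintegral eta phi * F' eta).
    apply: polynomial_fun_mul => //; apply: polynomial_fun_cintegral.
    exact: test_on_function tphi.
  by move=> eta fin; rewrite H.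
- exists (fun eta => a * F' eta + G' eta); first exact: polynomial_fun_lin.
  by move=> eta fin; rewrite H// H'.
Qed.

End polynomial_functions.

(** * The induced operators *)

Section sl2_coefficients.
Context (K : numFieldType).
Variables (r U : K).
Hypotheses (r0 : r != 0) (UE : U * (1 - r ^+ 2) = r) (r1 : 1 - r ^+ 2 != 0).

Let UE' : U = r / (1 - r ^+ 2). Proof. exact: (canRL (mulfK r1)). Qed.

Let vp : K * K * K := (U * r ^+ 2, U * (r ^+ 2)^-1, - (2 * U)).
Let vm : K * K * K := (U, U, - (2 * U)).
Let v0 : K * K * K := (- (U * r), - (U * r^-1), U * (r + r^-1)).

(** The normalization [U (1 - r ^+ 2) = r] is [c = r^-1 - r] with [U] the inverse
    of [c]. *)
Lemma sl2_mp : sl2_bracket vm vp = (2 * v0.1.1, 2 * v0.1.2, 2 * v0.2).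
Proof. by rewrite /vp /vm /v0 /sl2_bracket /= UE'; congr (_, _, _); field; rewrite ?r0 ?r1. Qed.

Lemma sl2_0p : sl2_bracket v0 vp = vp.
Proof. by rewrite /vp /vm /v0 /sl2_bracket /= UE'; congr (_, _, _); field; rewrite ?r0 ?r1. Qed.

Lemma sl2_0m : sl2_bracket v0 vm = (- vm.1.1, - vm.1.2, - vm.2).
Proof. by rewrite /vp /vm /v0 /sl2_bracket /= UE'; congr (_, _, _); field; rewrite ?r0 ?r1. Qed.

Lemma sl2_adjoint_0 : v0 = (r ^+ 2 * v0.1.2, (r ^+ 2)^-1 * v0.1.1, v0.2).
Proof. by rewrite /v0 /=; congr (_, _, _); field; rewrite ?r0. Qed.

Lemma sl2_adjoint_p : vm = (r ^+ 2 * vp.1.2, (r ^+ 2)^-1 * vp.1.1, vp.2).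
Proof. by rewrite /vp /vm /=; congr (_, _, _); field; rewrite ?r0. Qed.

Lemma sl2_self (v : K * K * K) : sl2_bracket v v = (0, 0, 0).
Proof. by rewrite /sl2_bracket /=; congr (_, _, _); ring. Qed.

(** The multiplication generator is recovered from the three currents. *)
Lemma sl2_cartan (A L C : K) :
  U * C = U ^+ 2 * ((vp.1.1 * A + vp.1.2 * L + vp.2 * C) +
    (vm.1.1 * A + vm.1.2 * L + vm.2 * C) +
    (r + r^-1) * (v0.1.1 * A + v0.1.2 * L + v0.2 * C)).
Proof. by rewrite /vp /vm /v0 /= UE'; field; rewrite ?r0 ?r1. Qed.

End sl2_coefficients.

Lemma transpose_coeff (K : fieldType) (P v1 v2 v3 A B C : K) : P != 0 ->
  v1 * A + v2 * (P * B) + v3 * C = P * v2 * B + P^-1 * v1 * (P * A) + v3 * C.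
Proof. by move=> P0; field. Qed.

Section induced.
Context d (X : measurableType d) (R : realType).
Hypothesis msing : forall x : X, measurable [set x].
Variables (alpha : {measure set X -> \bar R}).
Variables (p : R) (rho : probability (config X R) R).
Hypotheses (p01 : 0 < p < 1) (hrho : pascal_process p alpha rho).
Implicit Types (phi theta : X -> R[i]) (F G : config X R -> R[i]) (eta : config X R).
Implicit Types (h g : L2 rho) (v w : R[i] * R[i] * R[i]).

Local Notation finite_region := (finite_region alpha).
Local Notation cur := (pol_current alpha).
Local Notation dom := (polynomial_domain alpha rho).

Lemma pol_sqint S F : finite_region S -> pol S F -> sqint rho F.
Proof.
move=> [mS aS] pF; have mF := pol_cmeasurable mS pF; split=> //.
have [K [m [K0 HK]]] := pol_growth mS pF.
have := integrable_scale (K ^+ 2) (growth_integrable mS aS p01 hrho (m + m)).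
have mg := measurable_growth mS (m + m).
move=> /integrableP[_]; apply: le_lt_trans; apply: ge0_le_integral => //.
- by move=> eta _; rewrite lee_fin sqr_ge0.
- exact: measurable_normc_sqr.
- apply: measurableT_comp; first exact: abse_measurable.
  by apply/measurable_EFinP; apply: measurable_funM; [exact: measurable_cst|exact: mg].
move=> eta _ /=; rewrite lee_fin; apply: le_trans (ler_norm _).
apply: (@le_trans _ _ ((K * growth S m eta) ^+ 2)).
  by rewrite lerXn2r ?nnegrE ?normc_ge0 ?mulr_ge0 ?growth_ge0.
rewrite exprMn ler_wpM2l ?sqr_ge0// /growth; case: ifP => _; last by rewrite expr0n.
by rewrite -exprM muln2 addnn.
Qed.

Lemma pol_class S F : finite_region S -> pol S F -> exists h : L2 rho, L2_class_of F h.
Proof. by move=> fS pF; apply: sqint_class; exact: pol_sqint pF. Qed.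

Lemma region_ae S : finite_region S -> {ae rho, forall eta : config X R, (eta S < +oo)%E}.
Proof. by move=> [mS aS]; exact: (pascal_fin_ae p01 hrho mS aS). Qed.

Lemma vacuum_ae S F : finite_region S -> {ae rho, forall eta, F eta = vacuum S eta * F eta}.
Proof.
move=> fS; apply: filterS (region_ae fS) => eta fin.
by rewrite /vacuum fin mul1r.
Qed.

Lemma polynomial_class F : polynomial_fun alpha F -> exists h : L2 rho, L2_class_of F h.
Proof.
move=> /polynomial_fun_pol[S [fS /(_ S fS (@subset_refl _ S)) pF]].
have [h ch] := pol_class fS pF; exists h; apply: L2_class_ae ch.
by apply: filterS (vacuum_ae F fS) => eta /esym.
Qed.

Lemma domain_pol h S0 : dom h -> finite_region S0 ->
  exists S F, [/\ finite_region S, S0 `<=` S, pol S F & L2_class_of F h].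
Proof.
move=> [F pF cF] fS0; have [S1 [fS1 H]] := polynomial_fun_pol pF.
have fS := finite_regionU fS0 fS1.
exists (S0 `|` S1), (fun eta => vacuum (S0 `|` S1) eta * F eta); split.
- exact: fS.
- exact: subsetUl.
- by apply: H => //; exact: subsetUr.
- by apply: L2_class_ae cF; exact: vacuum_ae.
Qed.

Lemma domain_of_pol S F h : finite_region S -> pol S F -> L2_class_of F h -> dom h.
Proof.
move=> fS pF cF; have [F' pF' H] := pol_polynomial_fun fS pF.
exists F' => //; apply: L2_class_ae cF; apply: filterS (region_ae fS) => eta fin.
by rewrite H.
Qed.

Lemma pol_cur S v phi F : finite_region S -> test_on S phi -> pol S F -> pol S (cur S v phi F).
Proof.
by move=> [mS aS] tphi pF; apply: (ca_current (pol_current_action msing mS aS)).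
Qed.

Definition transpose v : R[i] * R[i] * R[i] := (p%:C * v.1.2, (p%:C)^-1 * v.1.1, v.2).

(** Transposition exchanges raising and lowering up to the factor [p] and fixes
    multiplications. *)
Lemma pairing_current S v phi F G : finite_region S -> test_on S phi -> pol S F -> pol S G ->
  pairing rho F (cur S v phi G) = pairing rho (cur S (transpose v) phi F) G.
Proof.
move=> fS tphi pF pG; have [mS aS] := fS.
have ca := pol_current_action msing mS aS.
have lin3 a b c A B C D : pol S A -> pol S B -> pol S C -> pol S D ->
    pairing rho D (a *: A + b *: B + c *: C) =
    a * pairing rho D A + b * pairing rho D B + c * pairing rho D C.
  move=> pA pB pC pD; rewrite -addrA.
  rewrite (pairing_lin mS aS p01 hrho)//; last by apply: pol_lin => //; exact: polZ.
  rewrite (pairing_lin mS aS p01 hrho)//; last exact: polZ.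
  rewrite -[c *: C]addr0 (pairing_lin mS aS p01 hrho)//; last exact: pol0.
  have -> : pairing rho D 0 = 0.
    rewrite /pairing /expect -[RHS](@cintegral0 _ (config X R) R rho).
    by apply: eq_cintegral => eta; rewrite mulr0.
  by rewrite addr0 addrA.
have pu H : pol S H -> pol S (raise alpha S phi H) by exact: (pol_raise mS aS tphi).
have pd H : pol S H -> pol S (lower S phi H) by exact: (pol_lower msing mS tphi).
have pc H : pol S H ->
  pol S (cartan (@number _ X R) (fun phi => 2^-1 * cintegral alpha phi) phi H).
  by move=> pH; exact: (ca_cartan ca).
have low A B : pol S A -> pol S B ->
    pairing rho A (lower S phi B) = p%:C * pairing rho (raise alpha S phi A) B.
  by move=> pA pB; exact: (pairing_lower msing mS aS p01 hrho).
have p0 : p%:C != 0 :> R[i].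
  by rewrite eq_complex /= eqxx andbT gt_eqF//; case/andP: p01.
rewrite [in RHS]pairingC /pol_current /current !lin3//; [|by [exact: pu|exact: pd|exact: pc]..].
rewrite (low F G)// (low G F)//.
rewrite (pairingC rho (raise alpha S phi F) G) (pairingC rho (raise alpha S phi G) F).
have -> : pairing rho F (cartan (@number _ X R) (fun phi => 2^-1 * cintegral alpha phi) phi G) =
    pairing rho G (cartan (@number _ X R) (fun phi => 2^-1 * cintegral alpha phi) phi F).
  rewrite /pairing; congr expect; apply/funext => eta.
  rewrite /cartan.
  rewrite -[LHS]/(F eta * (cintegral eta phi * G eta + 2^-1 * cintegral alpha phi * G eta)).
  rewrite -[RHS]/(G eta * (cintegral eta phi * F eta + 2^-1 * cintegral alpha phi * F eta)).
  ring.
exact: transpose_coeff.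
Qed.

(** Hence a current maps null functions to null functions: its values are
    orthogonal to the domain and belong to it. *)
Lemma current_null S v phi F : finite_region S -> test_on S phi -> pol S F ->
  {ae rho, forall eta, F eta = 0} -> {ae rho, forall eta, cur S v phi F eta = 0}.
Proof.
move=> fS tphi pF F0; have [mS aS] := fS.
set W := cur S v phi F; have pW : pol S W by exact: pol_cur.
have pcW := pol_conj mS pW.
have mW := pol_cmeasurable mS pW.
have [w cw] := pol_class fS pW.
have w0 : L2dot rho w w = 0.
  rewrite (L2dotE mW mW cw cw).
  rewrite -[LHS]/(pairing rho (fun eta => conjc (W eta)) W) pairing_current//.
  rewrite /pairing /expect -[RHS](@cintegral0 _ (config X R) R rho).
  apply: cintegral_ae_eq.
  - apply: cmeasurableM; last exact: pol_cmeasurable pF.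
    by apply: (pol_cmeasurable mS); exact: pol_cur.
  - exact: cmeasurable_cst.
  - by apply: filterS F0 => eta ->; rewrite mulr0.
have wE : w = 0.
  apply/eqP; apply: contraT => /(@L2dot_definite _ _ _ rho).
  by rewrite w0 ltxx.
have := L2_class0 (rho : {measure set (config X R) -> \bar R}).
by rewrite -wE; apply: filterS2 cw => eta -> ->.
Qed.

Section one_operator.
Variable K : (X -> R[i]) -> (config X R -> R[i]) -> config X R -> R[i].
Variables (v : R[i] * R[i] * R[i]) (tau : (X -> R[i]) -> X -> R[i]).

(** The formula [K] computes the current of [v] and [tau phi] at every configuration
    finite in a region; [tau] is the identity, or conjugation for the annihilation
    operators. *)
Definition realizes : Prop :=
  (forall S phi, test_on S phi -> test_on S (tau phi)) /\
  forall S phi F F' eta, finite_region S -> test_on S phi -> pol S F -> (eta S < +oo)%E ->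
    (forall eta, (eta S < +oo)%E -> F' eta = F eta) -> K phi F' eta = cur S v (tau phi) F eta.

(** The image of a class is the class of the image of some polynomial
    representative; the lemmas below show that the choice does not matter. *)
Definition class_operator phi (h : L2 rho) : L2 rho :=
  xget 0 [set g | exists F, [/\ polynomial_fun alpha F, L2_class_of F h & L2_class_of (K phi F) g]].

Hypothesis HK : realizes.

(** Any two representatives are polynomials in a common region, where their
    difference is null and so has a null image. *)
Lemma class_operator_pol S phi F h : finite_region S -> test_on S phi -> pol S F ->
  L2_class_of F h -> L2_class_of (cur S v (tau phi) F) (class_operator phi h).
Proof.
move=> fS tphi pF cF; have [Ht Hc] := HK.
have aeK S1 G G' : finite_region S1 -> test_on S1 phi -> pol S1 G ->
    (forall eta, (eta S1 < +oo)%E -> G' eta = G eta) ->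
    {ae rho, forall eta, K phi G' eta = cur S1 v (tau phi) G eta}.
  by move=> f1 t1 pG GG'; apply: filterS (region_ae f1) => eta fin; exact: Hc.
have [F1 pF1 H1] := pol_polynomial_fun fS pF.
have cF1 : L2_class_of F1 h.
  by apply: L2_class_ae cF; apply: filterS (region_ae fS) => eta fin; rewrite H1.
have aeF1 := aeK S F F1 fS tphi pF H1.
have [g0 cg0] : exists g0 : L2 rho, L2_class_of (K phi F1) g0.
  have [g0 cg0] := pol_class fS (pol_cur v fS (Ht _ _ tphi) pF).
  by exists g0; apply: L2_class_ae cg0; apply: filterS aeF1 => eta ->.
have : [set g | exists F, [/\ polynomial_fun alpha F, L2_class_of F h & L2_class_of (K phi F) g]]
    (class_operator phi h).
  by apply: (xgetPex 0); exists g0, F1.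
move=> [F2 [pF2 cF2 cK2]].
apply: L2_class_ae cK2.
have [S1 [f1 HS1]] := polynomial_fun_pol pF1.
have [S2 [f2 HS2]] := polynomial_fun_pol pF2.
(* In the common region [S'] both representatives are polynomials. *)
have f12 := finite_regionU f1 f2; have fS' := finite_regionU fS f12.
set S' := S `|` (S1 `|` S2) in fS'.
have p1 : pol S' (fun eta => vacuum S' eta * F1 eta).
  by apply: HS1 => // x S1x; right; left.
have p2 : pol S' (fun eta => vacuum S' eta * F2 eta).
  by apply: HS2 => // x S2x; right; right.
have t' : test_on S' phi by apply: test_on_sub tphi; exact: subsetUl.
have vac G eta : (eta S' < +oo)%E -> G eta = vacuum S' eta * G eta.
  by move=> fin; rewrite /vacuum fin mul1r.
have e1 := aeK S' _ F1 fS' t' p1 (vac F1).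
have e2 := aeK S' _ F2 fS' t' p2 (vac F2).
have p21 : pol S' (-1 *: (fun eta => vacuum S' eta * F2 eta) + (fun eta => vacuum S' eta * F1 eta)).
  exact: pol_lin.
have n21 : {ae rho, forall eta,
    (-1 *: (fun eta => vacuum S' eta * F2 eta) + (fun eta => vacuum S' eta * F1 eta)) eta = 0}.
  apply: filterS2 cF1 cF2 => eta h1 h2.
  rewrite -[LHS]/(-1 * (vacuum S' eta * F2 eta) + vacuum S' eta * F1 eta).
  by rewrite -h1 -h2 mulN1r addNr.
have := current_null v fS' (Ht _ _ t') p21 n21.
have [mS' aS'] := fS'.
have LE : cur S' v (tau phi) (-1 *: (fun eta => vacuum S' eta * F2 eta) +
     (fun eta => vacuum S' eta * F1 eta)) =
    -1 *: cur S' v (tau phi) (fun eta => vacuum S' eta * F2 eta) +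
    cur S' v (tau phi) (fun eta => vacuum S' eta * F1 eta).
  exact: (current_lin (pol_current_action msing mS' aS') v (Ht _ _ t') (-1) p2 p1).
rewrite LE.
have a0 := aeK S F F1 fS tphi pF H1.
have a1 : {ae rho, forall eta, cur S v (tau phi) F eta =
    cur S' v (tau phi) (fun eta => vacuum S' eta * F1 eta) eta}.
  by apply: filterS2 a0 e1 => eta <- <-.
apply: filterS3 a1 e2 => eta a1 e2.
rewrite -[LHS]/(-1 * cur S' v (tau phi) (fun eta => vacuum S' eta * F2 eta) eta
  + cur S' v (tau phi) (fun eta => vacuum S' eta * F1 eta) eta).
by rewrite -e2 -a1 mulN1r addrC => /eqP; rewrite subr_eq0 => /eqP ->.
Qed.

End one_operator.
End induced.

(** * The Fock representation *)

Section fock_fields.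
Context d (X : measurableType d) (R : realType).
Hypothesis msing : forall x : X, measurable [set x].
Variables (alpha : {measure set X -> \bar R}).
Variables (p : R) (rho : probability (config X R) R).
Hypotheses (p01 : 0 < p < 1) (hrho : pascal_process p alpha rho).
Implicit Types (phi theta : X -> R[i]) (F G : config X R -> R[i]) (eta : config X R).
Implicit Types (f g h : L2 rho) (v w : R[i] * R[i] * R[i]) (a c : R[i]).
Implicit Types (K : (X -> R[i]) -> (config X R -> R[i]) -> config X R -> R[i]).
Implicit Types (tau : (X -> R[i]) -> X -> R[i]).

Local Notation finite_region := (finite_region alpha).
Local Notation cur := (pol_current alpha).
Local Notation dom := (polynomial_domain alpha rho).
Local Notation ok := (test_function alpha).
Local Notation realizes := (realizes alpha).
Local Notation op := (class_operator alpha (rho := rho)).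
Local Notation conjf phi := (fun x => conjc (phi x)).

Lemma test_function_lin a phi theta : ok phi -> ok theta -> ok (a *: phi + theta).
Proof.
move=> /test_function_on[S1 [f1 t1]] /test_function_on[S2 [f2 t2]].
apply: (test_on_function (finite_regionU f1 f2)); apply: test_onD.
  by apply: test_onZ; apply: test_on_sub t1; exact: subsetUl.
by apply: test_on_sub t2; exact: subsetUr.
Qed.

Lemma test_function_mul phi theta : ok phi -> ok theta -> ok (fun x => phi x * theta x).
Proof.
move=> /test_function_on[S1 [f1 t1]] /test_function_on[S2 [f2 t2]].
apply: (test_on_function (finite_regionU f1 f2)); apply: test_onMt.
  by apply: test_on_sub t1; exact: subsetUl.
by apply: test_on_sub t2; exact: subsetUr.
Qed.

Lemma test_function_conj phi : ok phi -> ok (conjf phi).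
Proof.
by move=> /test_function_on[S [fS tS]]; apply: (test_on_function fS); exact: test_on_conj.
Qed.

(** A common region serves for finitely many polynomials and test functions. *)
Lemma domain_class f g phi theta : dom f -> dom g -> ok phi -> ok theta ->
  exists S F G, [/\ finite_region S, test_on S phi /\ test_on S theta, pol S F /\ pol S G,
    L2_class_of F f & L2_class_of G g].
Proof.
move=> [F pF cF] [G pG cG] /test_function_on[S1 [f1 t1]] /test_function_on[S2 [f2 t2]].
have [S3 [f3 H3]] := polynomial_fun_pol pF; have [S4 [f4 H4]] := polynomial_fun_pol pG.
have fS := finite_regionU (finite_regionU f1 f2) (finite_regionU f3 f4).
set S := _ `|` _ in fS.
exists S, (fun eta => vacuum S eta * F eta), (fun eta => vacuum S eta * G eta); split.
- exact: fS.
- split; [apply: test_on_sub t1|apply: test_on_sub t2]; move=> x Sx.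
    by left; left.
  by left; right.
- split; [apply: H3 => // x Sx|apply: H4 => // x Sx].
    by right; left.
  by right; right.
- by apply: L2_class_ae cF; exact: (vacuum_ae p01 hrho).
- by apply: L2_class_ae cG; exact: (vacuum_ae p01 hrho).
Qed.

Lemma op_class K v tau S phi F h : realizes K v tau -> finite_region S -> test_on S phi ->
  pol S F -> L2_class_of F h -> L2_class_of (cur S v (tau phi) F) (op K phi h).
Proof. by move=> HK fS tphi pF cF; exact: (class_operator_pol msing p01 hrho HK). Qed.

Lemma op_dom K v tau phi h : realizes K v tau -> ok phi -> dom h -> dom (op K phi h).
Proof.
move=> HK okphi dh.
have [S [F [G [fS [tphi _] [pF _] cF _]]]] := domain_class dh dh okphi okphi.
apply: (domain_of_pol p01 hrho fS _ (op_class HK fS tphi pF cF)).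
by apply: (pol_cur msing v fS _ pF); case: HK => + _; apply.
Qed.

Lemma op_lin K v tau phi a f g : realizes K v tau -> ok phi -> dom f -> dom g ->
  op K phi (a *: f + g) = a *: op K phi f + op K phi g.
Proof.
move=> HK okphi df dg.
have [S [F [G [fS [tphi _] [pF pG] cF cG]]]] := domain_class df dg okphi okphi.
have pFG : pol S (a *: F + G) by exact: pol_lin.
have c1 := op_class HK fS tphi pFG (L2_class_lin a cF cG).
have c2 := L2_class_lin a (op_class HK fS tphi pF cF) (op_class HK fS tphi pG cG).
apply: L2_class_eq c1 _; have [mS aS] := fS.
have tt : test_on S (tau phi) by case: HK => + _; apply.
have LE := current_lin (pol_current_action msing mS aS) v tt a pF pG.
by rewrite [cur S v (tau phi) (a *: F + G)]LE.
Qed.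

Lemma op_arg_lin K v tau a a' phi theta f : realizes K v tau -> ok phi -> ok theta -> dom f ->
  tau (a *: phi + theta) = a' *: tau phi + tau theta ->
  op K (a *: phi + theta) f = a' *: op K phi f + op K theta f.
Proof.
move=> HK okphi oktheta df tauE; have okl := test_function_lin a okphi oktheta.
have [S [F [_ [fS [tphi ttheta] [pF _] cF _]]]] := domain_class df df okphi oktheta.
have [mS aS] := fS.
have tl : test_on S (a *: phi + theta) by apply: test_onD => //; exact: test_onZ.
have c1 := op_class HK fS tl pF cF.
have c2 := L2_class_lin a' (op_class HK fS tphi pF cF) (op_class HK fS ttheta pF cF).
apply: L2_class_eq c1 _; rewrite tauE.
have [t1 t2] : test_on S (tau phi) /\ test_on S (tau theta) by case: HK => H _; split; apply: H.
by rewrite (current_test_lin msing mS aS v a' t1 t2 pF).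
Qed.

Lemma op_bracket K K' K'' v w k tau tau' tau'' c phi theta chi f :
  realizes K v tau -> realizes K' w tau' -> realizes K'' k tau'' ->
  sl2_bracket v w = (c * k.1.1, c * k.1.2, c * k.2) ->
  (fun x => tau phi x * tau' theta x) = tau'' chi ->
  (forall S, test_on S phi -> test_on S theta -> test_on S chi) ->
  ok phi -> ok theta -> dom f ->
  op K phi (op K' theta f) - op K' theta (op K phi f) = c *: op K'' chi f.
Proof.
move=> HK HK' HK'' vw tauE tchi okphi oktheta df.
have [S [F [_ [fS [tphi ttheta] [pF _] cF _]]]] := domain_class df df okphi oktheta.
have [mS aS] := fS; have ca := pol_current_action msing mS aS.
have t1 : test_on S (tau phi) by case: HK => + _; apply.
have t2 : test_on S (tau' theta) by case: HK' => + _; apply.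
have c1 := op_class HK fS tphi pF cF.
have c2 := op_class HK' fS ttheta pF cF.
have c12 := op_class HK fS tphi (pol_cur msing w fS t2 pF) c2.
have c21 := op_class HK' fS ttheta (pol_cur msing v fS t1 pF) c1.
have c3 := L2_class_scale c (op_class HK'' fS (tchi _ tphi ttheta) pF cF).
apply: L2_class_eq (L2_classB c12 c21) _.
apply: L2_class_ae c3; apply: aeW => eta.
have := current_bracket ca v w t1 t2 pF; rewrite vw => /(congr1 (fun F => F eta)).
rewrite tauE => E.
rewrite -[RHS]/((cur S v (tau phi) (cur S w (tau' theta) F) -
  cur S w (tau' theta) (cur S v (tau phi) F)) eta).
rewrite [RHS]E -[X in _ = X]/(cur S _ _ _ eta) !pol_currentE /=.
by rewrite !mulrDr !mulrA.
Qed.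

Lemma op_commute K v tau : realizes K v tau -> commute_on alpha dom (op K).
Proof.
move=> HK phi theta f okphi oktheta df.
have [S [F [_ [fS [tphi ttheta] [pF _] cF _]]]] := domain_class df df okphi oktheta.
have [mS aS] := fS; have ca := pol_current_action msing mS aS.
have t1 : test_on S (tau phi) by case: HK => + _; apply.
have t2 : test_on S (tau theta) by case: HK => + _; apply.
have c1 := op_class HK fS tphi pF cF.
have c2 := op_class HK fS ttheta pF cF.
have c12 := op_class HK fS tphi (pol_cur msing v fS t2 pF) c2.
have c21 := op_class HK fS ttheta (pol_cur msing v fS t1 pF) c1.
apply: L2_class_eq (L2_classB c12 c21) _.
apply: L2_class_ae (L2_class0 rho); apply: aeW => eta.
have := current_bracket ca v v t1 t2 pF; rewrite sl2_self => /(congr1 (fun F => F eta)) E.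
rewrite -[RHS]/((cur S v (tau phi) (cur S v (tau theta) F) -
  cur S v (tau theta) (cur S v (tau phi) F)) eta).
by rewrite [RHS]E -[RHS]/(cur S _ _ _ eta) pol_currentE /= !mul0r !addr0.
Qed.

(** Conjugation turns the Hermitian product into the bilinear pairing, for which the
    adjoint is the transpose. *)
Lemma op_adjoint K K' v w tau tau' phi phi' f g :
  realizes K v tau -> realizes K' w tau' -> vconj w = transpose p v ->
  conjf (tau' phi') = tau phi -> (forall S, test_on S phi -> test_on S phi') ->
  ok phi -> dom f -> dom g ->
  L2dot rho f (op K phi g) = L2dot rho (op K' phi' f) g.
Proof.
move=> HK HK' vw tauE tphi' okphi df dg.
have [S [F [G [fS [tphi _] [pF pG] cF cG]]]] := domain_class df dg okphi okphi.
have [mS aS] := fS.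
have t1 : test_on S (tau phi) by case: HK => + _; apply.
have t2 : test_on S (tau' phi') by case: HK' => + _; apply; exact: tphi'.
have c1 := op_class HK fS tphi pG cG.
have c2 := op_class HK' fS (tphi' _ tphi) pF cF.
have p1 := pol_cur msing v fS t1 pG; have p2 := pol_cur msing w fS t2 pF.
rewrite (L2dotE (pol_cmeasurable mS pF) (pol_cmeasurable mS p1) cF c1).
rewrite (L2dotE (pol_cmeasurable mS p2) (pol_cmeasurable mS pG) c2 cG).
have pcF := pol_conj mS pF.
rewrite -[LHS]/(pairing rho (conjf F) (cur S v (tau phi) G)).
rewrite (pairing_current msing p01 hrho v fS t1 pcF pG).
apply: eq_cintegral => eta; congr (_ * _).
by rewrite (conj_current msing mS aS w eta t2 pF) vw tauE.
Qed.

Lemma op_induced K v tau : realizes K v tau -> induced_operators alpha K (op K).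
Proof.
move=> HK phi F h okphi pF cF.
have [S0 [f0 t0]] := test_function_on okphi; have [S1 [f1 H1]] := polynomial_fun_pol pF.
have fS := finite_regionU f0 f1; set S := _ `|` _ in fS.
have tphi : test_on S phi by apply: test_on_sub t0; exact: subsetUl.
have pF' : pol S (fun eta => vacuum S eta * F eta) by apply: H1 => //; exact: subsetUr.
have cF' : L2_class_of (fun eta => vacuum S eta * F eta) h.
  by apply: L2_class_ae cF; exact: (vacuum_ae p01 hrho).
apply: L2_class_ae (op_class HK fS tphi pF' cF').
apply: filterS (region_ae p01 hrho fS) => eta fin.
case: HK => _ HK; rewrite (HK S phi (fun eta => vacuum S eta * F eta) F eta)//.
by move=> eta' fin'; rewrite /vacuum fin' mul1r.
Qed.

Lemma domain_subspace : linear_subspace dom.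
Proof.
split; first by exists (fun=> 0); [exact: polynomial_fun_cst|exact: L2_class0].
move=> a f g [F pF cF] [G pG cG]; exists (fun eta => a * F eta + G eta).
  exact: polynomial_fun_lin.
exact: L2_class_lin.
Qed.

Lemma realizes_Kplus : realizes (Kplus alpha p) (kplus p) id.
Proof. by split=> // S phi F F' eta [mS aS] *; exact: Kplus_current. Qed.

Lemma realizes_Kzero : realizes (Kzero alpha p) (kzero p) id.
Proof. by split=> // S phi F F' eta [mS aS] *; exact: Kzero_current. Qed.

Lemma realizes_Kminus : realizes (Kminus alpha p) (kminus p) (fun phi => conjf phi).
Proof.
split=> [S phi|S phi F F' eta [mS aS] *]; first exact: test_on_conj.
exact: Kminus_current.
Qed.

End fock_fields.

Section linear_spans.
Context (R : realType) (H : lmodType R[i]).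
Implicit Types (V : set H).

Lemma linear_span_sub V : V `<=` linear_span V.
Proof.
by move=> h Vh; exists 1%N, (fun=> 1), (fun=> h); split=> //; rewrite big_ord1 scale1r.
Qed.

Lemma linear_span_subspace V : linear_subspace (linear_span V).
Proof.
split; first by exists 0%N, (fun=> 0), (fun=> 0); split; [case|rewrite big_ord0].
move=> c f g [m [a [v [Vv ->]]]] [n [b [w [Vw ->]]]].
exists (m + n)%N, (fun i => match fintype.split i with inl j => c * a j | inr j => b j end),
  (fun i => match fintype.split i with inl j => v j | inr j => w j end); split.
  by move=> i; case: fintype.split.
rewrite big_split_ord scaler_sumr; congr (_ + _); apply: eq_bigr => i _.
  by rewrite -[lshift n i]/(unsplit (inl i)) unsplitK scalerA.
by rewrite -[rshift m i]/(unsplit (inr i)) unsplitK.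
Qed.


Lemma subspaceZ V a h : linear_subspace V -> V h -> V (a *: h).
Proof. by move=> [V0 VL] Vh; rewrite -[_ *: _]addr0; exact: VL. Qed.

Lemma subspaceD V f g : linear_subspace V -> V f -> V g -> V (f + g).
Proof. by move=> [V0 VL] Vf Vg; rewrite -[f]scale1r; exact: VL. Qed.

Lemma linear_span_min V V' : V `<=` V' -> linear_subspace V' -> linear_span V `<=` V'.
Proof.
move=> VV' sV' h [m [a [v [Vv ->]]]]; apply: (big_ind V').
- by case: sV'.
- by move=> f g; exact: subspaceD.
- by move=> i _; apply: subspaceZ => //; exact: VV'.
Qed.

End linear_spans.

Section fock_assembly.
Context d (X : measurableType d) (R : realType).
Hypothesis msing : forall x : X, measurable [set x].
Variables (alpha : {measure set X -> \bar R}).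
Hypothesis sfin : sigma_finite [set: X] alpha.
Variables (p : R) (rho : probability (config X R) R).
Hypotheses (p01 : 0 < p < 1) (hrho : pascal_process p alpha rho).
Implicit Types (phi theta : X -> R[i]) (F G : config X R -> R[i]) (eta : config X R).
Implicit Types (f g h : L2 rho).

Local Notation finite_region := (finite_region alpha).
Local Notation cur := (pol_current alpha).
Local Notation dom := (polynomial_domain alpha rho).
Local Notation ok := (test_function alpha).
Local Notation conjf phi := (fun x => conjc (phi x)).
Local Notation kp := (class_operator alpha (rho := rho) (Kplus alpha p)).
Local Notation k0 := (class_operator alpha (rho := rho) (Kzero alpha p)).
Local Notation km := (class_operator alpha (rho := rho) (Kminus alpha p)).

Let r : R[i] := (Num.sqrt p)%:C.
Let U : R[i] := (su11_c p)^-1%:C.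

Let Rp := realizes_Kplus msing alpha p.
Let Rm := realizes_Kminus msing alpha p.
Let R0 := realizes_Kzero msing alpha p01.

Let r_neq0 : r != 0.
Proof. by rewrite /r eq_complex /= eqxx andbT gt_eqF// sqrtp_gt0. Qed.

Let r2E : r ^+ 2 = p%:C.
Proof. by rewrite /r -rmorphXn /= sqrtp_sqr. Qed.

Let r2_neq1 : 1 - r ^+ 2 != 0.
Proof.
rewrite r2E -[1](rmorph1 (real_complex R)) -rmorphB eq_complex /= eqxx andbT.
by rewrite gt_eqF// subr_gt0; case/andP: p01.
Qed.

Let UE : U * (1 - r ^+ 2) = r.
Proof.
rewrite r2E -[1](rmorph1 (real_complex R)) -rmorphB -rmorphM /=; congr (_%:C).
rewrite su11_cE// invf_div mulrVK// unitfE gt_eqF// subr_gt0.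
by case/andP: p01.
Qed.

Let kplusE : kplus p = (U * r ^+ 2, U * (r ^+ 2)^-1, - (2 * U)).
Proof. by rewrite r2E /kplus -/U fmorphV. Qed.

Let kzeroE : kzero p = (- (U * r), - (U * r^-1), U * (r + r^-1)).
Proof. by rewrite /kzero -/U rmorphD /= fmorphV. Qed.

Let bracket_mp : sl2_bracket (kminus p) (kplus p) =
  (2 * (kzero p).1.1, 2 * (kzero p).1.2, 2 * (kzero p).2).
Proof. rewrite kplusE kzeroE; exact: sl2_mp. Qed.

Let bracket_0p : sl2_bracket (kzero p) (kplus p) =
  (1 * (kplus p).1.1, 1 * (kplus p).1.2, 1 * (kplus p).2).
Proof. rewrite kplusE kzeroE !mul1r; exact: sl2_0p. Qed.

Let bracket_0m : sl2_bracket (kzero p) (kminus p) =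
  (- 1 * (kminus p).1.1, - 1 * (kminus p).1.2, - 1 * (kminus p).2).
Proof. rewrite kzeroE !mulN1r; exact: sl2_0m. Qed.

Let p_neq0 : p%:C != 0 :> R[i].
Proof. by rewrite -r2E expf_neq0. Qed.

Let adj_0 : vconj (kzero p) = transpose p (kzero p).
Proof.
have -> : vconj (kzero p) = kzero p.
  by rewrite /kzero -!rmorphM -!rmorphN /= vconj_real.
by rewrite kzeroE /transpose -r2E {1}(sl2_adjoint_0 U r_neq0).
Qed.

Let adj_p : vconj (kminus p) = transpose p (kplus p).
Proof.
have -> : vconj (kminus p) = kminus p.
  by rewrite /kminus -[2](rmorph_nat (real_complex R)) -!rmorphM -!rmorphN /= vconj_real.
by rewrite kplusE /transpose -r2E /kminus -/U (sl2_adjoint_p U r_neq0).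
Qed.

Lemma L2_polynomials_dense : hdense (L2dot rho) dom.
Proof.
apply: (hdense_orthogonal (L2_hilbert rho)); first exact: domain_subspace.
move=> z orth; have z0 : {ae rho, forall eta, repr z eta = 0}.
  apply: (orthogonal_polynomials0 sfin p01 hrho); first exact: sqint_repr.
  move=> S mS aS F pF; have fS : finite_region S by split.
  have pcF := pol_conj mS pF.
  have [g cg] := pol_class p01 hrho fS pcF.
  have [mz _] := sqint_repr z.
  rewrite -(orth g (domain_of_pol p01 hrho fS pcF cg)).
  rewrite (L2dotE (pol_cmeasurable mS pcF) mz cg (L2_class_repr z)).
  by apply: eq_cintegral => eta; rewrite conjcK mulrC.
by apply: (L2_class_eq _ (L2_class0 rho)).
Qed.

Variable vac : L2 rho.
Hypothesis cvac : L2_class_of (fun=> 1) vac.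

Lemma vac_dom : dom vac.
Proof. by exists (fun=> 1) => //; exact: polynomial_fun_cst. Qed.

Lemma vac_norm : hnorm (L2dot rho) vac = 1.
Proof.
have m1 := @cmeasurable_cst _ (config X R) R 1.
rewrite /hnorm (L2dotE m1 m1 cvac cvac) /cintegral /=.
under eq_Rintegral do rewrite mulr1 mulr0 subr0.
rewrite Rintegral_cst// mul1r -[RHS]sqrtr1; congr Num.sqrt.
exact: (congr1 fine (probability_setT rho)).
Qed.

Lemma vac_class S : finite_region S -> L2_class_of (vacuum S) vac.
Proof.
move=> fS; apply: L2_class_ae cvac; apply: filterS (region_ae p01 hrho fS) => eta fin.
by rewrite /vacuum fin.
Qed.

Lemma current_vacuum S v phi eta : finite_region S -> test_on S phi ->
  cur S v phi (vacuum S) eta =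
  ((v.1.1 + v.1.2 + v.2) * cintegral eta phi + (v.1.1 + v.2 * 2^-1) * cintegral alpha phi)
    * vacuum S eta.
Proof.
move=> [mS aS] tphi; rewrite pol_currentE (raise_vacuum alpha tphi) (lower_vacuum msing mS tphi).
rewrite -[(number phi (vacuum S) + cintegral alpha phi *: vacuum S) eta]/
  (cintegral eta phi * vacuum S eta + cintegral alpha phi * vacuum S eta).
by rewrite -[number phi (vacuum S) eta]/(cintegral eta phi * vacuum S eta); ring.
Qed.

Lemma kzero_vac phi : ok phi -> k0 phi vac = (2^-1 * cintegral alpha phi) *: vac.
Proof.
move=> okphi; have [S [fS tphi]] := test_function_on okphi.
have c1 := op_class msing p01 hrho R0 fS tphi (@pol_vacuum _ X R S) (vac_class fS).
apply: L2_class_eq c1 _; apply: L2_class_ae (L2_class_scale _ (vac_class fS)).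
apply: aeW => eta; rewrite current_vacuum//; congr (_ * _).
rewrite kzeroE /=.
have -> : - (U * r) + - (U * r^-1) + U * (r + r^-1) = 0 by ring.
rewrite mul0r add0r; congr (_ * _).
have := UE; move: r_neq0 r2_neq1; move: r U => s V s0 s1 VE.
by rewrite (_ : V = s / (1 - s ^+ 2)) ?(canRL (mulfK s1) VE)//; field; rewrite s0 s1.
Qed.

Lemma kminus_vac phi : ok phi -> km phi vac = 0.
Proof.
move=> okphi; have [S [fS tphi]] := test_function_on okphi.
have c1 := op_class msing p01 hrho Rm fS tphi (@pol_vacuum _ X R S) (vac_class fS).
apply: L2_class_eq c1 _; apply: L2_class_ae (L2_class0 rho).
apply: aeW => eta; rewrite current_vacuum//; last exact: test_on_conj.
have -> : (kminus p).1.1 + (kminus p).1.2 + (kminus p).2 = 0 by rewrite /kminus /=; ring.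
have -> : (kminus p).1.1 + (kminus p).2 * 2^-1 = 0 
  by rewrite /kminus /= mulNr mulrAC divff ?pnatr_eq0// mul1r subrr.
by rewrite !mul0r addr0 mul0r.
Qed.

Local Notation W := (linear_span (creation_vector alpha kp vac)).

Lemma comm_0p phi theta f : ok phi -> ok theta -> dom f ->
  k0 phi (kp theta f) - kp theta (k0 phi f) = kp (fun x => phi x * theta x) f.
Proof.
move=> okphi oktheta df; rewrite -[RHS]scale1r.
apply: (op_bracket msing p01 hrho R0 Rp Rp bracket_0p erefl _ okphi oktheta df).
by move=> S; exact: test_onMt.
Qed.

Lemma comm_mp phi theta f : ok phi -> ok theta -> dom f ->
  km phi (kp theta f) - kp theta (km phi f) = 2 *: k0 (fun x => conjc (phi x) * theta x) f.
Proof.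
move=> okphi oktheta df.
apply: (op_bracket msing p01 hrho Rm Rp R0 bracket_mp erefl _ okphi oktheta df).
by move=> S /test_on_conj; exact: test_onMt.
Qed.

Lemma comm_0m phi theta f : ok phi -> ok theta -> dom f ->
  k0 phi (km theta f) - km theta (k0 phi f) = - km (fun x => conjc (phi x) * theta x) f.
Proof.
move=> okphi oktheta df.
rewrite -[RHS](scaleN1r (km (fun x => conjc (phi x) * theta x) f)).
have H := op_bracket msing p01 hrho R0 Rm Rm bracket_0m
  (phi := phi) (theta := theta) (chi := fun x => conjc (phi x) * theta x) (f := f).
apply: H => //; first by apply/funext => x; rewrite conjcM conjcK.
by move=> S /test_on_conj; exact: test_onMt.
Qed.

Lemma creation_dom : creation_vector alpha kp vac `<=` dom.
Proof.
move=> h; elim=> [|phi h' okphi _ dh]; first exact: vac_dom.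
exact: (op_dom msing p01 hrho Rp).
Qed.

Lemma span_invariant (A : L2 rho -> L2 rho) :
  (forall a f g, dom f -> dom g -> A (a *: f + g) = a *: A f + A g) ->
  (forall h, creation_vector alpha kp vac h -> W (A h)) -> forall h, W h -> W (A h).
Proof.
move=> linA WA h Wh.
have sW := linear_span_subspace (creation_vector alpha kp vac).
have [D0 DL] := domain_subspace alpha rho.
suff [] : [set h | dom h /\ W (A h)] h by [].
apply: (linear_span_min _ _ Wh); first by move=> g cg; split; [exact: creation_dom|exact: WA].
split.
  split=> //; have A0 : A 0 = 0.
    have := linA (-1) 0 0 D0 D0.
    by rewrite scaler0 addr0 scaleN1r addNr.
  by rewrite A0; case: sW.
move=> a f g [df Wf] [dg Wg]; split; first exact: DL.
by rewrite linA//; case: sW => _; apply.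
Qed.

Lemma kplus_span phi h : ok phi -> W h -> W (kp phi h).
Proof.
move=> okphi; apply: span_invariant.
  by move=> a f g df dg; exact: (op_lin msing p01 hrho _ Rp).
by move=> g cg; apply: linear_span_sub; exact: creation_step.
Qed.

(** A Cartan current is pushed through the creation operators to the vacuum, of
    which it makes a multiple. *)
Lemma kzero_span phi h : ok phi -> W h -> W (k0 phi h).
Proof.
have sW := linear_span_subspace (creation_vector alpha kp vac).
move=> okphi; apply: span_invariant.
  by move=> a f g df dg; exact: (op_lin msing p01 hrho _ R0).
move=> g cg; elim: cg phi okphi => [|theta g' oktheta cg' ih] phi okphi.
  rewrite kzero_vac//; apply: subspaceZ => //; apply: linear_span_sub.
  exact: creation_vacuum.
have dg' := creation_dom cg'.
have E := comm_0p okphi oktheta dg'.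
have -> : k0 phi (kp theta g') = kp (fun x => phi x * theta x) g' + kp theta (k0 phi g').
  by rewrite -E subrK.
apply: subspaceD => //.
  apply: kplus_span; last exact: linear_span_sub.
  exact: test_function_mul.
by apply: kplus_span => //; exact: ih.
Qed.

(** An annihilation current is pushed through the creation operators to the
    vacuum, which it kills; the commutators are Cartan currents. *)
Lemma kminus_span phi h : ok phi -> W h -> W (km phi h).
Proof.
have sW := linear_span_subspace (creation_vector alpha kp vac).
move=> okphi; apply: span_invariant.
  by move=> a f g df dg; exact: (op_lin msing p01 hrho _ Rm).
move=> g cg; elim: cg phi okphi => [|theta g' oktheta cg' ih] phi okphi.
  by rewrite kminus_vac//; case: sW.
have dg' := creation_dom cg'.
have E := comm_mp okphi oktheta dg'.
have -> : km phi (kp theta g') =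
    2 *: k0 (fun x => conjc (phi x) * theta x) g' + kp theta (km phi g').
  by rewrite -E subrK.
apply: subspaceD => //; last by apply: kplus_span => //; exact: ih.
apply: subspaceZ => //; apply: kzero_span; last exact: linear_span_sub.
by apply: test_function_mul => //; exact: test_function_conj.
Qed.

(** Multiplication by a count is a combination of the three currents, each of
    which leaves the span of the creation vectors invariant. *)
Lemma pol_span S F h : finite_region S -> pol S F -> L2_class_of F h -> W h.
Proof.
have sW := linear_span_subspace (creation_vector alpha kp vac).
move=> fS pF; have [mS aS] := fS.
elim: pF h => {F} [|phi F tphi pF ih|a F G pF ihF pG ihG] h ch.
- rewrite (L2_class_eq ch (vac_class fS)); apply: linear_span_sub.
  exact: creation_vacuum.
- have [g cg] := pol_class p01 hrho fS pF.
  have Wg := ih g cg.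
  have okphi := test_on_function fS tphi.
  have okc := test_function_conj okphi.
  have tc : test_on S (conjf phi) by exact: test_on_conj.
  have c1 := op_class msing p01 hrho Rp fS tphi pF cg.
  have c2 := op_class msing p01 hrho Rm fS tc pF cg.
  have c3 := op_class msing p01 hrho R0 fS tphi pF cg.
  have -> : h = U *: (kp phi g + km (conjf phi) g + (r + r^-1) *: k0 phi g)
      - (2^-1 * cintegral alpha phi) *: g.
    have c12 := L2_class_lin 1 c1 c2; rewrite scale1r in c12.
    have c123 := L2_class_lin (r + r^-1) c3 c12.
    rewrite addrC -scaleNr (addrC (kp phi g + km (conjf phi) g)).
    have cc := L2_class_lin (- (2^-1 * cintegral alpha phi)) cg (L2_class_scale U c123).
    apply: L2_class_eq ch _; apply: L2_class_ae cc; apply: aeW => eta.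
    have -> : (fun x => conjc (conjc (phi x))) = phi by apply/funext => x; rewrite conjcK.
    rewrite !pol_currentE kplusE kzeroE [kminus p]/kminus -/U mul1r.
    set A := raise _ _ _ _ _; set L := lower _ _ _ _.
    set C := (cintegral eta phi + _) * _.
    have := sl2_cartan r_neq0 UE r2_neq1 A L C => /= E.
    rewrite /number; set P := cintegral eta phi in C E *; set Q := cintegral alpha phi in C E *.
    (* Multiplication by the integral of [phi] is the Cartan term minus its constant. *)
    have CE : P * F eta = - (2^-1 * Q) * F eta + C by rewrite /C; ring.
    rewrite CE; congr (_ + _).
    have U0 : U != 0 by exact: (u_neq0 p01).
    apply: (mulfI U0); rewrite mulrA -expr2 E; congr (_ * _); ring.
  apply: subspaceD => //.
    apply: subspaceZ => //; apply: subspaceD => //.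
      by apply: subspaceD => //; [exact: kplus_span|exact: kminus_span].
    by apply: subspaceZ => //; exact: kzero_span.
  by rewrite -scaleNr; exact: subspaceZ.
- have [f cf] := pol_class p01 hrho fS pF; have [g cg] := pol_class p01 hrho fS pG.
  rewrite (L2_class_eq ch (L2_class_lin a cf cg)).
  by case: sW => _; apply; [exact: ihF|exact: ihG].
Qed.

Lemma creation_span_dense : hdense (L2dot rho) W.
Proof.
move=> h e e0; have [g dg he] := L2_polynomials_dense h e0.
exists g => //; have [S [F [fS _ pF cF]]] := domain_pol p01 hrho dg (finite_region0 alpha).
exact: (pol_span fS pF cF).
Qed.

Lemma pascal_fock_representation :
  fock_representation alpha (L2dot rho) dom kp k0 km vac.
Proof.
have ops K v tau phi : realizes alpha K v tau -> ok phi ->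
    operator_on dom (class_operator alpha (rho := rho) K phi).
  move=> HK okphi; split; first by move=> f; exact: (op_dom msing p01 hrho HK).
  by move=> a f g; exact: (op_lin msing p01 hrho a HK).
split.
- exact: L2_hilbert.
- exact: domain_subspace.
- exact: L2_polynomials_dense.
- by move=> phi okphi; split; [exact: (ops _ _ _ _ Rp)|exact: (ops _ _ _ _ R0)|exact: (ops _ _ _ _ Rm)].
- by move=> a phi theta f *; exact: (op_arg_lin msing p01 hrho Rp).
- by move=> a phi theta f *; exact: (op_arg_lin msing p01 hrho R0).
- move=> a phi theta f okphi oktheta df.
  apply: (op_arg_lin msing p01 hrho Rm) => //; apply/funext => x.
  by rewrite -[LHS]/(conjc (a * phi x + theta x)) conjcD conjcM.
- exact: comm_mp.
- exact: comm_0p.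
- exact: comm_0m.
- exact: (op_commute msing p01 hrho Rp).
- exact: (op_commute msing p01 hrho R0).
- exact: (op_commute msing p01 hrho Rm).
- move=> phi f g okphi df dg.
  apply: (op_adjoint msing p01 hrho R0 R0 adj_0) => //.
    by apply/funext => x /=; rewrite conjcK.
  by move=> S; exact: test_on_conj.
- move=> phi f g okphi df dg.
  apply: (op_adjoint msing p01 hrho Rp Rm adj_p) => //.
  by apply/funext => x /=; rewrite conjcK.
- exact: vac_dom.
- exact: vac_norm.
- exact: kminus_vac.
- exact: creation_span_dense.
Qed.

End fock_assembly.

(** * Meixner polynomials *)

Section poly_shift.
Context (R : idomainType).
Implicit Types (f g : {poly R}).

Lemma size_subn_leq f g n : (size f <= n.+1)%N -> (size g <= n.+1)%N -> (f`_n = g`_n :> R) ->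
  (size (f - g)%R <= n)%N.
Proof.
move=> /leq_sizeP sf /leq_sizeP sg fg; apply/leq_sizeP => j.
rewrite leq_eqVlt coefB => /orP[/eqP <-|nj]; first by rewrite fg subrr.
by rewrite sf// sg// subrr.
Qed.

Lemma size_shift f c : size (f \Po ('X + c%:P)) = size f.
Proof. by rewrite size_comp_poly2// size_XaddC. Qed.

(** A finite difference loses the leading term. *)
Lemma size_shift_sub f c : (size (f \Po ('X + c%:P) - f)%R <= (size f).-1)%N.
Proof.
have [->|f0] := eqVneq f 0; first by rewrite comp_poly0 subrr size_poly0.
have sf : size f = (size f).-1.+1 by rewrite prednK// size_poly_gt0.
apply: size_subn_leq; rewrite ?size_shift -?sf//.
have := @lead_coef_comp _ f ('X + c%:P); rewrite size_XaddC => /(_ isT).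
by rewrite lead_coefXaddC expr1n mulr1 /lead_coef size_shift.
Qed.

Lemma size_mulX_leq f n : (size f <= n.-1)%N -> (size ('X * f)%R <= n)%N.
Proof.
have [->|f0] := eqVneq f 0; first by rewrite mulr0 size_poly0.
rewrite mulrC size_mulX// => fn; case: n fn => [|n] //=.
by rewrite leqn0 size_poly_eq0 (negPf f0).
Qed.

Lemma size_scale_le (a : R) f n : (size f <= n)%N -> (size (a *: f)%R <= n)%N.
Proof. exact/leq_trans/size_scale_leq. Qed.

Lemma size_add_le f g n : (size f <= n)%N -> (size g <= n)%N -> (size (f + g)%R <= n)%N.
Proof. by move=> fn gn; apply: leq_trans (size_polyD _ _) _; rewrite geq_max fn. Qed.

End poly_shift.

(** One step of the summation by parts below, with the values of the two
    functions at neighbouring points as parameters. *)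
Lemma summation_by_parts (K : fieldType) (p a u x nu s f0 f1 f2 g0 g1 g2 : K) : p != 0 ->
  s + nu * (u * (x * (f1 * g0 - p^-1 * (f0 * g1)))) +
  nu * ((u * (p * ((x + a) * f2) + p^-1 * (x * f0) - (2 * x + a) * f1)) * g1) =
  s + nu * (f1 * (u * ((x + a) * g2 + x * g0 - (2 * x + a) * g1))) +
  u * (p * (x + a) * nu * (f2 * g1 - p^-1 * (f1 * g2))).
Proof. by move=> p0; field. Qed.

Section meixner.
Context (R : realType) (p a : R).
Hypotheses (p01 : 0 < p < 1) (a0 : 0 < a).
Implicit Types (f g : {poly R}).

Let u : R := (su11_c p)^-1.
Local Notation nu := (pascal_pmf p a).
Local Notation up f := (f \Po ('X + 1%:P)).
Local Notation dn f := (f \Po ('X + (-1)%:P)).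

(** The creation and annihilation operators of a single cell of mass [a]. *)
Definition creation f : {poly R} :=
  u *: (p *: (('X + a%:P) * up f) + p^-1 *: ('X * dn f) - (2 *: 'X + a%:P) * f).

Definition annihilation f : {poly R} :=
  u *: (('X + a%:P) * up f + 'X * dn f - (2 *: 'X + a%:P) * f).

Definition creation_poly n : {poly R} := iter n creation 1.

Lemma creationE f x : (creation f).[x] =
  u * (p * ((x + a) * f.[x + 1]) + p^-1 * (x * f.[x - 1]) - (2 * x + a) * f.[x]).
Proof. by rewrite /creation !hornerE !horner_comp !hornerE. Qed.

Lemma annihilationE f x : (annihilation f).[x] =
  u * ((x + a) * f.[x + 1] + x * f.[x - 1] - (2 * x + a) * f.[x]).
Proof. by rewrite /annihilation !hornerE !horner_comp !hornerE. Qed.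

Let p_neq0 : p != 0. Proof. by rewrite gt_eqF//; case/andP: p01. Qed.

Let uc2 : u * (p + p^-1 - 2) = su11_c p.
Proof.
have c0 : su11_c p != 0 by rewrite gt_eqF// su11_c_gt0.
apply: (mulIf c0); rewrite mulrAC mulVf// mul1r su11_cE//.
have s0 := sqrtp_gt0 p01; have := sqrtp_sqr p01; set s := Num.sqrt p in s0 *; move=> <-.
by field; rewrite gt_eqF.
Qed.

(** The coefficients of [annihilation] add up to zero, and what remains is a
    second-order difference times ['X] and a first-order difference. *)
Lemma annihilation_size f n : (size f <= n.+1)%N -> (size (annihilation f)%R <= n)%N.
Proof.
move=> sf; pose g := f - dn f.
have sg : (size g <= n)%N.
  rewrite -size_polyN opprB; apply: leq_trans (size_shift_sub _ _) _.
  by case: (size f) sf.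
have ug : up g = up f - f.
  rewrite /g comp_polyB; congr (_ - _); rewrite -comp_polyA comp_polyD comp_polyX comp_polyC.
  by rewrite -addrA -polyCD subrr addr0 comp_polyXr.
have -> : annihilation f = u *: ('X * (up g - g) + a *: up g).
  rewrite /annihilation; congr (_ *: _); rewrite ug /g -!mul_polyC; ring.
apply: size_scale_le; apply: size_add_le.
  apply: size_mulX_leq; apply: leq_trans (size_shift_sub _ _) _.
  by move: sg; case: (size g) => // k; case: n {sf}.
by apply: size_scale_le; rewrite size_shift.
Qed.

(** The coefficients of [creation] add up to [u (p + p^-1 - 2) = c] on the leading
    term; everything else is a finite difference or has the degree of [f]. *)
Lemma creation_lead f n b : (size (f - b *: ('X^n : {poly R}))%R <= n)%N ->
  (size (creation f - (su11_c p * b) *: ('X^(n.+1) : {poly R}))%R <= n.+1)%N.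
Proof.
move=> sf; set h := f - _ in sf.
have fE : f = b *: 'X^n + h by rewrite /h addrC subrK.
have sf1 : (size f <= n.+1)%N.
  rewrite fE; apply: size_add_le; last exact: leqW.
  by apply: size_scale_le; rewrite size_polyXn.
have -> : creation f - (su11_c p * b) *: 'X^(n.+1) =
    su11_c p *: ('X * h) + u *: (p *: ('X * (up f - f)) + (p * a) *: up f
      + p^-1 *: ('X * (dn f - f)) - a *: f).
  rewrite /creation exprS -uc2 -!mul_polyC.
  have -> : 'X * h = 'X * f - b%:P * ('X * 'X^n) by rewrite /h -mul_polyC; ring.
  rewrite !polyCM !polyCB !polyCD; ring.
have sm k : (size ('X * (f \Po ('X + k%:P) - f))%R <= n.+1)%N.
  apply: size_mulX_leq; apply: leq_trans (size_shift_sub _ _) _.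
  by case: (size f) sf1.
apply: size_add_le; first by apply: size_scale_le; exact: size_mulX_leq.
apply: size_scale_le; apply: size_add_le; last first.
  by rewrite size_polyN; exact: size_scale_le.
apply: size_add_le; last by apply: size_scale_le; exact: sm.
apply: size_add_le; first by apply: size_scale_le; exact: sm.
by apply: size_scale_le; rewrite size_shift.
Qed.

Lemma creation_poly_lead n : (size (creation_poly n - su11_c p ^+ n *: ('X^n : {poly R}))%R <= n)%N.
Proof.
elim: n => [|n ih]; first by rewrite /creation_poly /= expr0 scale1r subrr size_poly0.
by rewrite /creation_poly iterS exprS; exact: creation_lead.
Qed.

Definition orthogonal_poly f g : Prop :=
  series (fun x => nu x * (f.[x%:R] * g.[x%:R])) @ \oo --> (0 : R).

Let cvg_ext (v w : nat -> R) (l : R) : v =1 w -> v @ \oo --> l -> w @ \oo --> l.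
Proof. by move=> /funext ->. Qed.

Let cvg_lin b (v w : nat -> R) (l m : R) : v @ \oo --> l -> w @ \oo --> m ->
  (fun n => b * v n + w n) @ \oo --> b * l + m.
Proof. by move=> vl wm; apply: cvgD => //; apply: cvgM => //; exact: cvg_cst. Qed.

Lemma orthogonal_polyC f g : orthogonal_poly f g -> orthogonal_poly g f.
Proof.
rewrite /orthogonal_poly.
by rewrite (_ : (fun x => _) = (fun x => nu x * (g.[x%:R] * f.[x%:R])))//; apply/funext => x; ring.
Qed.

Lemma orthogonal_poly_lin f b g h : orthogonal_poly f g -> orthogonal_poly f h ->
  orthogonal_poly f (b *: g + h).
Proof.
move=> fg fh; rewrite /orthogonal_poly.
have := cvg_lin (b := b) fg fh; rewrite mulr0 addr0 => H.
apply: (cvg_ext _ H) => n.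
rewrite /series /= mulr_sumr -big_split.
by apply: eq_bigr => i _; rewrite hornerD hornerZ /=; ring.
Qed.

Lemma pmf_poly_cvg0 f : (fun n => nu n * f.[n%:R]) @ \oo --> (0 : R).
Proof.
suff H k : (fun n => n%:R ^+ k * nu n * f.[n%:R]) @ \oo --> (0 : R).
  by have := H 0%N; under eq_fun do rewrite expr0 mul1r.
elim/poly_ind: f k => [|f c ih] k.
  by under eq_fun do rewrite horner0 mulr0; exact: cvg_cst.
have := cvg_lin (b := c) (pascal_pmf_moment_cvg0 p01 k (ltW a0)) (ih k.+1).
rewrite mulr0 addr0 => H; apply: (cvg_ext _ H) => n.
by rewrite hornerMXaddC exprS; ring.
Qed.

(** Summation by parts: the recursion of the weights makes the partial sums
    agree up to a boundary term, which vanishes in the limit. *)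
Lemma creation_adjoint f g : orthogonal_poly f (annihilation g) ->
  orthogonal_poly (creation f) g.
Proof.
move=> fg; pose b := u *: ('X * (f * dn g - p^-1 *: (dn f * g))).
have bE n : b.[n%:R] = u * (n%:R *
    (f.[n%:R] * g.[n%:R - 1] - p^-1 * (f.[n%:R - 1] * g.[n%:R]))).
  by rewrite /b !hornerE !horner_comp !hornerE.
have E n : series (fun x => nu x * ((creation f).[x%:R] * g.[x%:R])) n =
    series (fun x => nu x * (f.[x%:R] * (annihilation g).[x%:R])) n + nu n * b.[n%:R].
  elim: n => [|n ih]; first by rewrite /series /= !big_geq// bE mul0r !mulr0 addr0.
  rewrite /series /= !big_nat_recr//= in ih *.
  rewrite ih; have e := pascal_pmfS p a n.
  have -> : nu n.+1 * b.[n.+1%:R] = u * (p * (n%:R + a) * nu n *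
      (f.[n.+1%:R] * g.[n%:R] - p^-1 * (f.[n%:R] * g.[n.+1%:R]))).
    by rewrite bE -e -natr1 addrK; ring.
  rewrite creationE annihilationE bE -[n.+1%:R]natr1.
  exact: summation_by_parts.
rewrite /orthogonal_poly.
have := cvg_lin (b := 1) fg (pmf_poly_cvg0 b); rewrite mulr0 addr0 => H.
apply: (cvg_ext _ H) => n.
by rewrite E mul1r.
Qed.

Lemma orthogonal_poly0 f : orthogonal_poly f 0.
Proof.
rewrite /orthogonal_poly; apply: (cvg_ext _ (cvg_cst 0)) => n.
by rewrite /series /= big1// => i _; rewrite horner0 !mulr0.
Qed.

Lemma creation_poly_orthogonal n g : (size g <= n)%N -> orthogonal_poly (creation_poly n) g.
Proof.
elim: n g => [|n ih] g sg.
  move: sg; rewrite leqn0 size_poly_eq0 => /eqP ->; exact: orthogonal_poly0.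
by rewrite /creation_poly iterS; apply: creation_adjoint; apply: ih; exact: annihilation_size.
Qed.

(** Every weight is positive, so that [f] vanishes at every integer. *)
Lemma orthogonal_poly_self f : orthogonal_poly f f -> forall n, f.[n%:R] = 0.
Proof.
move=> ff n.
have t0 k : 0 <= nu k * (f.[k%:R] * f.[k%:R]).
  by apply: mulr_ge0; [rewrite pascal_pmf_ge0 ?ltW|rewrite -expr2 sqr_ge0].
have nd : nondecreasing_seq (series (fun x => nu x * (f.[x%:R] * f.[x%:R]))).
  exact: nondecreasing_series.
have := nondecreasing_cvgn_le nd (cvgP _ ff) n.+1.
rewrite (cvg_lim _ ff)// /series /= big_nat_recr//= => h.
have : nu n * (f.[n%:R] * f.[n%:R]) <= 0.
  by apply: le_trans h; rewrite lerDr sumr_ge0.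
by rewrite pmulr_rle0 ?pascal_pmf_gt0// -expr2 => h2; apply/eqP; rewrite -sqrf_eq0 eq_le h2 sqr_ge0.
Qed.

(** The difference has degree less than [n] and is orthogonal to such polynomials,
    hence to itself. *)
Lemma meixner_creation_poly (M : nat -> {poly R}) : meixner_polynomials p a M ->
  forall n k, (creation_poly n).[k%:R] = su11_c p ^+ n * (M n).[k%:R].
Proof.
move=> [sM mM oM] n k; pose c := su11_c p.
have c0 : c ^+ n != 0 by rewrite expf_neq0// gt_eqF// su11_c_gt0.
have Mlow m g : (m <= n)%N -> (size g <= m)%N -> orthogonal_poly (M n) g.
  elim: m g => [|m ih] g mn sg.
    by move: sg; rewrite leqn0 size_poly_eq0 => /eqP ->; exact: orthogonal_poly0.
  have sr : (size (g - g`_m *: M m)%R <= m)%N.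
    apply: size_subn_leq => //; first by apply: size_scale_le; rewrite sM.
    have := mM m; rewrite monicE /lead_coef sM /= => /eqP e.
    by rewrite coefZ e mulr1.
  have -> : g = g`_m *: M m + (g - g`_m *: M m) by rewrite addrC subrK.
  apply: orthogonal_poly_lin; last by apply: ih => //; exact: ltnW.
  by apply: oM; rewrite gtn_eqF.
pose D := creation_poly n - c ^+ n *: M n.
have sD : (size D <= n)%N.
  have -> : D = (creation_poly n - c ^+ n *: 'X^n) + c ^+ n *: ('X^n - M n).
    by rewrite /D -!mul_polyC; ring.
  apply: size_add_le; first exact: creation_poly_lead.
  apply: size_scale_le; apply: size_subn_leq; rewrite ?size_polyXn ?sM//.
  by have := mM n; rewrite monicE /lead_coef sM /= => /eqP ->; rewrite coefXn eqxx.
have /orthogonal_poly_self /(_ k) : orthogonal_poly D D.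
  have o1 := orthogonal_polyC (creation_poly_orthogonal sD).
  have o2 := orthogonal_polyC (Mlow n D (leqnn n) sD).
  have := orthogonal_poly_lin (- c ^+ n) o2 o1.
  by rewrite scaleNr addrC.
by rewrite /D !hornerE => /eqP; rewrite subr_eq0 => /eqP.
Qed.

End meixner.

(** * Creation operators of disjoint cells *)

Section creation_on_cells.
Context d (X : measurableType d) (R : realType).
Hypothesis msing : forall x : X, measurable [set x].
Variables (alpha : {measure set X -> \bar R}) (S : set X).
Hypotheses (mS : measurable S) (alphaS : (alpha S < +oo)%E).
Variables (T : finType) (C : T -> set X).
Hypotheses (mC : forall t, measurable (C t)) (tC : trivIset [set: T] C).
Hypothesis CS : forall t, C t `<=` S.
Variable p : R.
Implicit Types (eta : config X R) (F : config X R -> R[i]).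
Implicit Types (t s : T) (n : {ffun T -> nat}) (g : T -> {poly R}).

Local Notation icell := (@cell _ X R T C).
Local Notation a t := (fine (alpha (C t))).

Definition decr t n : {ffun T -> nat} := [ffun s => (n s - (s == t))%N].

Lemma incrK t : cancel (incr t) (decr t).
Proof. by move=> n; apply/ffunP => s; rewrite !ffunE addnK. Qed.

(** On functions of the counts the integrands are constant on the cell, and the
    operator becomes a difference operator in one count. *)
Lemma Kplus_cell t F (Q : {ffun T -> nat} -> R[i]) eta :
  (forall eta, (eta S < +oo)%E -> F eta = Q (counts C eta)) -> (eta S < +oo)%E ->
  Kplus alpha p (icell t) F eta =
  let n := counts C eta in let x := (n t)%:R%:C in
  (su11_c p)^-1%:C * (p%:C * ((x + (a t)%:C) * Q (incr t n)) +
    p^-1%:C * (x * Q (decr t n)) - (2 * x + (a t)%:C) * Q n).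
Proof.
move=> FQ fin; have tcell := test_cell R mC CS t.
have nE : fine (eta (C t)) = (counts C eta t)%:R by rewrite (fine_count mS mC CS)// ffunE.
have ie : cintegrable eta (icell t) by exact: (test_integrable mS fin).
have ia : cintegrable alpha (icell t) by exact: (test_integrable mS alphaS).
rewrite /Kplus (FQ eta fin).
have -> : cintegral (measure_add eta alpha) (fun x => icell t x * F (config_add eta x)) =
    ((counts C eta t)%:R%:C + (a t)%:C) * Q (incr t (counts C eta)).
  rewrite (@eq_cintegral _ _ _ _ _ (fun x => Q (incr t (counts C eta)) * icell t x)); last first.
    move=> x; rewrite /cell indicE; case: (pselect (C t x)) => Cx.
      by rewrite mem_set// mulr1 mul1r FQ ?config_add_fin// (counts_add mS mC tC CS fin Cx).
    by rewrite memNset// mul0r mulr0.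
  rewrite cintegral_measure_add; [|exact: cintegrableZ..].
  by rewrite !cintegralZ// !(cintegral_cell mC) nE -mulrDr mulrC.
have -> : cintegral eta (fun x => icell t x * F (config_sub eta x)) =
    (counts C eta t)%:R%:C * Q (decr t (counts C eta)).
  rewrite (cintegral_sub_points msing F mS fin tcell).
  rewrite -nE -(cintegral_cell mC) (cintegral_points mS fin (f := icell t)); [|by case: tcell..].
  rewrite mulr_suml; apply: eq_big_seq => x xs.
  rewrite /cell indicE; case: (pselect (C t x)) => Cx; last by rewrite memNset// !mul0r.
  have sfin := config_sub_fin fin xs fin.
  by rewrite FQ// -{2}(config_subK fin xs) (counts_add mS mC tC CS sfin Cx) incrK.
rewrite !(cintegral_cell mC) nE /=.
set x := _%:C; set A := (a t)%:C; set u := _^-1%:C; ring.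
Qed.

Definition cell_product g n : R[i] := (\prod_s (g s).[(n s)%:R])%:C.

Definition upd g t (f : {poly R}) : T -> {poly R} := fun s => if s == t then f else g s.

(** A vanishing count makes the value at its predecessor irrelevant, so that the
    truncated subtraction agrees with the difference operator on polynomials. *)
Lemma Kplus_cell_product t F g eta :
  (forall eta, (eta S < +oo)%E -> F eta = cell_product g (counts C eta)) -> (eta S < +oo)%E ->
  Kplus alpha p (icell t) F eta =
  cell_product (upd g t (creation p (a t) (g t))) (counts C eta).
Proof.
move=> FQ fin; rewrite (Kplus_cell t FQ fin) /=; set n := counts C eta.
pose rest := \prod_(s | s != t) (g s).[(n s)%:R].
have restE (h : T -> {poly R}) (m : {ffun T -> nat}) : (forall s, s != t -> h s = g s) ->
    (forall s, s != t -> m s = n s) -> cell_product h m = ((h t).[(m t)%:R] * rest)%:C.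
  move=> hg mn; rewrite /cell_product (bigD1 t)//=; congr (_ * _)%:C.
  by apply: eq_bigr => s st; rewrite hg// mn.
rewrite (restE g (incr t n))//; last by move=> s st; rewrite ffunE (negPf st) addn0.
rewrite (restE g (decr t n))//; last by move=> s st; rewrite ffunE (negPf st) subn0.
rewrite (restE g n)// (restE (upd _ _ _) n)//; last by move=> s st; rewrite /upd (negPf st).
rewrite /upd eqxx creationE !ffunE eqxx addn1 -natr1.
have -> : (count (C t) eta)%:R%:C * ((g t).[(count (C t) eta - 1)%:R] * rest)%:C =
    ((count (C t) eta)%:R * (g t).[(count (C t) eta)%:R - 1] * rest)%:C :> R[i].
  rewrite -rmorphM; congr (_%:C); rewrite mulrA.
  (* Only at a vanishing count do [n - 1] and its real counterpart differ. *)
  case: (count (C t) eta) => [|k]; first by rewrite !mul0r.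
  by rewrite subn1 /= -[X in _ = _ * _.[X - 1] * _]natr1 addrK.
rewrite -[2](rmorph_nat (real_complex R)) -!(rmorphM, rmorphD, rmorphB).
by congr (_%:C); ring.
Qed.

Lemma iter_Kplus_cell t k F g :
  (forall eta, (eta S < +oo)%E -> F eta = cell_product g (counts C eta)) ->
  forall eta, (eta S < +oo)%E ->
  iter k (Kplus alpha p (icell t)) F eta =
  cell_product (upd g t (iter k (creation p (a t)) (g t))) (counts C eta).
Proof.
move=> FQ; elim: k => [|k ih] eta fin.
  rewrite /= FQ//; congr cell_product; apply/funext => s.
  by rewrite /upd; case: eqP => // ->.
rewrite iterS (Kplus_cell_product t ih fin); congr cell_product; apply/funext => s.
by rewrite /upd eqxx; case: eqP.
Qed.

Lemma foldr_Kplus_cell (k : T -> nat) (r : seq T) : uniq r ->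
  forall eta, (eta S < +oo)%E ->
  foldr (fun t F => iter (k t) (Kplus alpha p (icell t)) F) (fun=> 1) r eta =
  cell_product (fun t => if t \in r then creation_poly p (a t) (k t) else 1) (counts C eta).
Proof.
elim: r => [_ eta fin|t r ih /= /andP[tr ur] eta fin].
  by rewrite /= /cell_product big1// => s _; rewrite hornerC.
rewrite (iter_Kplus_cell t (k t) (ih ur) fin); congr cell_product; apply/funext => s.
rewrite /upd inE; case: eqP => [->|//]; by rewrite (negPf tr).
Qed.

End creation_on_cells.

Theorem theorem3p9 (R : realType) (d : measure_display) (X : measurableType d)
    (alpha : {sigma_finite_measure set X -> \bar R}) (p : R)
    (rho : probability (config X R) R) (M : R -> nat -> {poly R})
    (hX : borel_space R X) (hp : 0 < p < 1)
    (hrho : pascal_process p alpha rho)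
    (hM : forall a : R, 0 < a -> meixner_polynomials p a (M a)) :
  (exists (kp k0 km : (X -> R[i]) -> L2 rho -> L2 rho) (vac : L2 rho),
     (forall F : config X R -> R[i], polynomial_fun alpha F ->
        exists h : L2 rho, L2_class_of F h) /\
     induced_operators alpha (Kplus alpha p) kp /\
     induced_operators alpha (Kzero alpha p) k0 /\
     induced_operators alpha (Kminus alpha p) km /\
     L2_class_of (fun=> 1) vac /\
     fock_representation alpha (L2dot rho) (polynomial_domain alpha rho)
       kp k0 km vac) /\
  (forall (l : nat) (B : 'I_l -> set X) (n : 'I_l -> nat),
     (0 < l)%N -> (forall j, measurable (B j)) -> trivIset [set: 'I_l] B ->
     (forall j, (0 < alpha (B j) < +oo)%E) -> (forall j, (0 < n j)%N) ->
     {ae rho, forall eta : config X R,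
        foldr (fun j G => iter (n j) (Kplus alpha p \1_(B j)) G) (fun=> 1)
          (enum 'I_l) eta
        = \prod_(j < l) ((su11_c p ^+ n j)%:C *
            ((M (fine (alpha (B j))) (n j)).[fine (eta (B j))])%:C)}).
Proof.
have msing := borel_space_measurable_set1 hX.
have sfin : sigma_finite [set: X] alpha := sigma_finiteT alpha.
split.
  have [vac cvac] := polynomial_class hp hrho (polynomial_fun_cst alpha 1).
  exists (class_operator alpha (Kplus alpha p)), (class_operator alpha (Kzero alpha p)),
    (class_operator alpha (Kminus alpha p)), vac; split.
    by move=> F; exact: (polynomial_class hp hrho).
  split; first exact: (op_induced msing hp hrho (realizes_Kplus msing alpha p)).
  split; first exact: (op_induced msing hp hrho (realizes_Kzero msing alpha hp)).
  split; first exact: (op_induced msing hp hrho (realizes_Kminus msing alpha p)).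
  by split=> //; exact: (pascal_fock_representation msing sfin hp hrho cvac).
move=> l B n l0 mB tB aB n0.
pose S := \big[setU/set0]_(j < l) B j.
have [mS aS] : finite_region alpha S.
  apply: big_ind => [|A A' fA fA'|j _].
  - exact: finite_region0.
  - exact: finite_regionU.
  - by split=> //; case/andP: (aB j).
have BS j : B j `<=` S by move=> x Bx; rewrite /S (bigD1 j)//=; left.
apply: filterS (pascal_fin_ae hp hrho mS aS) => eta fin.
have cE j : \1_(B j) = @cell _ X R _ B j.
  by apply/funext => x; rewrite /cell !indicE; case: (_ \in _).
have -> : foldr (fun j G => iter (n j) (Kplus alpha p \1_(B j)) G) (fun=> 1) (enum 'I_l) =
    foldr (fun j G => iter (n j) (Kplus alpha p (cell R B j)) G) (fun=> 1) (enum 'I_l).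
  by elim: (enum 'I_l) => //= j r ->; rewrite cE.
rewrite (foldr_Kplus_cell msing mS aS mB tB BS p n (enum_uniq 'I_l) fin).
rewrite /cell_product rmorph_prod; apply: eq_bigr => j _ /=.
rewrite mem_enum inE ffunE (fine_count mS mB BS j fin) -rmorphM /=.
have a0 : 0 < fine (alpha (B j)).
  by apply: fine_gt0; exact: aB.
by rewrite (meixner_creation_poly hp a0 (hM _ a0)).
Qed.
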